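(* For every integer $r\ge 2$ there is a constant $\alpha=\alpha(r)>0$, depending only on $r$, such that for every $\xi\in(0,1)$ there are constants $c,C>0$, depending only on $r$ and $\xi$, for which the following holds for all integers $n\ge1$, all $p\in(0,1-\xi]$ and all real $\varepsilon\ge n^{-\alpha}$. Let $X=X_{r,n,p}$ be the number of copies of $K_{1,r}$ in $G_{n,p}$, let $\mu:=\mathbb{E}X$, $\sigma^2:=\operatorname{Var}X$, $\varphi(x):=(1+x)\log(1+x)-x$, and $$\Phi(\varepsilon):=\min\Bigl\{\varphi(\varepsilon)\mu^2/\sigma^2,\ \max\bigl\{(\varepsilon\mu)^{1/r},\ (\varepsilon\mu)/n^{r-1}\bigr\}\log(e/p)\Bigr\}.$$ If $1\le(1+\varepsilon)\mu\le X_{r,n,1}$ and $\Phi(\varepsilon)\ge1$, then $$c\,\Phi(\varepsilon)\ \le\ -\log\mathbb{P}\bigl(X\ge(1+\varepsilon)\mu\bigr)\ \le\ C\,\Phi(\varepsilon).$$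
   Context: $G_{n,p}$ is the binomial random graph on the vertex set $\{1,\dots,n\}$, in which each of the $\binom n2$ possible edges is present independently with probability $p$. $K_{1,r}$ is the star with $r$ edges. A copy of $K_{1,r}$ in a graph is a (not necessarily induced) subgraph isomorphic to $K_{1,r}$. $X_{r,n,1}$ is the (deterministic) number of copies of $K_{1,r}$ in the complete graph $K_n$, i.e. $n\binom{n-1}{r}$ for $r\ge2$. $\log$ is the natural logarithm. The parameter $\varepsilon$ may depend on $n$. (The hypothesis $1\le(1+\varepsilon)\mu\le X_{r,n,1}$ forces $n\ge r+1$, so $\sigma^2>0$.) *)

(* Defs.v *)
From HB Require Import structures.
From mathcomp Require Import all_boot all_order all_algebra.
From mathcomp Require Import reals sequences exp.

Set Implicit Arguments.
Unset Strict Implicit.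
Unset Printing Implicit Defensive.

Import Order.TTheory GRing.Theory Num.Theory.

Local Open Scope ring_scope.

(* A simple graph on the vertex set 'I_n is given by its edge set, a set of
   two-element subsets of 'I_n. *)
Definition complete_graph (n : nat) : {set {set 'I_n}} :=
  [set e : {set 'I_n} | #|e| == 2%N].

(* The star K_{1,r} on the vertex set 'I_r.+1, with centre ord0. *)
Definition star (r : nat) : {set {set 'I_r.+1}} :=
  [set [set ord0; lift ord0 i] | i : 'I_r].

(* A subgraph is a pair (vertex set, edge set); copies of K_{1,r} in G are the
   subgraphs of G isomorphic to K_{1,r}, counted as subgraphs (not as
   embeddings) and not required to be induced. *)
Definition star_copies (r n : nat) (G : {set {set 'I_n}}) :
    {set {set 'I_n} * {set {set 'I_n}}} :=
  [set H : {set 'I_n} * {set {set 'I_n}} | (H.2 \subset G) &&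
     [exists f : {ffun 'I_r.+1 -> 'I_n},
        [&& injectiveb f,
            H.1 == f @: [set: 'I_r.+1] &
            H.2 == [set f @: e | e : {set 'I_r.+1} in star r]]]].

Definition nb_stars (r n : nat) (G : {set {set 'I_n}}) : nat :=
  #|star_copies r G|.

Section BinomialRandomGraph.
Variables (R : realType) (n : nat) (p : R).

Definition Gnp_weight (G : {set {set 'I_n}}) : R :=
  \prod_(e in complete_graph n) (if e \in G then p else 1 - p).

Definition Gnp_prob (A : pred {set {set 'I_n}}) : R :=
  \sum_(G in powerset (complete_graph n) | A G) Gnp_weight G.

Definition Gnp_expect (Y : {set {set 'I_n}} -> R) : R :=
  \sum_(G in powerset (complete_graph n)) Gnp_weight G * Y G.

Definition Gnp_var (Y : {set {set 'I_n}} -> R) : R :=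
  Gnp_expect (fun G => (Y G - Gnp_expect Y) ^+ 2).

End BinomialRandomGraph.

Section StarUpperTail.
Variables (R : realType) (r n : nat) (p : R).

Definition star_count (G : {set {set 'I_n}}) : R := (nb_stars r G)%:R.

Definition star_mean : R := Gnp_expect p star_count.

Definition star_var : R := Gnp_var p star_count.

Definition star_upper_tail (eps : R) : R :=
  Gnp_prob p (fun G => (1 + eps) * star_mean <= star_count G).

Definition phi (x : R) : R := (1 + x) * ln (1 + x) - x.

Definition Phi (eps : R) : R :=
  Num.min (phi eps * star_mean ^+ 2 / star_var)
    (Num.max ((eps * star_mean) `^ (r%:R^-1))
             (eps * star_mean / n%:R ^+ r.-1)
     * ln (expR 1 / p)).

End StarUpperTail.

(* Main.v *)
(**
Write d = n p, x = eps mu, y = x^(1/r), L = log (e / p), M = max (y, x / n^(r-1)),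
so that Phi is the minimum of G = phi(eps) mu^2 / sigma^2 and M L.

Decay of the tail.  Cut the degrees at a threshold D of order max (1, d), up to a
small power of n.  Stars with centre of degree below D: an edge lies in at most
2 D^(r-1) of them, so an excess of eps mu / 2 such stars yields many k-tuples of
edge-disjoint stars, whose expected number is at most mu^k; Markov's inequality
with k of order x / D^(r-1) applies.  Stars with centre of degree at least D: by
Finner's inequality (every edge meets two vertices) the sum of
deg v log (deg v / d) over these vertices has a bounded exponential moment, and an
excess of eps mu / 2 stars forces this sum to be at least of order M L.  When Phi
is bounded, Cantelli's inequality suffices.

Lower bound for the tail.  Planting a star or a set of full vertices, which costs
p^|F| with |F| of order M, gives M L.  For G: if d >= 1 and eps is small, tilt
the edge probability to (1 + K eps) p and apply Cauchy-Schwarz to the change of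
measure; if d <= 1 and x is small compared with sqrt n, plant about x
vertex-disjoint random stars and compare the x-th moment of X with its size on
the resulting event; in the remaining cases M L is of order at most G.
*)

Require Import Defs.
From mathcomp Require Import all_boot all_order all_algebra.
From mathcomp Require Import ring lra zify.
From mathcomp Require Import reals sequences exp.

Set Implicit Arguments.
Unset Strict Implicit.
Unset Printing Implicit Defensive.

Import Order.TTheory GRing.Theory Num.Theory.
Local Open Scope ring_scope.

(** * Expectations over a random subset *)

(** Up to constants depending on r and xi, G is x log (1 + eps) / max (1, d)^(r-1): phi(eps) is of
    order eps log (1 + eps), and sigma^2 of order mu max (1, d)^(r-1). Light stars below a threshold
    D give the exponent x log (1 + eps) / D^(r-1), which is the right one for D of order max (1, d).

    The obstacle is that the degree tail must beat a union over all degrees, which for d >= n^-alpha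
    forces D above log n even when d is bounded. The threshold is then raised to max (d, n^alpha),
    and in the resulting gap d < n^alpha it is M L, not G, that the light exponent has to beat. The
    hypothesis eps >= n^-alpha leaves room for this: with alpha = 1 / (16 r), y exceeds d by a
    factor n^(15 alpha) up to a constant, so powers of n^alpha are cheap.

    The heavy part rests on convexity: a vertex of degree t costs t log (t / d) and carries at most
    t^r stars, so stars are cheapest at the largest useful degree, which is y, or n when y exceeds
    n. These are the two terms of M, and the two planted shapes match them. *)

Section ProductExpectation.
Variables (R : realType) (T : finType).
Implicit Types (p : R) (E F G : {set T}) (f g : {set T} -> R).

(** The ground set is a parameter so that identities can be proved by adding one element at a time.
    At [complete_graph n] this is [Gnp_expect] by conversion. *)
Definition pexp p E f : R :=
  \sum_(G in powerset E) (\prod_(e in E) (if e \in G then p else 1 - p)) * f G.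

Lemma pexp_set0 p f : pexp p set0 f = f set0.
Proof.
by rewrite /pexp powerset0 big_set1 big_pred0 ?mul1r // => x; rewrite inE.
Qed.

Lemma eq_pexp p E f g :
  (forall G, G \subset E -> f G = g G) -> pexp p E f = pexp p E g.
Proof.
by move=> fg; apply: eq_bigr => G; rewrite powersetE => /fg ->.
Qed.

Lemma pexp_setU1 p E (e : T) f : e \notin E ->
  pexp p (e |: E) f =
  p * pexp p E (fun G => f (e |: G)) + (1 - p) * pexp p E f.
Proof.
move=> eE; rewrite /pexp (bigID (fun G : {set T} => e \in G)) /=.
rewrite (reindex_onto (fun G => e |: G) (fun G => G :\ e)) /=; last first.
  by move=> G /andP[_ eG]; rewrite setD1K.
rewrite !big_distrr /=; congr (_ + _).
  apply: eq_big => [G|G].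
    rewrite !powersetE setU11 andbT; apply/andP/idP => [[]|GE].
      move=> sGE /eqP eGG; apply/subsetP => x xG.
      have := subsetP sGE x; rewrite !inE xG orbT => /(_ isT).
      case/orP=> // /eqP xe; move: xG; rewrite xe -eGG !inE eqxx //.
    split; first exact: setUS.
    rewrite setU1K //; apply: contra eE; exact: (subsetP GE).
  rewrite !powersetE => /andP[/andP[_ _] /eqP eGG].
  rewrite big_setU1 //= setU11 -!mulrA; congr (_ * (_ * _)).
  apply: eq_bigr => x xE; rewrite !inE.
  by case: eqP => // xe; move: xE; rewrite xe (negbTE eE).
apply: eq_big => [G|G].
  rewrite !powersetE; apply/andP/idP => [[sGE eG]|GE].
    apply/subsetP => x xG; have := subsetP sGE x xG.
    by rewrite !inE; case/orP=> // /eqP xe; move: eG; rewrite -xe xG.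
  split; first by apply: subset_trans GE _; exact: subsetUr.
  by apply: contra eE; exact: (subsetP GE).
move=> /andP[_ eG]; rewrite big_setU1 //= (negbTE eG) mulrA.
by [].
Qed.

Lemma pexp_setD1 p E (e : T) f : e \in E ->
  pexp p E f =
  p * pexp p (E :\ e) (fun G => f (e |: G)) + (1 - p) * pexp p (E :\ e) f.
Proof. by move=> eE; rewrite -{1}(setD1K eE) pexp_setU1 // !inE eqxx. Qed.

Lemma set_ind1 (P : {set T} -> Prop) :
  P set0 -> (forall (e : T) E, e \notin E -> P E -> P (e |: E)) ->
  forall E, P E.
Proof.
move=> P0 PS E; have [n] := ubnP #|E|; elim: n E => // n IH E En.
have [->//|[e eE]] := set_0Vmem E.
rewrite -(setD1K eE); apply: PS; first by rewrite !inE eqxx.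
by apply: IH; move: En; rewrite (cardsD1 e E) eE.
Qed.

Lemma pexpD p E f g : pexp p E (fun G => f G + g G) = pexp p E f + pexp p E g.
Proof. by rewrite /pexp -big_split; apply: eq_bigr => G _; rewrite mulrDr. Qed.

Lemma pexpZ p E (c : R) f : pexp p E (fun G => c * f G) = c * pexp p E f.
Proof. by rewrite /pexp big_distrr; apply: eq_bigr => G _; rewrite mulrCA. Qed.

Lemma pexpN p E f : pexp p E (fun G => - f G) = - pexp p E f.
Proof. by rewrite /pexp -sumrN; apply: eq_bigr => G _; rewrite mulrN. Qed.

Lemma pexpB p E f g : pexp p E (fun G => f G - g G) = pexp p E f - pexp p E g.
Proof. by rewrite pexpD pexpN. Qed.

Lemma pexp_sum p E (I : Type) (r : seq I) (P : pred I) (F : I -> {set T} -> R) :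
  pexp p E (fun G => \sum_(i <- r | P i) F i G)
  = \sum_(i <- r | P i) pexp p E (F i).
Proof.
by rewrite /pexp exchange_big; apply: eq_bigr => G _; rewrite mulr_sumr.
Qed.

Lemma pexp_cst p E (c : R) : pexp p E (fun=> c) = c.
Proof.
elim/set_ind1: E => [|e E eE IH]; first by rewrite pexp_set0.
by rewrite pexp_setU1 // IH; ring.
Qed.

Lemma ler_pexp p E f g : 0 <= p -> p <= 1 ->
  (forall G, G \subset E -> f G <= g G) -> pexp p E f <= pexp p E g.
Proof.
move=> p0 p1 fg; apply: ler_sum => G; rewrite powersetE => GE.
apply: ler_wpM2l (fg _ GE); apply: prodr_ge0 => e _; case: ifP => // _.
by rewrite subr_ge0.
Qed.

Lemma pexp_ge0 p E f : 0 <= p -> p <= 1 ->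
  (forall G, G \subset E -> 0 <= f G) -> 0 <= pexp p E f.
Proof. by move=> p0 p1 f0; rewrite -(pexp_cst p E 0); apply: ler_pexp. Qed.

Lemma pexp_mem p E (e : T) f : e \in E ->
  pexp p E (fun G => (e \in G)%:R * f G) = p * pexp p E (fun G => f (e |: G)).
Proof.
move=> eE; rewrite !(pexp_setD1 _ _ eE).
under [X in p * X + _ = _]eq_pexp => G _ do rewrite setU11 mul1r.
rewrite [X in _ + _ * X](_ : _ = 0); last first.
  rewrite (@eq_pexp _ _ _ (fun=> 0)) ?pexp_cst // => G GE.
  case: (boolP (e \in G)) => [/(subsetP GE)|_]; last by rewrite mul0r.
  by rewrite !inE eqxx.
under [X in p * (p * X + _)]eq_pexp => G _ do rewrite setUA setUid.
by ring.
Qed.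

(** Conditioning on the presence of F leaves the other elements independent. Planting a subgraph
    therefore costs exactly the factor p^|F|. *)
Lemma pexp_plant p E F f : F \subset E ->
  pexp p E (fun G => (F \subset G)%:R * f G)
  = p ^+ #|F| * pexp p E (fun G => f (F :|: G)).
Proof.
elim/set_ind1: F f => [|e F eF IH] f FE.
  rewrite cards0 expr0 mul1r; apply: eq_pexp => G _.
  by rewrite sub0set mul1r set0U.
move: FE; rewrite subUset sub1set => /andP[eE FE].
transitivity (pexp p E (fun G => (e \in G)%:R * ((F \subset G)%:R * f G))).
  by apply: eq_pexp => G _; rewrite subUset sub1set -mulnb natrM mulrA.
rewrite pexp_mem //.
transitivity (p * pexp p E (fun G => (F \subset G)%:R * f (e |: G))).
  congr (_ * _); apply: eq_pexp => G _; congr (_%:R * _).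
  congr nat_of_bool; apply/idP/idP => [/subsetP FG|FG].
    apply/subsetP => x xF; have := FG x xF; rewrite !inE.
    by case/orP => // /eqP xe; move: eF; rewrite -xe xF.
  by apply: subset_trans FG _; exact: subsetUr.
rewrite (IH (fun G => f (e |: G))) // mulrA cardsU1 eF exprS; congr (_ * _).
by apply: eq_pexp => G _; rewrite setUA.
Qed.

Lemma pexp_subset p E F : F \subset E ->
  pexp p E (fun G => (F \subset G)%:R) = p ^+ #|F|.
Proof.
move=> FE; have := pexp_plant p (fun=> 1) FE; rewrite pexp_cst mulr1 => <-.
by apply: eq_pexp => G _; rewrite mulr1.
Qed.

Section Unit.
Variables (p : R) (E : {set T}).
Hypotheses (p0 : 0 <= p) (p1 : p <= 1).

Lemma pexp_cauchy_schwarz f g :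
  (pexp p E (fun G => f G * g G)) ^+ 2
  <= pexp p E (fun G => f G ^+ 2) * pexp p E (fun G => g G ^+ 2).
Proof.
set a := pexp _ _ (fun G => f G ^+ 2); set b := pexp _ _ (fun G => f G * g G).
set c := pexp _ _ _.
have q (s t : R) : 0 <= s ^+ 2 * a - 2 * s * t * b + t ^+ 2 * c.
  have := @pexp_ge0 p E (fun G => (s * f G - t * g G) ^+ 2) p0 p1
    (fun G _ => sqr_ge0 _).
  have -> : pexp p E (fun G => (s * f G - t * g G) ^+ 2)
    = pexp p E (fun G => s ^+ 2 * f G ^+ 2 + (- (2 * s * t) * (f G * g G)
      + t ^+ 2 * g G ^+ 2)) by apply: eq_pexp => G _; ring.
  by rewrite !(pexpD, pexpZ) mulNr addrA.
have c0 : 0 <= c by apply: pexp_ge0 => // G _; exact: sqr_ge0.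
have a0 : 0 <= a by apply: pexp_ge0 => // G _; exact: sqr_ge0.
have [c00|cn0] := eqVneq c 0.
  suff -> : b = 0 by rewrite expr0n mulr_ge0.
  have qq := q 1; rewrite c00 in qq.
  (* With c = 0 the form at s = 1 is affine in t, and this t gives it the value -1. *)
  apply/eqP/negPn/negP => bn0; have := qq ((a + 1) / (2 * b)).
  have -> : 2 * 1 * ((a + 1) / (2 * b)) * b = a + 1 by field.
  by rewrite mulr0 expr1n; lra.
have := q c b.
have -> : c ^+ 2 * a - 2 * c * b * b + b ^+ 2 * c = c * (a * c - b ^+ 2) by ring.
by rewrite pmulr_rge0 ?subr_ge0 // lt0r cn0.
Qed.

Lemma pexp_markov f (t : R) : (forall G, G \subset E -> 0 <= f G) ->
  t * pexp p E (fun G => (t <= f G)%R%:R) <= pexp p E f.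
Proof.
move=> f0; rewrite -pexpZ; apply: ler_pexp => // G GE.
by case: (boolP (t <= f G)%R) => /= h; rewrite ?mulr1 // mulr0 f0.
Qed.

Lemma pexp_predC (P : pred {set T}) :
  pexp p E (fun G => (~~ P G)%:R) = 1 - pexp p E (fun G => (P G)%:R).
Proof.
rewrite -{2}(pexp_cst p E 1) -pexpB; apply: eq_pexp => G _.
by case: (P G); rewrite ?subrr ?subr0.
Qed.

Definition pvar f : R := pexp p E (fun G => (f G - pexp p E f) ^+ 2).

Lemma pvarE f : pvar f = pexp p E (fun G => f G ^+ 2) - pexp p E f ^+ 2.
Proof.
rewrite /pvar; set m := pexp p E f.
transitivity (pexp p E (fun G => f G ^+ 2 + (- (2 * m) * f G + m ^+ 2))).
  by apply: eq_pexp => G _; ring.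
by rewrite !(pexpD, pexpZ) pexp_cst -/m; ring.
Qed.

Lemma pexp_chebyshev f (t : R) : 0 < t ->
  t ^+ 2 * pexp p E (fun G => (t <= `|f G - pexp p E f|)%R%:R) <= pvar f.
Proof.
move=> t0; apply: le_trans (pexp_markov (t ^+ 2) (fun G _ => sqr_ge0 _)).
apply: ler_wpM2l; first exact: sqr_ge0.
apply: ler_pexp => // G _; rewrite ler_nat -(real_normK (num_real (f G - pexp p E f))).
by rewrite (@ler_pXn2r R 2) ?nnegrE ?normr_ge0 ?(ltW t0).
Qed.

(** Markov's inequality for (f - m + t)^2, which is at least 4 t^2 on the event and has mean pvar f
    + t^2. Unlike Chebyshev's inequality it still says something at pvar f = t^2. *)
Lemma pexp_cantelli f (t : R) : 0 < t -> pvar f <= t ^+ 2 ->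
  pexp p E (fun G => (pexp p E f + t <= f G)%R%:R) <= 2^-1.
Proof.
move=> t0 vt; set m := pexp p E f.
have h : 4 * t ^+ 2 * pexp p E (fun G => (m + t <= f G)%R%:R)
  <= pexp p E (fun G => (f G - m + t) ^+ 2).
  rewrite -pexpZ; apply: ler_pexp => // G _.
  case: (boolP (m + t <= f G)%R) => /= h; last by rewrite mulr0 sqr_ge0.
  by rewrite mulr1; nra.
have e : pexp p E (fun G => (f G - m + t) ^+ 2) = pvar f + t ^+ 2.
  transitivity (pexp p E (fun G => (f G - m) ^+ 2 + (2 * t * (f G - m) + t ^+ 2))).
    by apply: eq_pexp => G _; ring.
  by rewrite !(pexpD, pexpZ, pexpN) !pexp_cst -/m -/(pvar f); ring.
have t2 : 0 < t ^+ 2 by rewrite exprn_gt0.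
rewrite e in h; nra.
Qed.

End Unit.

(** Cauchy-Schwarz for the density of the q-measure with respect to the p-measure. The second moment
    of the density is a product, with the factor q^2 / p + (1 - q)^2 / (1 - p) for each element. *)
Lemma pexp_tilt p (q : R) E f : 0 < p -> p < 1 -> 0 <= q -> q <= 1 ->
  (pexp q E f) ^+ 2
  <= (1 + (q - p) ^+ 2 / (p * (1 - p))) ^+ #|E| * pexp p E (fun G => f G ^+ 2).
Proof.
move=> p0 p1 q0 q1; set K := 1 + _.
have pn : p != 0 by rewrite gt_eqF.
have qn : 1 - p != 0 by rewrite gt_eqF // subr_gt0.
have KE : K = q ^+ 2 / p + (1 - q) ^+ 2 / (1 - p).
  by rewrite /K; field; rewrite pn qn.
have K0 : 0 <= K.
  by rewrite /K addr_ge0 // divr_ge0 ?sqr_ge0 ?mulr_ge0 ?subr_ge0 // ltW.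
elim/set_ind1: E f => [|e E eE IH] f.
  by rewrite !pexp_set0 cards0 expr0 mul1r.
rewrite !pexp_setU1 // cardsU1 eE /= (exprS _ #|E|).
have := IH (fun G => f (e |: G)); have := IH f.
set A := pexp q E f; set B := pexp q E _; set a := pexp p E (fun G => f G ^+ 2).
set b := pexp p E _; set k := K ^+ #|E| => hA hB.
apply: (@le_trans _ _ (K * (p * B ^+ 2 + (1 - p) * A ^+ 2))); last first.
  rewrite -mulrA; apply: ler_wpM2l => //.
  have := ler_wpM2l (ltW p0) hB.
  have q1' : 0 <= 1 - p by lra.
  by have := ler_wpM2l q1' hA; lra.
(* Cauchy-Schwarz on a two-point space, with its deficit written as a square. *)
have -> : K * (p * B ^+ 2 + (1 - p) * A ^+ 2) = (q * B + (1 - q) * A) ^+ 2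
  + (q * (1 - p) * A - (1 - q) * p * B) ^+ 2 / (p * (1 - p)).
  by rewrite KE; field; rewrite pn qn.
by rewrite lerDl divr_ge0 ?sqr_ge0 ?mulr_ge0 ?subr_ge0 // ltW.
Qed.

End ProductExpectation.

(* Finner's inequality for edges covered twice: by Cauchy-Schwarz one edge at a
   time, since each edge influences only the two factors at its ends. *)
Lemma pexp_finner (R : realType) (V : finType) (p : R) (E : {set {set V}})
    (f : V -> {set {set V}} -> R) : 0 <= p -> p <= 1 ->
  (forall e, e \in E -> #|e| = 2%N) ->
  (forall v G, 0 <= f v G) ->
  (forall v (e : {set V}) G, v \notin e -> f v (e |: G) = f v G) ->
  (pexp p E (fun G => \prod_v f v G)) ^+ 2
  <= \prod_v pexp p E (fun G => f v G ^+ 2).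
Proof.
move=> p0 p1.
elim/set_ind1: E f => [|e E eE IH] f E2 f0 fe.
  by rewrite pexp_set0 -prodrXl; under [leRHS]eq_bigr do rewrite pexp_set0.
have E2' e' : e' \in E -> #|e'| = 2%N by move=> h; apply: E2; rewrite inE h orbT.
rewrite pexp_setU1 //; under [leRHS]eq_bigr do rewrite pexp_setU1 //.
have := IH _ E2' f0 fe.
have := IH (fun v G => f v (e |: G)) E2' (fun v G => f0 v (e |: G)).
have fe2 v (e' : {set V}) G : v \notin e' -> f v (e |: (e' |: G)) = f v (e |: G).
  by move=> ve; rewrite setUCA fe.
move=> /(_ fe2).
set A := pexp p E _; set B := pexp p E _.
set a := fun v => pexp p E (fun G => f v (e |: G) ^+ 2).
set b := fun v => pexp p E (fun G => f v G ^+ 2).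
have -> : \prod_v pexp p E (fun G => f v (e |: G) ^+ 2) = \prod_v a v by [].
have -> : \prod_v pexp p E (fun G => f v G ^+ 2) = \prod_v b v by [].
have -> : \prod_v (p * pexp p E (fun G => f v (e |: G) ^+ 2) +
     (1 - p) * pexp p E (fun G => f v G ^+ 2))
  = \prod_v (p * a v + (1 - p) * b v) by [].
have A0 : 0 <= A by apply: pexp_ge0 => // G _; apply: prodr_ge0.
have B0 : 0 <= B by apply: pexp_ge0 => // G _; apply: prodr_ge0.
have a0 v : 0 <= a v by apply: pexp_ge0 => // G _; exact: sqr_ge0.
have b0 v : 0 <= b v by apply: pexp_ge0 => // G _; exact: sqr_ge0.
have ab v : v \notin e -> a v = b v.
  by move=> ve; apply: eq_pexp => G _; rewrite fe.
have /eqP/cards2P[x [y [xy ee]]] := E2 e (setU11 e E).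
have pe (F : V -> R) : \prod_v F v = F x * F y * \prod_(v | v \notin e) F v.
  rewrite (bigID (mem e)) /= ee big_setU1 ?inE //= big_set1 -ee //.
rewrite !pe.
have -> : \prod_(v | v \notin e) (p * a v + (1 - p) * b v)
   = \prod_(v | v \notin e) b v.
  by apply: eq_bigr => v /ab ->; ring.
have -> : \prod_(v | v \notin e) a v = \prod_(v | v \notin e) b v.
  by apply: eq_bigr => v /ab.
have : 0 <= \prod_(v | v \notin e) b v by apply: prodr_ge0.
set g := \prod_(v | _) _ => g0.
move: (a x) (a y) (b x) (b y) (a0 x) (a0 y) (b0 x) (b0 y).
move=> ax ay bx by_ ax0 ay0 bx0 by0 hA hB.
have q0 : 0 <= 1 - p by lra.
(* The cross term: the two induction hypotheses give A^2 B^2 <= g^2 (ax by)(bx ay), and the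
   geometric mean is at most the arithmetic mean. *)
have AB : 2 * (A * B) <= g * (ax * by_ + bx * ay).
  rewrite -(@ler_pXn2r _ 2) ?nnegrE ?mulr_ge0 ?addr_ge0 ?mulr_ge0 //.
  have h : A ^+ 2 * B ^+ 2 <= (ax * ay * g) * (bx * by_ * g).
    by apply: ler_pM => //; exact: sqr_ge0.
  have h2 : 0 <= g ^+ 2 * (ax * by_ - bx * ay) ^+ 2 by rewrite mulr_ge0 ?sqr_ge0.
  have -> : (2 * (A * B)) ^+ 2 = 4 * (A ^+ 2 * B ^+ 2) by ring.
  have -> : (g * (ax * by_ + bx * ay)) ^+ 2
    = 4 * ((ax * ay * g) * (bx * by_ * g)) + g ^+ 2 * (ax * by_ - bx * ay) ^+ 2
    by ring.
  by lra.
have h1 : p ^+ 2 * A ^+ 2 <= p ^+ 2 * (ax * ay * g).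
  by apply: ler_wpM2l => //; exact: sqr_ge0.
have h2 : (1 - p) ^+ 2 * B ^+ 2 <= (1 - p) ^+ 2 * (bx * by_ * g).
  by apply: ler_wpM2l => //; exact: sqr_ge0.
have h3 : p * (1 - p) * (2 * (A * B))
   <= p * (1 - p) * (g * (ax * by_ + bx * ay)).
  by apply: ler_wpM2l => //; rewrite mulr_ge0.
have -> : (p * A + (1 - p) * B) ^+ 2 = p ^+ 2 * A ^+ 2 + (1 - p) ^+ 2 * B ^+ 2
  + p * (1 - p) * (2 * (A * B)) by ring.
have -> : (p * ax + (1 - p) * bx) * (p * ay + (1 - p) * by_) * g
  = p ^+ 2 * (ax * ay * g) + (1 - p) ^+ 2 * (bx * by_ * g)
   + p * (1 - p) * (g * (ax * by_ + bx * ay)) by ring.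
by lra.
Qed.

(** * Stars in the complete graph *)

Section Stars.
Variable n : nat.
Implicit Types (G F : {set {set 'I_n}}) (A B e : {set 'I_n}).
Implicit Types (s t : 'I_n * {set 'I_n}).

(* A star K_{1,r} in K_n is encoded by its centre and its set of leaves. *)
Definition stars (r : nat) : {set 'I_n * {set 'I_n}} :=
  [set t : 'I_n * {set 'I_n} | (t.1 \notin t.2) && (#|t.2| == r)].

Definition star_edges (t : 'I_n * {set 'I_n}) : {set {set 'I_n}} :=
  [set [set t.1; x] | x in t.2].

Definition nbhd G (v : 'I_n) : {set 'I_n} :=
  [set x | ([set v; x] \in G) && (x != v)].

Definition deg G v : nat := #|nbhd G v|.

Lemma set2_inj (v x y : 'I_n) : [set v; x] = [set v; y] -> x = y.
Proof.
move=> e; have := set22 v x; rewrite e !inE => /orP[/eqP xv|/eqP//].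
by have := set22 v y; rewrite -e !inE xv orbb => /eqP.
Qed.

Lemma star_edgesP t e :
  reflect (exists2 x, x \in t.2 & e = [set t.1; x]) (e \in star_edges t).
Proof. exact: imsetP. Qed.

Lemma card_star_edges r t : t \in stars r -> #|star_edges t| = r.
Proof.
rewrite inE => /andP[_ /eqP <-]; apply: card_in_imset => x y _ _.
exact: set2_inj.
Qed.

Lemma star_edges_complete r t : t \in stars r ->
  star_edges t \subset complete_graph n.
Proof.
rewrite inE => /andP[vt _]; apply/subsetP => e /star_edgesP[x xt ->].
by rewrite inE cards2; case: (eqVneq t.1 x) => // tx; rewrite tx xt in vt.
Qed.

Lemma star_edges_sub r v A G : (v, A) \in stars r ->
  (star_edges (v, A) \subset G) = (A \subset nbhd G v).
Proof.
rewrite inE => /andP[/= vA _]; apply/subsetP/subsetP => h x.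
  move=> xA; rewrite inE; case: eqP => [xv|_]; first by rewrite -xv xA in vA.
  by rewrite andbT h //; apply/star_edgesP; exists x.
by case/star_edgesP => y /h; rewrite inE => /andP[? _] ->.
Qed.

Lemma deg_lt G v : (deg G v < n)%N.
Proof.
have : nbhd G v \subset [set~ v] by apply/subsetP => x; rewrite !inE => /andP[].
by move=> /subset_leq_card; rewrite cardsC1 card_ord /deg; have := ltn_ord v; lia.
Qed.

Lemma deg_complete v : deg (complete_graph n) v = n.-1.
Proof.
rewrite /deg (_ : nbhd _ v = [set~ v]) ?cardsC1 ?card_ord //.
by apply/setP => x; rewrite !inE cards2 (eq_sym x); case: (eqVneq v x).
Qed.

Lemma card_stars_centre r G v :
  #|[set t in stars r | (star_edges t \subset G) && (t.1 == v)]|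
  = 'C(deg G v, r).
Proof.
rewrite /deg -cards_draws.
have pI : injective (pair v : {set 'I_n} -> 'I_n * {set 'I_n}) by move=> x y [].
rewrite -(card_imset _ pI); apply/eq_card => -[w A].
apply/idP/imsetP => [|[B]].
  rewrite inE => /and3P[h /=]; rewrite (star_edges_sub _ h) => AN /eqP wv; subst w.
  exists A => //; rewrite !inE AN /=.
  by move: h; rewrite inE => /andP[].
rewrite inE => /andP[BN Br] [-> ->].
have h : (v, B) \in stars r.
  rewrite inE Br andbT /=; apply/negP => /(subsetP BN).
  by rewrite inE eqxx andbF.
by rewrite inE h (star_edges_sub _ h) BN /=.
Qed.

(** Grouping by centre makes the count a function of the degree sequence, which is what the cut into
    light and heavy vertices acts on. *)
Lemma card_stars_in r G :
  #|[set t in stars r | star_edges t \subset G]| = (\sum_v 'C(deg G v, r))%N.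
Proof.
rewrite -sum1_card (partition_big (fun t => t.1) predT) //=.
apply: eq_bigr => v _; rewrite -card_stars_centre -sum1_card.
by apply: eq_bigl => t; rewrite !inE -!andbA.
Qed.

Lemma card_stars r : #|stars r| = (n * 'C(n.-1, r))%N.
Proof.
transitivity #|[set t in stars r | star_edges t \subset complete_graph n]|.
  apply: eq_card => t; rewrite [RHS]inE.
  by case: (boolP (t \in stars r)) => //= /star_edges_complete ->.
rewrite card_stars_in; under eq_bigr do rewrite deg_complete.
by rewrite sum_nat_const card_ord.
Qed.

(** Two distinct edges of a star meet only in its centre. A single edge has two possible centres, so
    r >= 2 is essential. *)
Lemma star_edges_inj r : (2 <= r)%N -> {in stars r &, injective star_edges}.
Proof.
move=> r2 [v A] [w B] vA wB e.
have hw x : x \in A -> w \in [set v; x].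
  move=> xA; have : [set v; x] \in star_edges (w, B).
    by rewrite -e; apply/star_edgesP; exists x.
  by case/star_edgesP => y _ /= ->; rewrite set21.
have vw : v = w.
  move: vA; rewrite inE /= => /andP[_ /eqP Ar].
  have : (1 < #|A|)%N by rewrite Ar.
  case/card_gt1P => x [y [xA yA xy]].
  have := hw x xA; have := hw y yA; rewrite !inE => /orP[/eqP ->//|/eqP wy].
  by case/orP => [/eqP ->//|/eqP wx]; move: xy; rewrite -wx -wy eqxx.
subst w; congr (_, _); apply/setP => x.
have im A' : (x \in A') = ([set v; x] \in star_edges (v, A')).
  apply/idP/star_edgesP => [h|[y h /set2_inj ->]//]; by exists x.
by rewrite !im e.
Qed.

Lemma star_imset r (f : {ffun 'I_r.+1 -> 'I_n}) :
  [set f @: e | e : {set 'I_r.+1} in star r]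
  = star_edges (f ord0, [set f (lift ord0 i) | i : 'I_r]).
Proof.
apply/setP => e; apply/imsetP/star_edgesP => [[e' /imsetP[i _ ->] ->]|[x]].
  exists (f (lift ord0 i)); first exact: imset_f.
  by rewrite imsetU !imset_set1.
case/imsetP => i _ -> ->; exists [set ord0; lift ord0 i].
  exact: imset_f.
by rewrite imsetU !imset_set1.
Qed.

Lemma star_copies_stars r G : star_copies r G =
  [set (t.1 |: t.2, star_edges t) | t in stars r & star_edges t \subset G].
Proof.
apply/setP => -[W H]; rewrite inE /=.
have full (f : {ffun 'I_r.+1 -> 'I_n}) :
    f @: [set: 'I_r.+1] = f ord0 |: [set f (lift ord0 i) | i : 'I_r].
  apply/setP => x; apply/imsetP/setU1P.
    case=> i _ ->; case: (unliftP ord0 i) => [j ->|->]; last by left.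
    by right; exact: imset_f.
  by case=> [->|/imsetP[i _ ->]]; eexists; rewrite ?inE.
apply/andP/imsetP => [[HG /existsP[f /and3P[/injectiveP fI /eqP -> /eqP eH]]]|].
  rewrite star_imset in eH.
  exists (f ord0, [set f (lift ord0 i) | i : 'I_r]); last by rewrite full eH.
  rewrite inE -eH HG andbT inE /= card_imset ?card_ord ?eqxx ?andbT; last first.
    by move=> i j /fI /lift_inj.
  by apply/imsetP => -[i _ /fI /eqP]; rewrite -val_eqE.
case=> -[v A]; rewrite inE => /andP[vA sG] [-> ->]; split=> //.
move: vA; rewrite inE => /andP[/= vA /eqP Ar].
pose f : {ffun 'I_r.+1 -> 'I_n} := [ffun j =>
  if unlift ord0 j is Some i then enum_val (cast_ord (esym Ar) i) else v].
have f0 : f ord0 = v by rewrite ffunE unlift_none.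
have fl i : f (lift ord0 i) = enum_val (cast_ord (esym Ar) i).
  by rewrite ffunE liftK.
have fA : [set f (lift ord0 i) | i : 'I_r] = A.
  apply/setP => x; apply/imsetP/idP => [[i _ ->]|xA].
    by rewrite fl; exact: enum_valP.
  exists (cast_ord Ar (enum_rank_in xA x)) => //.
  by rewrite fl cast_ordK enum_rankK_in.
apply/existsP; exists f; rewrite full f0 fA eqxx star_imset f0 fA eqxx !andbT.
apply/injectiveP => i j.
case: (unliftP ord0 i) => [i' ->|->]; case: (unliftP ord0 j) => [j' ->|->] //.
- by rewrite !fl => /enum_val_inj/cast_ord_inj ->.
- by rewrite f0 fl => e; move: vA; rewrite -e enum_valP.
- by rewrite f0 fl => e; move: vA; rewrite e enum_valP.
Qed.

Lemma nb_starsE r G : (2 <= r)%N ->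
  nb_stars r G = #|[set t in stars r | star_edges t \subset G]|.
Proof.
move=> r2; rewrite /nb_stars star_copies_stars card_in_imset // => s t.
by rewrite !inE => /andP[hs _] /andP[ht _] [_ /(star_edges_inj r2)]; rewrite !inE; apply.
Qed.

Lemma sum_deg G : G \subset complete_graph n -> (\sum_v deg G v = 2 * #|G|)%N.
Proof.
move=> Gc.
have dE v : deg G v = (\sum_(e in G) (v \in e))%N.
  rewrite -big_mkcondr sum1_card /deg -(card_imset _ (f := fun x => [set v; x])).
    apply: eq_card => e; apply/imsetP/andP => [[x]|[eG ve]].
      by rewrite inE => /andP[xG _] ->; rewrite set21.
    have := subsetP Gc e eG; rewrite inE => /cards2P[x [y [xy ee]]].
    move: ve; rewrite ee !inE => /orP[/eqP->|/eqP->].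
      by exists y; rewrite // inE -ee eG eq_sym.
    by exists x; rewrite // ?inE 1?setUC -?ee ?eG.
  by move=> x y /set2_inj.
under eq_bigr do rewrite dE.
rewrite exchange_big /= mulnC -sum_nat_const; apply: eq_bigr => e eG.
by rewrite -big_mkcond sum1_card; have := subsetP Gc e eG; rewrite inE => /eqP <-.
Qed.

End Stars.

(** * Mean and variance *)

Section ElementarySums.
Variables (R : realType) (V : finType).

Lemma ler_sum_setD1 (k : nat) (x : V) (g : {set V} -> R) :
  (forall B, 0 <= g B) ->
  \sum_(A : {set V} | (x \in A) && (#|A| == k.+1)) g (A :\ x)
  <= \sum_(B : {set V} | #|B| == k) g B.
Proof.
move=> g0; rewrite [leRHS](bigID (fun B : {set V} => x \in B)) /=.
rewrite addrC [X in _ <= X + _](reindex_onto (fun A => A :\ x) (fun B => x |: B)) /=; last first.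
  by move=> B /andP[_ xB]; rewrite setU1K.
rewrite -[leLHS]addr0; apply: lerD; last by apply: sumr_ge0.
rewrite le_eqVlt; apply/orP; left; apply/eqP; apply: eq_bigl => A.
rewrite setD11 andbT; case: (boolP (x \in A)) => xA /=.
  by rewrite setD1K // eqxx andbT (cardsD1 x A) xA.
apply/esym/negbTE/negP => /andP[_ /eqP e]; move: xA.
by rewrite -e setU11.
Qed.

(** An elementary symmetric polynomial against a power of the first one. Splitting off one member of
    A in every possible way counts A at least once. *)
Lemma ler_sum_prod_sets (k : nat) (w : V -> R) : (forall x, 0 <= w x) ->
  \sum_(A : {set V} | #|A| == k) \prod_(x in A) w x <= (\sum_x w x) ^+ k.
Proof.
move=> w0; elim: k => [|k IH].
  rewrite (big_pred1 set0) ?big_set0 // => A.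
  by rewrite cards_eq0.
have S0 : 0 <= \sum_x w x by apply: sumr_ge0.
apply: (@le_trans _ _ (\sum_x w x *
   \sum_(A : {set V} | (x \in A) && (#|A| == k.+1)) \prod_(y in A :\ x) w y)).
  under [leRHS]eq_bigr do rewrite big_distrr /=.
  rewrite [leRHS](exchange_big_dep (fun A : {set V} => #|A| == k.+1)) /=; last first.
    by move=> x A _ /andP[].
  apply: ler_sum => A /eqP Ak.
  have [x xA] : exists x, x \in A by apply/card_gt0P; rewrite Ak.
  rewrite (big_setD1 x) //= [leRHS](bigD1 x) /=; last by rewrite xA Ak eqxx.
  by rewrite lerDl sumr_ge0 // => i _; rewrite mulr_ge0 ?prodr_ge0.
rewrite exprS mulr_suml; apply: ler_sum => x _; apply: ler_wpM2l => //.
apply: le_trans (ler_sum_setD1 k x (g := fun B => \prod_(y in B) w y) _) IH.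
by move=> B; exact: prodr_ge0.
Qed.

End ElementarySums.

Section Moments.
Variables (R : realType) (n r : nat).
Implicit Types (G F : {set {set 'I_n}}) (J : {set 'I_n * {set 'I_n}}).
Implicit Types (s t : 'I_n * {set 'I_n}).
Local Notation E := (complete_graph n).

Definition nstars J G : R := \sum_(t in J) (star_edges t \subset G)%:R.

Lemma nstars_ge0 J G : 0 <= nstars J G.
Proof. exact: sumr_ge0. Qed.

Lemma nstarsE J G : nstars J G = #|[set t in J | star_edges t \subset G]|%:R.
Proof.
rewrite /nstars -natr_sum -big_mkcondr sum1_card; congr _%:R.
by apply: eq_card => t; rewrite [RHS]inE.
Qed.

Lemma star_countE G : (2 <= r)%N -> star_count R r G = nstars (stars n r) G.
Proof. by move=> r2; rewrite /star_count nb_starsE // nstarsE. Qed.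

Lemma Gnp_expectE (p : R) (f : {set {set 'I_n}} -> R) :
  Gnp_expect p f = pexp p E f.
Proof. by []. Qed.

Variables (p : R).

Lemma pexp_nstars J : J \subset stars n r ->
  pexp p E (nstars J) = #|J|%:R * p ^+ r.
Proof.
move=> /subsetP JS; rewrite /nstars pexp_sum mulr_natl -sumr_const.
apply: eq_bigr => t /JS tS.
by rewrite pexp_subset ?(card_star_edges tS) // (star_edges_complete tS).
Qed.

Lemma star_meanE : (2 <= r)%N ->
  star_mean r n p = (n * 'C(n.-1, r))%:R * p ^+ r.
Proof.
move=> r2; rewrite /star_mean Gnp_expectE.
rewrite (@eq_pexp _ _ _ _ _ (nstars (stars n r))); last first.
  by move=> G _; rewrite star_countE.
by rewrite pexp_nstars ?card_stars.
Qed.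

Lemma star_varE : (2 <= r)%N ->
  star_var r n p = pvar p E (nstars (stars n r)).
Proof.
move=> r2; rewrite /star_var /Gnp_var /pvar !Gnp_expectE.
have e : pexp p E (star_count R r (n:=n)) = pexp p E (nstars (stars n r)).
  by apply: eq_pexp => G _; rewrite star_countE.
by rewrite e; apply: eq_pexp => G _; rewrite star_countE.
Qed.

Lemma star_upper_tailE (eps : R) : (2 <= r)%N ->
  star_upper_tail r n p eps = pexp p E (fun G =>
    ((1 + eps) * star_mean r n p <= nstars (stars n r) G)%R%:R).
Proof.
move=> r2; rewrite /star_upper_tail /Gnp_prob /pexp big_mkcondr /=.
apply: eq_bigr => G _; rewrite star_countE //.
by case: ifP => _; rewrite ?mulr1 ?mulr0.
Qed.

Lemma pvar_nstars J : J \subset stars n r ->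
  pvar p E (nstars J) = \sum_(s in J) \sum_(t in J)
    (p ^+ #|star_edges s :|: star_edges t| - p ^+ r * p ^+ r).
Proof.
move=> JS; rewrite pvarE pexp_nstars //.
have -> : pexp p E (fun G => nstars J G ^+ 2) = \sum_(s in J) \sum_(t in J)
    p ^+ #|star_edges s :|: star_edges t|.
  rewrite (@eq_pexp _ _ _ _ _ (fun G => \sum_(s in J) \sum_(t in J)
     (star_edges s :|: star_edges t \subset G)%:R)); last first.
    move=> G _; rewrite expr2 /nstars mulr_suml; apply: eq_bigr => s _.
    by rewrite mulr_sumr; apply: eq_bigr => t _; rewrite subUset -mulnb natrM.
  rewrite pexp_sum; apply: eq_bigr => s sJ; rewrite pexp_sum.
  apply: eq_bigr => t tJ; rewrite pexp_subset // subUset.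
  by rewrite !(@star_edges_complete _ r) // (subsetP JS).
under [RHS]eq_bigr do rewrite sumrB sumr_const.
by rewrite sumrB sumr_const -[in RHS]mulr_natl -[in RHS](mulr_natl (p ^+ r * p ^+ r)); ring.
Qed.

Hypotheses (p0 : 0 <= p) (p1 : p <= 1).

Lemma star_cov_ge0 s t : s \in stars n r -> t \in stars n r ->
  0 <= p ^+ #|star_edges s :|: star_edges t| - p ^+ r * p ^+ r.
Proof.
move=> sS tS; rewrite subr_ge0 -exprD; apply: ler_wiXn2l => //.
by rewrite cardsU !(@card_star_edges _ r) // leq_subr.
Qed.

Lemma pvar_nstarsS J : J \subset stars n r ->
  pvar p E (nstars J) <= pvar p E (nstars (stars n r)).
Proof.
move=> JS; rewrite !pvar_nstars //.
rewrite [leRHS](big_setID J) /= (setIidPr JS) -[leLHS]addr0; apply: lerD.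
  apply: ler_sum => s sJ; rewrite [leRHS](big_setID J) /= (setIidPr JS) lerDl.
  apply: sumr_ge0 => t; rewrite inE => /andP[_ tS].
  by rewrite star_cov_ge0 // (subsetP JS).
apply: sumr_ge0 => s; rewrite inE => /andP[_ sS].
by apply: sumr_ge0 => t tS; exact: star_cov_ge0.
Qed.

(** All covariances are nonnegative, so the diagonal alone is a lower bound; it has the right order
    for d <= 1. The bound against the number of edges serves for d >= 1. *)
Lemma pvar_nstars_ge : (0 < r)%N ->
  (1 - p) * (#|stars n r|%:R * p ^+ r) <= pvar p E (nstars (stars n r)).
Proof.
move=> r0; rewrite pvar_nstars // mulrCA mulr_natl -sumr_const.
apply: ler_sum => s sS; rewrite (bigD1 s) //= setUid (card_star_edges sS).
apply: (@le_trans _ _ (p ^+ r - p ^+ r * p ^+ r)).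
  have : p ^+ r <= p by case: r r0 => // k _; rewrite exprS ler_piMr // exprn_ile1.
  have := exprn_ge0 r p0; set q := p ^+ r => q0 qp.
  have := mulr_ge0 q0 (_ : 0 <= p - q); rewrite subr_ge0 => /(_ qp); lra.
by rewrite lerDl; apply: sumr_ge0 => t /andP[tS _]; exact: star_cov_ge0.
Qed.

(* Cauchy-Schwarz against the centred number of edges. *)
Lemma pvar_nstars_ge_edges : p < 1 ->
  (#|stars n r|%:R * p ^+ r) ^+ 2 * r%:R ^+ 2 * (1 - p)
  <= #|E|%:R * p * pvar p E (nstars (stars n r)).
Proof.
move=> p1'; set m := _ * p ^+ r; set s2 := pvar _ _ _.
pose h G : R := \sum_(e in E) ((e \in G)%:R - p).
have pin e : e \in E -> pexp p E (fun G => (e \in G)%:R) = p.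
  move=> eE; rewrite -[RHS]expr1 -(cards1 e) -(@pexp_subset _ _ _ E) ?sub1set //.
  by apply: eq_pexp => G _; rewrite sub1set.
have h0 : pexp p E h = 0.
  rewrite pexp_sum big1 // => e eE; rewrite pexpB pexp_cst pin //.
  by rewrite subrr.
have hh e e' : e \in E -> e' \in E ->
    pexp p E (fun G => ((e \in G)%:R - p) * ((e' \in G)%:R - p))
    = if e == e' then p * (1 - p) else 0.
  move=> eE e'E; rewrite (@eq_pexp _ _ _ _ _ (fun G =>
    ([set e; e'] \subset G)%:R + (- p * (e \in G)%:R + (- p * (e' \in G)%:R + p ^+ 2)))).
    rewrite !(pexpD, pexpZ) pexp_cst !pin // pexp_subset ?subUset ?sub1set ?eE ?e'E //.
    by rewrite cards2; case: eqP => _; rewrite ?expr1; ring.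
  by move=> G _; rewrite subUset !sub1set -mulnb natrM; ring.
have h2 : pexp p E (fun G => h G ^+ 2) = #|E|%:R * (p * (1 - p)).
  rewrite (@eq_pexp _ _ _ _ _ (fun G => \sum_(e in E) \sum_(e' in E)
     ((e \in G)%:R - p) * ((e' \in G)%:R - p))); last first.
    by move=> G _; rewrite expr2 /h mulr_suml; apply: eq_bigr => e _; rewrite mulr_sumr.
  rewrite pexp_sum mulr_natl -sumr_const; apply: eq_bigr => e eE.
  rewrite pexp_sum (bigD1 e) //= hh // eqxx big1 ?addr0 // => e' /andP[e'E ne].
  by rewrite hh // eq_sym (negbTE ne).
(* An edge outside the star is independent of it and its centred indicator averages to 0; an edge of
   the star is present for certain and leaves 1 - p. *)
have te t e : t \in stars n r -> e \in E ->
    pexp p E (fun G => (star_edges t \subset G)%:R * ((e \in G)%:R - p))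
    = if e \in star_edges t then p ^+ r * (1 - p) else 0.
  move=> tS eE; rewrite (pexp_plant _ _ (star_edges_complete tS)) (card_star_edges tS).
  rewrite pexpB pexp_cst; case: ifP => et.
    rewrite (@eq_pexp _ _ _ _ _ (fun=> 1)) ?pexp_cst // => G _.
    by rewrite inE et.
  rewrite (@eq_pexp _ _ _ _ _ (fun G => (e \in G)%:R)) ?pin ?subrr ?mulr0 // => G _.
  by rewrite inE et.
have hX : pexp p E (fun G => h G * nstars (stars n r) G) = m * r%:R * (1 - p).
  rewrite (@eq_pexp _ _ _ _ _ (fun G => \sum_(t in stars n r) \sum_(e in E)
     (star_edges t \subset G)%:R * ((e \in G)%:R - p))); last first.
    by move=> G _; rewrite mulrC /nstars mulr_suml; apply: eq_bigr => t _; rewrite mulr_sumr.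
  rewrite pexp_sum /m -!mulrA mulr_natl -sumr_const; apply: eq_bigr => t tS.
  rewrite pexp_sum (eq_bigr _ (fun e eE => te t e tS eE)) -big_mkcondr /=.
  rewrite (eq_bigl (mem (star_edges t))); last first.
    move=> e; apply/andP/idP => [[]//|et]; split=> //.
    exact: (subsetP (star_edges_complete tS)).
  by rewrite sumr_const (card_star_edges tS) -mulr_natl; ring.
have := pexp_cauchy_schwarz E p0 p1 h (fun G => nstars (stars n r) G - pexp p E (nstars (stars n r))).
rewrite h2 -/(pvar _ _ _) -/s2.
have -> : pexp p E (fun G => h G * (nstars (stars n r) G - pexp p E (nstars (stars n r))))
   = m * r%:R * (1 - p).
  under eq_pexp => G _ do rewrite mulrBr.
  rewrite pexpB hX (@eq_pexp _ _ _ _ (fun G => h G * _)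
     (fun G => pexp p E (nstars (stars n r)) * h G)); last by move=> G _; rewrite mulrC.
  by rewrite pexpZ h0 mulr0 subr0.
have q0 : 0 < 1 - p by lra.
rewrite (_ : (m * r%:R * (1 - p)) ^+ 2 = (m ^+ 2 * r%:R ^+ 2 * (1 - p)) * (1 - p)); last by ring.
rewrite (_ : #|E|%:R * (p * (1 - p)) * s2 = (#|E|%:R * p * s2) * (1 - p)); last by ring.
by rewrite ler_pM2r.
Qed.

(* A touched star is located by its centre and a leaf joined to it in F. *)
Lemma sum_touching F (D : nat) : (0 < r)%N -> F \subset E ->
  (forall v, (deg F v <= D)%N) ->
  \sum_(t in stars n r | ~~ [disjoint star_edges t & F])
     p ^+ #|star_edges t :\: F|
  <= (2 * #|F|)%:R * (n%:R * p + D%:R) ^+ r.-1.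
Proof.
case: r => // k _ FE FD /=.
(* The probability that the edge from v to y is present once F is planted. *)
pose w (v y : 'I_n) : R := if y \in nbhd F v then 1 else p.
have w0 v y : 0 <= w v y by rewrite /w; case: ifP.
have wsum v : \sum_y w v y <= n%:R * p + D%:R.
  apply: (@le_trans _ _ (\sum_(y : 'I_n) (p + (y \in nbhd F v)%:R))).
    by apply: ler_sum => y _; rewrite /w; case: ifP => _; rewrite ?addr0 // lerDr.
  rewrite big_split /= sumr_const card_ord mulr_natl lerD2l.
  by rewrite -natr_sum -big_mkcond sum1_card ler_nat FD.
have wE t : t \in stars n k.+1 ->
    p ^+ #|star_edges t :\: F| = \prod_(y in t.2) w t.1 y.
  case: t => v A tS; rewrite (bigID (fun y => y \in nbhd F v)) /=.
  rewrite [X in X * _]big1 ?mul1r => [|y /andP[_ h]]; last by rewrite /w h.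
  rewrite (eq_bigr (fun=> p)) => [|y /andP[_ /negbTE h]]; last by rewrite /w h.
  rewrite prodr_const; congr (_ ^+ _).
  rewrite (_ : star_edges (v, A) :\: F
     = [set [set v; x] | x in A :\: nbhd F v]); last first.
    apply/setP => e; rewrite inE; apply/andP/imsetP => [[eF /star_edgesP[x /= xA ee]]|[x]].
      by exists x; rewrite // !inE xA andbT -ee (negbTE eF).
    rewrite !inE => /andP[h xA] ->; split; last by apply/star_edgesP; exists x.
    move: h; rewrite negb_and negbK => /orP[//|/eqP xv].
    by move: tS; rewrite inE /= -xv xA.
  rewrite card_imset; last by move=> x y; exact: set2_inj.
  by apply: eq_card => x; rewrite inE andbC.
(* A star that meets F in several edges is counted once for each of them. *)
apply: (@le_trans _ _ (\sum_v \sum_(x in nbhd F v)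
  \sum_(A : {set 'I_n} | (x \in A) && (#|A| == k.+1)) \prod_(y in A :\ x) w v y)).
  rewrite (partition_big (fun t => t.1) predT) //=; apply: ler_sum => v _.
  under [leRHS]eq_bigr => x _ do rewrite big_mkcond /=.
  rewrite [leRHS]exchange_big /=.
  rewrite (reindex_onto (fun A : {set 'I_n} => (v, A)) (fun t => t.2)) /=; last first.
    by move=> [u A] /andP[_ /= /eqP ->].
  rewrite [leLHS]big_mkcond /=; apply: ler_sum => A _.
  case: ifP => [|_]; last first.
    by apply: sumr_ge0 => x _; case: ifP => // _; exact: prodr_ge0.
  rewrite !eqxx !andbT => /andP[tS].
  rewrite -setI_eq0 => /set0Pn[e]; rewrite inE => /andP[/star_edgesP[x /= xA ee] eF].
  have /andP[vA Ak] : (v \notin A) && (#|A| == k.+1) by move: tS; rewrite inE.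
  have xN : x \in nbhd F v.
    by rewrite inE -ee eF; apply: contraNneq vA => <-.
  rewrite wE //= [leRHS](bigD1 x) //= xA Ak /= (big_setD1 x) //=.
  rewrite {1}/w xN mul1r lerDl; apply: sumr_ge0 => y _.
  by case: ifP => // _; exact: prodr_ge0.
apply: (@le_trans _ _ (\sum_v (deg F v)%:R * (n%:R * p + D%:R) ^+ k)).
  apply: ler_sum => v _; rewrite mulr_natl -sumr_const; apply: ler_sum => x _.
  apply: le_trans (ler_sum_setD1 k x (g := fun B => \prod_(y in B) w v y) _) _.
    by move=> B; exact: prodr_ge0.
  apply: le_trans (ler_sum_prod_sets k (w0 v)) _.
  by apply: lerXn2r; rewrite ?nnegrE ?sumr_ge0 ?addr_ge0 ?mulr_ge0.
by rewrite -mulr_suml -natr_sum sum_deg.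
Qed.

Lemma deg_star_edges t v : (2 <= r)%N -> t \in stars n r -> (deg (star_edges t) v <= r)%N.
Proof.
move=> r2 tS; rewrite -(card_star_edges tS) /deg.
rewrite -(card_imset _ (f := fun x => [set v; x])); last by move=> x y; exact: set2_inj.
by apply/subset_leq_card/subsetP => e /imsetP[x]; rewrite inE => /andP[h _] ->.
Qed.

(** For fixed s only the stars t meeting s contribute, each at most p^r p^|t - s|. This is the sum
    of [sum_touching] with the edges of s as F. *)
Lemma pvar_nstars_le : (2 <= r)%N ->
  pvar p E (nstars (stars n r))
  <= (#|stars n r|%:R * p ^+ r) * ((2 * r)%:R * (n%:R * p + r%:R) ^+ r.-1).
Proof.
move=> r2; rewrite pvar_nstars // -mulrA mulr_natl -sumr_const.
apply: ler_sum => s sS.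
have sE := star_edges_complete sS.
have := sum_touching (ltnW r2) sE (fun v => deg_star_edges v r2 sS).
rewrite (card_star_edges sS) => /(ler_wpM2l (exprn_ge0 r p0)); apply: le_trans.
rewrite (bigID (fun t => [disjoint star_edges t & star_edges s])) /=.
rewrite [X in X + _]big1 ?add0r; last first.
  move=> t /andP[tS]; rewrite -setI_eq0 setIC => /eqP d0.
  by rewrite cardsU d0 cards0 subn0 exprD (card_star_edges tS) (card_star_edges sS) subrr.
rewrite mulr_sumr; apply: ler_sum => t /andP[tS _].
have -> : #|star_edges s :|: star_edges t| = (r + #|star_edges t :\: star_edges s|)%N.
  rewrite cardsU cardsD setIC -(card_star_edges sS) addnBA //.
  exact/subset_leq_card/subsetIl.
by rewrite exprD gerBl mulr_ge0 ?exprn_ge0.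
Qed.

End Moments.

(** * Light and heavy stars *)

Lemma leq_bin_exp m k : ('C(m, k) <= m ^ k)%N.
Proof.
rewrite -(leq_pmul2r (fact_gt0 k)) bin_ffact; apply: leq_trans (leq_pmulr _ (fact_gt0 k)).
by elim: k => // k IH; rewrite ffactnSr expnSr leq_mul // leq_subr.
Qed.

Lemma leq_exp_r m1 m2 k : (m1 <= m2 -> m1 ^ k <= m2 ^ k)%N.
Proof. by case: k => // k; rewrite leq_exp2r. Qed.

Lemma leq_card_bigcup (T I : finType) (A : {set I}) (F : I -> {set T}) :
  (#|\bigcup_(i in A) F i| <= \sum_(i in A) #|F i|)%N.
Proof.
elim/big_rec2: _ => [|i k B _ IH]; first by rewrite cards0.
by apply: leq_trans (leq_card_setU _ _) _; rewrite leq_add2l.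
Qed.

Lemma expR1_le4 (R : realType) : expR 1 <= 4 :> R.
Proof.
have := expR_ge1Dx (- 2^-1 : R); rewrite expRN.
have -> : expR 1 = expR 2^-1 * expR 2^-1 :> R by rewrite -expRD; congr expR; lra.
have := expR_gt0 (2^-1 : R); set x := expR _ => x0.
have -> : 1 + - 2^-1 = 2^-1 :> R by lra.
by rewrite lef_pV2 ?posrE // => h; nra.
Qed.

Section Tails.
Variables (R : realType) (n r : nat) (p : R).
Hypotheses (p0 : 0 <= p) (p1 : p <= 1).
Implicit Types (G F : {set {set 'I_n}}) (S : {set 'I_n * {set 'I_n}}).
Implicit Types (s t : 'I_n * {set 'I_n}).
Local Notation E := (complete_graph n).
Local Notation mu := (#|stars n r|%:R * p ^+ r).

(** Counts ordered k-tuples of stars of G that are edge-disjoint from one another and from F; each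
    chosen star is absorbed into F before the next choice. *)
Fixpoint disjoint_tuples (k : nat) F G : R :=
  if k is k'.+1 then
    \sum_(t in stars n r | (star_edges t \subset G) && [disjoint star_edges t & F])
      disjoint_tuples k' (F :|: star_edges t) G
  else 1.

Lemma disjoint_tuples_ge0 k F G : 0 <= disjoint_tuples k F G.
Proof. by elim: k F => //= k IH F; apply: sumr_ge0. Qed.

(** Edge-disjoint stars are independent, so each choice contributes at most mu. Carrying the event
    that F is present lets the induction absorb the stars chosen so far. *)
Lemma pexp_disjoint_tuples k F : F \subset E ->
  pexp p E (fun G => (F \subset G)%:R * disjoint_tuples k F G)
  <= p ^+ #|F| * mu ^+ k.
Proof.
elim: k F => [|k IH] F FE /=.
  rewrite expr0 mulr1 -(pexp_subset p FE) le_eqVlt; apply/orP; left; apply/eqP.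
  by apply: eq_pexp => G _; rewrite mulr1.
rewrite (@eq_pexp _ _ _ _ _ (fun G => \sum_(t in stars n r | [disjoint star_edges t & F])
   ((F :|: star_edges t \subset G)%:R * disjoint_tuples k (F :|: star_edges t) G))); last first.
  move=> G _; rewrite mulr_sumr big_mkcondr [RHS]big_mkcondr /=.
  apply: eq_bigr => t _; rewrite subUset.
  case: [disjoint _ & _]; case: (star_edges t \subset G); case: (F \subset G);
    by rewrite /= ?mul0r ?mul1r ?mulr0.
rewrite pexp_sum.
apply: (@le_trans _ _ (\sum_(t in stars n r) p ^+ #|F| * (p ^+ r * mu ^+ k))).
  rewrite big_mkcondr /=; apply: ler_sum => t tS; case: ifP => [dt|_]; last first.
    by rewrite !mulr_ge0 ?exprn_ge0 // mulr_ge0 ?exprn_ge0.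
  apply: le_trans (IH _ _) _; first by rewrite subUset FE (star_edges_complete tS).
  rewrite mulrA -exprD cardsU (card_star_edges tS).
  by move: dt; rewrite disjoint_sym -setI_eq0 => /eqP ->; rewrite cards0 subn0.
by rewrite sumr_const -[leLHS]mulr_natl exprS mulrCA !mulrA.
Qed.

(** Greedy choice inside S: before the last choice at most |F| + r (k - 1) edges are occupied, each
    blocks at most q members of S, and so at least B members stay available at every step. *)
Lemma disjoint_tuples_ge k (q : nat) S F G (B : R) : 0 <= B ->
  (forall t, t \in S -> (t \in stars n r) && (star_edges t \subset G)) ->
  (forall e, (#|[set t in S | e \in star_edges t]| <= q)%N) ->
  ((0 < k)%N -> B + (q * (#|F| + r * k.-1))%:R <= #|S|%:R) ->
  B ^+ k <= disjoint_tuples k F G.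
Proof.
move=> B0 SG Sq; elim: k F => [|k IH] F hB //=.
have {}hB := hB isT; rewrite /= in hB.
apply: (@le_trans _ _ (\sum_(t in S | [disjoint star_edges t & F]) B ^+ k)); last first.
  rewrite [leRHS](bigID (mem S)) /= -[leLHS]addr0; apply: lerD; last first.
    by apply: sumr_ge0 => *; exact: disjoint_tuples_ge0.
  rewrite [leRHS](eq_bigl (fun t => (t \in S) && [disjoint star_edges t & F])); last first.
    move=> t; case: (boolP (t \in S)) => [/SG/andP[-> ->]|_] /=; first by rewrite andbT.
    by rewrite andbF.
  apply: ler_sum => t /andP[/SG/andP[tS tG] dt]; apply: IH.
  move=> k0; apply: le_trans hB; rewrite lerD2l ler_nat leq_mul2l; apply/orP; right.
  have -> : (r * k = r + r * k.-1)%N by rewrite -mulnS prednK.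
  by rewrite cardsU (card_star_edges tS) addnA leq_add2r leq_subr.
rewrite sumr_const exprS -[leRHS]mulr_natl; apply: ler_wpM2r; first exact: exprn_ge0.
have bad : (#|[set t in S | ~~ [disjoint star_edges t & F]]| <= q * #|F|)%N.
  apply: (@leq_trans #|\bigcup_(e in F) [set t in S | e \in star_edges t]|).
    apply/subset_leq_card/subsetP => t; rewrite inE => /andP[tS].
    rewrite -setI_eq0 => /set0Pn[e]; rewrite inE => /andP[et eF].
    by apply/bigcupP; exists e; rewrite // inE tS.
  apply: leq_trans (leq_card_bigcup _ _) _.
  by rewrite mulnC -sum_nat_const; apply: leq_sum.
have : (#|S| <= #|[pred t | (t \in S) && [disjoint star_edges t & F]]| +
   #|[set t in S | ~~ [disjoint star_edges t & F]]|)%N.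
  rewrite -!sum1_card (bigID (fun t => [disjoint star_edges t & F])) /=.
  by apply/eq_leq; congr (_ + _)%N; apply: eq_bigl => t; rewrite inE.
move=> hS; have {}hS : (#|S| <= #|[pred t | (t \in S) && [disjoint star_edges t & F]]| + q * #|F|)%N by lia.
move: hS; rewrite -(ler_nat R) natrD => hS.
have : (q * #|F|)%:R <= (q * (#|F| + r * k))%:R :> R by rewrite ler_nat leq_mul2l leq_addr orbT.
lra.
Qed.

Definition light_stars (D : nat) G : {set 'I_n * {set 'I_n}} :=
  [set t in stars n r | (star_edges t \subset G) && (deg G t.1 < D)%N].

Lemma card_light_stars D G :
  #|light_stars D G| = (\sum_(v | (deg G v < D)%N) 'C(deg G v, r))%N.
Proof.
rewrite -sum1_card (partition_big (fun t => t.1) (fun v => deg G v < D)%N) /=; last first.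
  by move=> t; rewrite inE => /and3P[].
apply: eq_bigr => v vD; rewrite -card_stars_centre -sum1_card.
apply: eq_bigl => t; rewrite !inE -!andbA.
by case: (eqVneq t.1 v) => [->|_]; rewrite ?vD ?andbF ?andbT.
Qed.

(** The centre is one of the two ends of e, hence the factor 2; the remaining r - 1 leaves are
    neighbours of a centre of degree below D. *)
Lemma light_stars_edge D G e : (0 < r)%N ->
  (#|[set t in light_stars D G | e \in star_edges t]| <= 2 * D ^ r.-1)%N.
Proof.
move=> r0.
have half (v u : 'I_n) : (#|[set t in light_stars D G | (t.1 == v) && (u \in t.2)]|
    <= D ^ r.-1)%N.
  case: (ltnP (deg G v) D) => vD; last first.
    rewrite (_ : [set t in _ | _] = set0) ?cards0 //; apply/setP => t; rewrite !inE.
    by case: (eqVneq t.1 v) => [->|_]; rewrite ?andbF // ltnNge vD !andbF.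
  apply: (@leq_trans #|[set A : {set 'I_n} | (A \subset nbhd G v) && (#|A| == r.-1)]|).
    rewrite -(card_in_imset (f := fun t => t.2 :\ u)).
      apply/subset_leq_card/subsetP => A /imsetP[[w B]].
      rewrite inE /= => /and3P[]; rewrite inE /= => /and3P[h BG _] /eqP wv uB ->.
      subst w; rewrite (star_edges_sub _ h) in BG; rewrite inE.
      rewrite (subset_trans (subD1set _ _) BG) /=.
      move: h; rewrite inE /= => /andP[_ /eqP <-].
      by rewrite (cardsD1 u B) uB.
    move=> [w B] [w' B']; rewrite !inE /= => /and3P[_ /eqP -> uB] /and3P[_ /eqP -> uB'] h.
    by rewrite -(setD1K uB) h (setD1K uB').
  rewrite cards_draws; apply: leq_trans (leq_bin_exp _ _) _.
  exact/leq_exp_r/ltnW.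
have [/existsP[v /existsP[u /eqP ->]]|/existsP h] :=
  boolP [exists v, exists u, e == [set v; u]]; last first.
  rewrite (_ : [set t in _ | _] = set0) ?cards0 //; apply/setP => t; rewrite inE [RHS]inE.
  apply/negP => /andP[_ /star_edgesP[x _ ee]]; apply: h.
  by exists t.1; apply/existsP; exists x; rewrite ee.
apply: (@leq_trans #|[set t in light_stars D G | (t.1 == v) && (u \in t.2)]
   :|: [set t in light_stars D G | (t.1 == u) && (v \in t.2)]|).
  apply/subset_leq_card/subsetP => t; rewrite inE => /andP[tL /star_edgesP[x xt ee]].
  rewrite inE [X in X || _]inE [X in _ || X]inE tL /=.
  have : t.1 \in [set v; u] by rewrite ee set21.
  rewrite !inE => /orP[/eqP tv|/eqP tu].
    by apply/orP; left; rewrite -tv eqxx; rewrite -tv in ee; rewrite (set2_inj ee).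
  apply/orP; right; rewrite -tu eqxx; rewrite -tu setUC in ee.
  by rewrite (set2_inj ee).
by apply: leq_trans (leq_card_setU _ _) _; rewrite mul2n -addnn leq_add.
Qed.

(* Markov's inequality for the number of k-tuples of edge-disjoint stars. *)
Lemma light_tail (D k : nat) (B : R) : (0 < r)%N -> 0 <= B ->
  B ^+ k.+1 * pexp p E (fun G =>
    (B + (2 * D ^ r.-1 * (r * k))%:R
      <= (\sum_(v | (deg G v < D)%N) 'C(deg G v, r))%:R)%R%:R)
  <= mu ^+ k.+1.
Proof.
move=> r0 B0; rewrite -pexpZ.
have := pexp_disjoint_tuples k.+1 (sub0set E); rewrite cards0 expr0 mul1r.
apply: le_trans; apply: ler_pexp => // G _; rewrite sub0set mul1r.
case: (boolP (_ <= (\sum_(v | _) _)%:R)%R) => [h|_]; last first.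
  by rewrite mulr0 disjoint_tuples_ge0.
rewrite mulr1; apply: (@disjoint_tuples_ge k.+1 (2 * D ^ r.-1)%N (light_stars D G)) => //.
- by move=> t; rewrite inE => /and3P[-> -> _].
- by move=> e; exact: light_stars_edge.
- by move=> _; rewrite cards0 add0n card_light_stars.
Qed.

Lemma pexp_bin_deg (x : nat) v :
  pexp p E (fun G => ('C(deg G v, x))%:R) = ('C(n.-1, x))%:R * p ^+ x.
Proof.
pose J := [set t in stars n x | t.1 == v].
have JE G : ('C(deg G v, x))%:R = nstars R J G.
  rewrite nstarsE -card_stars_centre; congr _%:R; apply: eq_card => t.
  by rewrite !inE -!andbA; congr (_ && (_ && _)); rewrite andbC.
under eq_pexp => G _ do rewrite JE.
rewrite (@pexp_nstars _ _ x); last by apply/subsetP => t; rewrite inE => /andP[].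
congr (_%:R * _); rewrite -(deg_complete v) -card_stars_centre.
apply: eq_card => t; rewrite in_set /J in_set.
by case: (boolP (t \in stars n x)) => [tS|_] //=; rewrite (star_edges_complete tS).
Qed.

(** Finner's inequality leaves a product of n factors E f_v^2. The event deg v = x has probability
    at most E C(deg v, x), so the bound n^-2 summed over fewer than n values of x makes each factor
    at most 1 + 1/n, and the product at most e <= 4 = 2^2. *)
Lemma heavy_moment (D : nat) (w : nat -> R) : (0 < n)%N -> (forall x, 0 <= w x) ->
  (forall x, (D <= x < n)%N ->
     ('C(n.-1, x))%:R * p ^+ x * w x ^+ 2 <= n%:R^-1 ^+ 2) ->
  pexp p E (fun G => \prod_v (if (deg G v < D)%N then 1 else w (deg G v))) <= 2.
Proof.
move=> n0 w0 hw; set f := fun v G => if (deg G v < D)%N then 1 else w (deg G v).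
have nR : 0 < n%:R :> R by rewrite ltr0n.
have f0 v G : 0 <= f v G by rewrite /f; case: ifP.
have fe v (e : {set 'I_n}) G : v \notin e -> f v (e |: G) = f v G.
  move=> ve; rewrite /f (_ : deg (e |: G) v = deg G v) //; apply: eq_card => x.
  rewrite !inE; case: eqP => // ee; move: ve; by rewrite -ee set21.
have E2 e : e \in E -> #|e| = 2%N by rewrite inE => /eqP.
have := pexp_finner p0 p1 E2 f0 fe.
set P := pexp _ _ _ => hP.
have P0 : 0 <= P by apply: pexp_ge0 => // G _; apply: prodr_ge0.
have one v : pexp p E (fun G => f v G ^+ 2) <= 1 + n%:R^-1.
  apply: (@le_trans _ _ (pexp p E (fun G =>
     1 + \sum_(D <= x < n) w x ^+ 2 * ('C(deg G v, x))%:R))).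
    apply: ler_pexp => // G _; rewrite /f; case: ltnP => vD.
      by rewrite expr1n lerDl sumr_ge0 // => x _; rewrite mulr_ge0 ?sqr_ge0.
    rewrite (big_cat_nat vD (ltnW (deg_lt G v))) /=.
    rewrite (big_ltn (deg_lt G v)) binn mulr1.
    have h (a b : nat) : 0 <= \sum_(a <= x < b) w x ^+ 2 * ('C(deg G v, x))%:R.
      by apply: sumr_ge0 => x _; rewrite mulr_ge0 ?sqr_ge0.
    by have := h D (deg G v); have := h (deg G v).+1 n; lra.
  rewrite pexpD pexp_cst lerD2l pexp_sum.
  apply: (@le_trans _ _ (\sum_(D <= x < n) n%:R^-1 ^+ 2)).
    rewrite big_nat_cond [leRHS]big_nat_cond; apply: ler_sum => x /andP[xD _].
    by rewrite pexpZ pexp_bin_deg mulrC hw.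
  rewrite sumr_const_nat -[leLHS]mulr_natl expr2 mulrA ler_piMl ?invr_ge0 //.
  by rewrite ler_pdivrMr // mul1r ler_nat leq_subr.
have : P ^+ 2 <= 4.
  apply: le_trans hP _; apply: (@le_trans _ _ (\prod_(v < n) (1 + n%:R^-1))).
    by apply: ler_prod => v _; rewrite one andbT pexp_ge0 // => G _; exact: sqr_ge0.
  rewrite prodr_const card_ord.
  apply: (@le_trans _ _ (expR (n%:R^-1) ^+ n)).
    by apply: lerXn2r; rewrite ?nnegrE ?expR_ge0 ?addr_ge0 ?invr_ge0 ?expR_ge1Dx.
  rewrite -expRM_natl mulfV ?gt_eqF //; exact: expR1_le4.
by nra.
Qed.

End Tails.

(** * Planted subgraphs *)

Lemma bernoulli_inequality (R : realType) (a : R) (k : nat) : 0 <= a -> a <= 1 -> 1 - k%:R * a <= (1 - a) ^+ k.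
Proof.
move=> a0 a1; elim: k => [|k IH]; first by rewrite mul0r subr0 expr0.
rewrite exprS -natr1; have k0 : 0 <= k%:R :> R by [].
have : 0 <= (1 - a) * ((1 - a) ^+ k - (1 - k%:R * a)).
  by rewrite mulr_ge0 ?subr_ge0.
have : 0 <= k%:R * a ^+ 2 by rewrite mulr_ge0 ?sqr_ge0.
lra.
Qed.

Section Planting.
Variables (R : realType) (n r : nat) (p : R).
Hypotheses (r2 : (2 <= r)%N) (p0 : 0 <= p) (p1 : p <= 1).
Implicit Types (G F : {set {set 'I_n}}) (U : {set 'I_n}).
Implicit Types (s t : 'I_n * {set 'I_n}).
Local Notation E := (complete_graph n).
Local Notation mu := (#|stars n r|%:R * p ^+ r).
Local Notation X := (nstars R (stars n r)).
Local Notation s2 := (pvar p E X).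

Lemma nstars_setU_ge F G :
  X F + nstars R [set t in stars n r | ~~ (star_edges t \subset F)] G <= X (F :|: G).
Proof.
rewrite /nstars [in leLHS]big_mkcond [X in _ + X <= _]big_mkcond.
rewrite [leRHS]big_mkcond -big_split; apply: ler_sum => t _ /=.
have -> : (t \in [set t in stars n r | ~~ (star_edges t \subset F)])
  = (t \in stars n r) && ~~ (star_edges t \subset F) by rewrite in_set.
case: (boolP (t \in stars n r)) => tS /=; last by rewrite addr0.
have FU : star_edges t \subset F -> star_edges t \subset F :|: G.
  by move=> h; apply: subset_trans h (subsetUl _ _).
have GU : star_edges t \subset G -> star_edges t \subset F :|: G.
  by move=> h; apply: subset_trans h (subsetUr _ _).
case: (boolP (star_edges t \subset F)) => tF /=; first by rewrite (FU tF) addr0.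
rewrite add0r; case: (boolP (star_edges t \subset G)) => [/GU ->//|_].
by rewrite ler0n.
Qed.

(** The stars inside F are gained for certain, but the mean of the other stars is only mu - p^r X F;
    the net gain is (1 - p^r) X F >= 3 x. The other stars have variance at most s2, so by Chebyshev
    they lose 2 x with probability at most 1/4. *)
Lemma pexp_plant_ge F (x : R) : 0 < x -> s2 <= x ^+ 2 ->
  3 * x <= (1 - p ^+ r) * X F ->
  3 / 4 <= pexp p E (fun G => (mu + x <= X (F :|: G))%R%:R).
Proof.
move=> x0 sx xF; set J := [set t in stars n r | ~~ (star_edges t \subset F)].
have JS : J \subset stars n r by apply/subsetP => t; rewrite inE => /andP[].
have cJ : #|J|%:R = #|stars n r|%:R - X F.
  rewrite nstarsE; apply/eqP; rewrite eq_sym subr_eq -natrD eqr_nat.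
  rewrite addnC -(cardsID [set t | star_edges t \subset F] (stars n r)).
  by apply/eqP; congr (_ + _)%N; apply: eq_card => t; rewrite !in_set // andbC.
have mJ : pexp p E (nstars R J) = mu - X F * p ^+ r.
  by rewrite (pexp_nstars p JS) cJ mulrBl.
have x20 : 0 < 2 * x by lra.
have := pexp_chebyshev E p0 p1 (nstars R J) x20.
set Q := pexp _ _ _ => hQ.
have {}hQ : Q <= 1 / 4.
  have := pvar_nstarsS p0 p1 JS => h.
  have x2 : 0 < x ^+ 2 by exact: exprn_gt0.
  have : (2 * x) ^+ 2 * Q <= x ^+ 2 by apply: le_trans hQ _; apply: le_trans h _.
  rewrite exprMn => h'; have : 2 ^+ 2 * Q <= 1 by rewrite -(ler_pM2l x2) mulr1; lra.
  by lra.
apply: (@le_trans _ _ (1 - Q)); first by lra.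
rewrite -(@pexp_predC _ _ p E (fun G => 2 * x <= `|nstars R J G - pexp p E (nstars R J)|)%R).
apply: ler_pexp => // G _; rewrite ler_nat -ltNge ltr_norml mJ.
case: (boolP (_ && _)) => //= /andP[h _]; rewrite lt0b.
have := nstars_setU_ge F G; rewrite -/J => hU; lra.
Qed.

Lemma ler_pexp_plant F (f : {set {set 'I_n}} -> R) : F \subset E ->
  (forall G, 0 <= f G) -> p ^+ #|F| * pexp p E (fun G => f (F :|: G)) <= pexp p E f.
Proof.
move=> FE f0; rewrite -(pexp_plant _ _ FE); apply: ler_pexp => // G _.
by case: (F \subset G); rewrite ?mul1r ?mul0r.
Qed.

Lemma tail_plant F (x : R) : F \subset E -> 0 < x -> s2 <= x ^+ 2 ->
  3 * x <= (1 - p ^+ r) * X F ->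
  p ^+ #|F| * (3 / 4) <= pexp p E (fun G => (mu + x <= X G)%R%:R).
Proof.
move=> FE x0 sx xF.
apply: le_trans (ler_pexp_plant FE (fun G => ler0n _ _)).
by apply: ler_wpM2l; [exact: exprn_ge0 | exact: pexp_plant_ge].
Qed.

Lemma pexp_plant_excess F : F \subset E -> (forall v, (deg F v <= r)%N) ->
  pexp p E (fun G => X (F :|: G) - X G)
  <= (2 * #|F|)%:R * (n%:R * p + r%:R) ^+ r.-1.
Proof.
move=> FE Fr; apply: le_trans (sum_touching p0 (ltnW r2) FE Fr).
rewrite (@eq_pexp _ _ _ _ _ (fun G => \sum_(t in stars n r)
   ((star_edges t \subset F :|: G)%:R - (star_edges t \subset G)%:R))); last first.
  by move=> G _; rewrite sumrB.
rewrite pexp_sum big_mkcondr /=; apply: ler_sum => t tS.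
case: ifP => [_|/negbT]; last first.
  rewrite negbK -setI_eq0 => /eqP d0.
  rewrite (@eq_pexp _ _ _ _ _ (fun=> 0)) ?pexp_cst // => G _.
  apply/eqP; rewrite subr_eq0; apply/eqP; congr (nat_of_bool _)%:R.
  apply/idP/idP => h; last by apply: subset_trans h (subsetUr _ _).
  apply/subsetP => e et; have := subsetP h e et; rewrite inE => /orP[eF|//].
  by have := in_set0 e; rewrite -d0 inE et eF.
have DE : star_edges t :\: F \subset E.
  by apply: subset_trans (subsetDl _ _) (star_edges_complete tS).
rewrite -(pexp_subset p DE); apply: ler_pexp => // G _; rewrite subDset.
by rewrite gerBl ler0n.
Qed.

(** The upper end comes from Chebyshev at 3 x for X G and from Markov for the stars created by F;
    the factor 16 is 8 times the 2 of [pexp_plant_excess]. In total 3/4 - 1/9 - 1/8 >= 1/2. The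
    upper end is needed later to bound a moment of X on the event by its probability. *)
Lemma pexp_plant_window F (x : R) : F \subset E -> (forall v, (deg F v <= r)%N) ->
  0 < x -> s2 <= x ^+ 2 -> 3 * x <= (1 - p ^+ r) * X F -> (0 < #|F|)%N ->
  1 / 2 <= pexp p E (fun G => (mu + x <= X (F :|: G)
    <= mu + 3 * x + (16 * #|F|)%:R * (n%:R * p + r%:R) ^+ r.-1)%R%:R).
Proof.
move=> FE Fr x0 sx xF F0.
set T := (16 * #|F|)%:R * _.
have T0 : 0 < T.
  rewrite mulr_gt0 ?ltr0n ?muln_gt0 // exprn_gt0 // ltr_wpDl ?mulr_ge0 //.
  by rewrite ltr0n ltnW.
have mX : pexp p E X = mu by rewrite (pexp_nstars p (subxx _)).
have hA := pexp_plant_ge x0 sx xF.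
have x30 : 0 < 3 * x by lra.
have := pexp_chebyshev E p0 p1 X x30; rewrite mX.
set Q := pexp _ _ _ => hQ.
have {}hQ : Q <= 1 / 9.
  have x2 : 0 < x ^+ 2 by exact: exprn_gt0.
  have : (3 * x) ^+ 2 * Q <= x ^+ 2 by apply: le_trans hQ _.
  rewrite exprMn => h'; have : 3 ^+ 2 * Q <= 1 by rewrite -(ler_pM2l x2) mulr1; lra.
  by lra.
have D0 G : 0 <= X (F :|: G) - X G.
  rewrite subr_ge0 /nstars; apply: ler_sum => t _; rewrite ler_nat.
  case: (boolP (star_edges t \subset G)) => // h.
  by rewrite (subset_trans h (subsetUr _ _)).
have := pexp_markov p0 p1 T (fun G (_ : G \subset E) => D0 G).
set W := pexp p E (fun G => (T <= _)%R%:R) => hW.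
have {}hW : W <= 1 / 8.
  have h := le_trans hW (pexp_plant_excess FE Fr).
  have : T * W <= T * (1 / 8).
    apply: le_trans h _; rewrite /T !natrM; lra.
  by rewrite ler_pM2l.
set A := pexp p E (fun G => (mu + x <= X (F :|: G))%R%:R) in hA.
apply: (@le_trans _ _ (A - Q - W)); first by lra.
rewrite -!pexpB; apply: ler_pexp => // G _.
case: (boolP (mu + x <= X (F :|: G))%R) => h1 /=; last first.
  by rewrite sub0r -opprD oppr_le0 addr_ge0 ?ler0n.
case: (boolP (3 * x <= `|X G - mu|)%R) => h2 /=.
  by rewrite subrr sub0r (le_trans _ (ler0n _ _)) // oppr_le0 ler0n.
case: (boolP (T <= X (F :|: G) - X G)%R) => h3 /=.
  by rewrite subr0 subrr ler0n.
rewrite !subr0; move: h2 h3; rewrite -!ltNge ltr_norml => /andP[_ h2] h3.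
suff -> : (X (F :|: G) <= mu + 3 * x + T)%R by [].
by lra.
Qed.

(** The properties of the union F of i vertex-disjoint stars with vertices in U that the moment
    argument uses. *)
Definition star_packing (i : nat) F U : Prop :=
  [/\ F \subset E, #|F| = (r * i)%N, (forall v, (deg F v <= r)%N),
      (forall v, v \notin U -> nbhd F v = set0) &
      (#|U| <= r.+1 * i)%N /\ i%:R <= X F].

Lemma nbhdU F G v : nbhd (F :|: G) v = nbhd F v :|: nbhd G v.
Proof. by apply/setP => x; rewrite !inE andb_orl. Qed.

Lemma star_packing0 : star_packing 0 set0 set0.
Proof.
have N0 v : nbhd (set0 : {set {set 'I_n}}) v = set0.
  by apply/setP => x; rewrite !inE.
split; rewrite ?sub0set ?cards0 ?muln0 //; last by rewrite nstars_ge0.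
by move=> v; rewrite /deg N0 cards0.
Qed.

Lemma star_packingS i F U t : star_packing i F U -> t \in stars n r ->
  [disjoint t.1 |: t.2 & U] ->
  star_packing i.+1 (F :|: star_edges t) (U :|: (t.1 |: t.2)).
Proof.
move=> [FE cF Fr FU [cU XF]] tS tU.
have mem_st v x : x \in nbhd (star_edges t) v -> v \in t.1 |: t.2.
  rewrite inE => /andP[/star_edgesP[y yt e] _].
  have : v \in [set t.1; y] by rewrite -e set21.
  by rewrite !inE => /orP[->//|/eqP ->]; rewrite yt orbT.
have tN v : v \in U -> nbhd (star_edges t) v = set0.
  move=> vU; apply/setP => x; rewrite [RHS]inE; apply/negP => /mem_st vt.
  by move: tU; rewrite disjoint_subset => /subsetP/(_ v vt); rewrite inE vU.
have t1U : t.1 \notin U.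
  apply/negP => h; move: tU; rewrite disjoint_subset => /subsetP/(_ t.1).
  by rewrite !inE eqxx h => /(_ isT).
have Ft : F :&: star_edges t = set0.
  apply/setP => e; rewrite !inE; apply/negP => /andP[eF /star_edgesP[x xt ee]].
  have := FU t.1 t1U => /setP/(_ x); rewrite !inE -ee eF /=.
  by case: eqP => // xt1; move: tS; rewrite inE -xt1 xt.
split.
- by rewrite subUset FE (star_edges_complete tS).
- by rewrite cardsU Ft cards0 subn0 cF (card_star_edges tS) mulnS addnC.
- move=> v; rewrite /deg nbhdU; case: (boolP (v \in U)) => [/tN ->|/FU ->].
    by rewrite setU0; exact: Fr.
  by rewrite set0U; exact: deg_star_edges.
- move=> v; rewrite inE negb_or => /andP[vU vt]; rewrite nbhdU FU // set0U.
  apply/setP => x; rewrite [RHS]inE; apply/negP => /mem_st; exact/negP.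
- split.
    apply: leq_trans (leq_card_setU _ _) _; rewrite mulnS addnC; apply: leq_add => //.
    apply: leq_trans (leq_card_setU _ _) _; rewrite cards1 add1n ltnS.
    by move: tS; rewrite inE => /andP[_ /eqP ->].
  apply: le_trans (nstars_setU_ge F (star_edges t)).
  rewrite -natr1; apply: lerD => //.
  rewrite /nstars (bigD1 t) /=; last first.
    rewrite inE tS /=; apply/negP => /setIidPl; rewrite setIC Ft => e0.
    by have := card_star_edges tS; rewrite -e0 cards0; lia.
  by rewrite subxx lerDl; apply: sumr_ge0.
Qed.

(** The centre u accounts for C(n-1, r) stars, the n - 1 other centres for C(n-2, r-1) each, which
    is r C(n-1, r) in total. *)
Lemma card_stars_vertex u :
  (#|[set t in stars n r | u \in t.1 |: t.2]| <= r.+1 * 'C(n.-1, r))%N.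
Proof.
have n0 : (0 < n)%N by apply: leq_ltn_trans (ltn_ord u).
apply: (@leq_trans (\sum_(v : 'I_n) if v == u then 'C(n.-1, r) else 'C(n.-2, r.-1))).
  rewrite -sum1_card (partition_big (fun t => t.1) predT) //=.
  apply: leq_sum => v _; rewrite sum1dep_card; case: eqP => [->|/eqP vu].
    rewrite -(deg_complete u) -card_stars_centre.
    apply/subset_leq_card/subsetP => t; rewrite !in_set => /andP[/andP[tS _] ->].
    by rewrite tS (@star_edges_complete n r) // in_set.
  apply: (@leq_trans #|[set A : {set 'I_n} | (A \subset ~: [set u; v]) & (#|A| == r.-1)]|).
    rewrite -(card_in_imset (f := fun t => t.2 :\ u)).
      apply/subset_leq_card/subsetP => A /imsetP[[w B]].
      rewrite !inE /= => /andP[/andP[/andP[wB /eqP Br] uB] /eqP wv] ->; subst w.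
      rewrite eq_sym (negbTE vu) /= in uB.
      apply/andP; split; last by rewrite -Br (cardsD1 u B) uB.
      apply/subsetP => x; rewrite !inE => /andP[xu xB]; rewrite negb_or xu /=.
      by apply: contraNneq wB => <-.
    move=> [w B] [w' B']; rewrite !inE /= => /andP[/andP[_ uB] /eqP wv].
    move=> /andP[/andP[_ uB'] /eqP wv'] h; subst w w'.
    rewrite eq_sym (negbTE vu) /= in uB uB'.
    by rewrite -(setD1K uB) h (setD1K uB').
  rewrite cards_draws cardsCs setCK cards2 eq_sym vu card_ord.
  by rewrite (_ : (n - (true.+1))%N = n.-2) //; lia.
rewrite (bigD1 u) //= eqxx (eq_bigr (fun=> 'C(n.-2, r.-1))); last first.
  by move=> v /negbTE ->.
rewrite sum_nat_const mulSn leq_add2l.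
rewrite (_ : #|_| = n.-1); last first.
  by transitivity #|predC1 u|; [exact: eq_card | rewrite cardC1 card_ord].
by rewrite mul_bin_diag prednK // ltnW.
Qed.

(** * A high moment of the star count against planted vertex-disjoint stars *)

Section RandomPacking.
Variables (x : R) (J : nat).
Hypotheses (x0 : 0 < x) (sx : s2 <= x ^+ 2) (J0 : (0 < J)%N).
Hypotheses (pJ : 3 * x <= (1 - p ^+ r) * J%:R).
Hypothesis (Jn : ((r.+1 * J) ^ 2 * 4 <= n)%N).

(** The upper end of the window of [pexp_plant_window] when the planted set has the r J edges of J
    disjoint stars; [A] is the indicator of that window. *)
Let top : R := mu + 3 * x + (16 * (r * J))%:R * (n%:R * p + r%:R) ^+ r.-1.
Let A G : R := (mu + x <= X G <= top)%R%:R.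
Let B : R := #|stars n r|%:R * (1 - (r.+1 ^ 2 * J)%:R / n%:R).

(** At most (r + 1) J vertices are occupied, and each of them lies in at most a fraction (r + 1) / n
    of all stars. *)
Lemma packing_choices i F U : (i < J)%N -> star_packing i F U ->
  B <= #|[set t in stars n r | [disjoint t.1 |: t.2 & U]]|%:R.
Proof.
move=> iJ [_ _ _ _ [cU _]].
have n0 : (0 < n)%N by apply: leq_trans Jn; rewrite muln_gt0 expn_gt0 muln_gt0 J0.
have bad : (#|[set t in stars n r | ~~ [disjoint t.1 |: t.2 & U]]|
   <= r.+1 * J * (r.+1 * 'C(n.-1, r)))%N.
  apply: (@leq_trans #|\bigcup_(u in U) [set t in stars n r | u \in t.1 |: t.2]|).
    apply/subset_leq_card/subsetP => t; rewrite inE => /andP[tS].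
    rewrite -setI_eq0 => /set0Pn[u]; rewrite in_setI => /andP[ut uU].
    by apply/bigcupP; exists u; rewrite // in_set tS.
  apply: leq_trans (leq_card_bigcup _ _) _.
  apply: (@leq_trans (\sum_(u in U) r.+1 * 'C(n.-1, r))%N).
    by apply: leq_sum => u _; exact: card_stars_vertex.
  rewrite sum_nat_const; apply: leq_mul => //; apply: leq_trans cU _.
  by rewrite leq_mul2l (ltnW iJ) orbT.
have : (#|stars n r| <= #|[set t in stars n r | [disjoint t.1 |: t.2 & U]]|
   + #|[set t in stars n r | ~~ [disjoint t.1 |: t.2 & U]]|)%N.
  rewrite -!sum1_card (bigID (fun t => [disjoint t.1 |: t.2 & U])) /=.
  by apply/eq_leq; congr (_ + _)%N; apply: eq_bigl => t; rewrite [RHS]in_set.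
move=> h; have {h bad} : (#|stars n r| <= #|[set t in stars n r | [disjoint t.1 |: t.2 & U]]|
   + r.+1 * J * (r.+1 * 'C(n.-1, r)))%N by lia.
rewrite -(ler_nat R) natrD => h.
suff -> : B = #|stars n r|%:R - (r.+1 * J * (r.+1 * 'C(n.-1, r)))%:R by lra.
rewrite /B card_stars !natrM; field.
by rewrite pnatr_eq0 -lt0n.
Qed.

Lemma B_ge0 : 0 <= B.
Proof.
have n0 : (0 < n)%N by apply: leq_trans Jn; rewrite muln_gt0 expn_gt0 muln_gt0 J0.
rewrite mulr_ge0 // subr_ge0 ler_pdivrMr ?ltr0n // mul1r ler_nat.
apply: leq_trans Jn; nia.
Qed.

(** Expanding one factor X over the stars and keeping those disjoint from U plants one more star.
    After J rounds the planted stars put X into the window with probability at least 1/2. *)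
Lemma packing_moment i j F U : (i + j = J)%N -> star_packing i F U ->
  p ^+ (r * i) * (p ^+ r * B) ^+ j / 2
  <= pexp p E (fun G => (F \subset G)%:R * (A G * X G ^+ j)).
Proof.
elim: j i F U => [|j IH] i F U.
  rewrite addn0 => -> [FE cF Fr _ [_ XF]]; rewrite expr0 mulr1.
  rewrite (@eq_pexp _ _ _ _ _ (fun G => (F \subset G)%:R * A G)); last first.
    by move=> G _; rewrite expr0 mulr1.
  rewrite (pexp_plant _ _ FE) cF; apply: ler_wpM2l; first exact: exprn_ge0.
  rewrite -div1r /A /top -cF; apply: pexp_plant_window => //; last by rewrite cF; lia.
  apply: le_trans pJ _; apply: ler_wpM2l => //.
  by rewrite subr_ge0 exprn_ile1.
move=> iJ FP; have [FE cF _ _ _] := FP.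
apply: (@le_trans _ _ (\sum_(t in [set t in stars n r | [disjoint t.1 |: t.2 & U]])
  (p ^+ (r * i.+1) * (p ^+ r * B) ^+ j / 2))).
  rewrite sumr_const -[leRHS]mulr_natl.
  have := packing_choices (ltac:(lia) : (i < J)%N) FP.
  set N := #|_|%:R => BN.
  have c0 : 0 <= p ^+ (r * i.+1) * (p ^+ r * B) ^+ j / 2.
    by rewrite divr_ge0 // mulr_ge0 ?exprn_ge0 // mulr_ge0 ?exprn_ge0 ?B_ge0.
  apply: le_trans (ler_wpM2r c0 BN); rewrite mulnS exprD exprS.
  by rewrite le_eqVlt; apply/orP; left; apply/eqP; ring.
rewrite (@eq_pexp _ _ _ _ _ (fun G => \sum_(t in stars n r)
  (F :|: star_edges t \subset G)%:R * (A G * X G ^+ j))); last first.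
  move=> G _; rewrite exprS [X in _ * (_ * (X * _))]/nstars !mulr_suml !mulr_sumr.
  apply: eq_bigr => t _; rewrite subUset -mulnb natrM.
  by rewrite !mulrA; congr (_ * _); rewrite mulrAC.
rewrite pexp_sum [leRHS](bigID (fun t => [disjoint t.1 |: t.2 & U])) /= -[leLHS]addr0.
apply: lerD; last first.
  by apply: sumr_ge0 => t _; apply: pexp_ge0 => // G _;
    rewrite !mulr_ge0 // exprn_ge0 // nstars_ge0.
rewrite (eq_bigl (fun t => (t \in stars n r) && [disjoint t.1 |: t.2 & U])); last first.
  by move=> t; rewrite in_set.
apply: ler_sum => t /andP[tS tU]; apply: (IH i.+1 _ (U :|: (t.1 |: t.2))); first by rewrite addSnnS.
exact: star_packingS.
Qed.

(** On the window X^J <= top^J, so the moment bounds the probability from below. The choices lost to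
    occupied vertices cost (1 - a)^J >= 1 - J a >= 3/4, because J is small against sqrt n; then 3/8
    = 3/4 * 1/2. *)
Lemma tail_packing : (3 / 8) * (mu / top) ^+ J <= pexp p E (fun G => (mu + x <= X G)%R%:R).
Proof.
have n0 : (0 < n)%N by apply: leq_trans Jn; rewrite muln_gt0 expn_gt0 muln_gt0 J0.
have mu0 : 0 <= mu by rewrite mulr_ge0 ?exprn_ge0.
have np0 : 0 <= n%:R * p by rewrite mulr_ge0.
have top0 : 0 < top.
  have : 0 <= (16 * (r * J))%:R * (n%:R * p + r%:R) ^+ r.-1.
    by rewrite mulr_ge0 // exprn_ge0 // addr_ge0.
  by move=> h; rewrite /top ltr_wpDr // ltr_wpDl // mulr_gt0.
have := packing_moment (add0n J) star_packing0; rewrite muln0 expr0 mul1r => h.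
have {}h : (p ^+ r * B) ^+ J / 2 <= top ^+ J * pexp p E (fun G => (mu + x <= X G)%R%:R).
  apply: le_trans h _; rewrite -pexpZ; apply: ler_pexp => // G _.
  rewrite sub0set mul1r /A.
  case: (boolP (mu + x <= X G)%R) => h1 /=; last by rewrite mul0r mulr0.
  case: (boolP (X G <= top)%R) => h2 /=; last by rewrite mul0r mulr1 exprn_ge0 // ltW.
  by rewrite mul1r mulr1; apply: lerXn2r; rewrite ?nnegrE ?nstars_ge0 // ltW.
rewrite expr_div_n mulrA ler_pdivrMr ?exprn_gt0 // [leRHS]mulrC; apply: le_trans h.
set a : R := (r.+1 ^ 2 * J)%:R / n%:R.
have -> : p ^+ r * B = mu * (1 - a) by rewrite /B /a mulrA [p ^+ r * _]mulrC.
rewrite (exprMn _ mu).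
have a0 : 0 <= a by rewrite divr_ge0.
have Ja : J%:R * a <= 1 / 4.
  rewrite /a mulrA ler_pdivrMr ?ltr0n //.
  have := Jn; rewrite -(ler_nat R) natrM => hh.
  have e : J%:R * (r.+1 ^ 2 * J)%:R = ((r.+1 * J) ^ 2)%:R :> R.
    by rewrite -natrM expnMn mulnCA mulnn.
  by rewrite e; lra.
have a1 : a <= 1.
  have : 1 <= J%:R :> R by rewrite ler1n.
  nra.
have := bernoulli_inequality J a0 a1.
set c := (1 - a) ^+ J => hc.
have : 0 <= mu ^+ J * (c - 3 / 4) by rewrite mulr_ge0 ?exprn_ge0 //; lra.
set m := mu ^+ J; lra.
Qed.

End RandomPacking.

End Planting.

(** * Tilting and clusters *)

Section TiltAndClusters.
Variables (R : realType) (n r : nat).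
Implicit Types (G F : {set {set 'I_n}}).
Local Notation E := (complete_graph n).
Local Notation X := (nstars R (stars n r)).

(** By Chebyshev the event has q-probability at least 1/2; [pexp_tilt] is applied to its indicator,
    which equals its own square. *)
Lemma tail_tilt (p q T y : R) : 0 < p -> p < 1 -> 0 <= q -> q <= 1 -> 0 < y ->
  T + y <= pexp q E X -> 2 * pvar q E X <= y ^+ 2 ->
  1 / 4 <= (1 + (q - p) ^+ 2 / (p * (1 - p))) ^+ #|E|
           * pexp p E (fun G => (T <= X G)%R%:R).
Proof.
move=> p0 p1 q0 q1 y0 Ty vy.
have := @pexp_tilt R _ p q E (fun G => (T <= X G)%R%:R) p0 p1 q0 q1.
rewrite [pexp p E _](@eq_pexp _ _ _ _ _ (fun G => (T <= X G)%R%:R)); last first.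
  by move=> G _; case: (T <= X G)%R; rewrite ?expr1n ?expr0n.
apply: le_trans.
suff h : 1 / 2 <= pexp q E (fun G => (T <= X G)%R%:R).
  set Q := pexp _ _ _ in h *; nra.
have := pexp_chebyshev E q0 q1 X y0.
set Q := pexp q E (fun G => (y <= `|_|)%R%:R) => hQ.
have y2 : 0 < y ^+ 2 by exact: exprn_gt0.
have {}hQ : Q <= 1 / 2.
  by rewrite -(ler_pM2l y2); apply: le_trans hQ _; lra.
apply: (@le_trans _ _ (1 - Q)); first by lra.
rewrite -(@pexp_predC _ _ q E (fun G => y <= `|X G - pexp q E X|)%R).
apply: ler_pexp => // G _; rewrite ler_nat -ltNge ltr_norml.
case: (boolP (_ && _)) => //= /andP[h _]; rewrite lt0b; lra.
Qed.

(** The shape for the term y of M: k edges carry about k^r stars. *)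
Lemma star_cluster k : (k < n)%N ->
  exists F, [/\ F \subset E, #|F| = k & ('C(k, r))%:R <= X F].
Proof.
move=> kn; have v : 'I_n by exact: Ordinal kn.
have : (k <= #|[set~ v]|)%N by rewrite cardsC1 card_ord; lia.
rewrite cardE => kc; pose A := [set x in take k (enum [set~ v])].
have Ak : #|A| = k.
  rewrite cardsE (card_uniqP _) ?take_uniq ?enum_uniq //.
  by rewrite size_take; case: ltngtP kc => // ->.
have vA : v \notin A.
  by rewrite inE; apply/negP => /mem_take; rewrite mem_enum !inE eqxx.
have tS : (v, A) \in stars n k by rewrite inE vA Ak eqxx.
exists (star_edges (v, A)); split.
- exact: star_edges_complete tS.
- exact: card_star_edges tS.
have kE : (k <= deg (star_edges (v, A)) v)%N.
  by rewrite -[leqLHS]Ak; apply/subset_leq_card; rewrite -(star_edges_sub _ tS).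
rewrite nstarsE card_stars_in ler_nat (bigD1 v) //=.
by apply: leq_trans (leq_addr _ _); apply: leq_bin2l.
Qed.

(** The shape for the term x / n^(r-1) of M: k n edges carry about k n^r stars. *)
Lemma hub_cluster k : (k <= n)%N ->
  exists F, [/\ F \subset E, (#|F| <= k * n)%N & (k * 'C(n.-1, r))%:R <= X F].
Proof.
move=> kn; pose W := [set x in take k (enum 'I_n)].
have Wk : #|W| = k.
  rewrite cardsE (card_uniqP _) ?take_uniq ?enum_uniq // size_take size_enum_ord.
  by case: ltngtP kn => // ->.
exists [set e in E | e :&: W != set0]; split.
- by apply/subsetP => e; rewrite inE => /andP[].
- apply: (@leq_trans #|\bigcup_(w in W) [set [set w; x] | x : 'I_n]|).
    apply/subset_leq_card/subsetP => e; rewrite in_set => /andP[eE /set0Pn[w]].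
    rewrite in_setI => /andP[we wW]; apply/bigcupP; exists w => //.
    move: eE; rewrite inE => /cards2P[x [y [_ ee]]].
    move: we; rewrite ee !inE => /orP[/eqP->|/eqP->]; first exact: imset_f.
    by rewrite setUC; exact: imset_f.
  apply: leq_trans (leq_card_bigcup _ _) _; rewrite -Wk -sum_nat_const.
  by apply: leq_sum => w _; apply: leq_trans (leq_imset_card _ _) _; rewrite card_ord.
rewrite nstarsE card_stars_in ler_nat (bigID (mem W)) /=.
apply: leq_trans (leq_addr _ _); rewrite -[k in leqLHS]Wk -sum_nat_const.
apply: leq_sum => v vW; rewrite (_ : deg _ v = n.-1) //.
rewrite -(deg_complete v); apply: eq_card => x; rewrite !in_set.
case: (boolP (#|[set v; x]| == 2%N)) => //= _.
by case: (boolP (_ != set0)) => // /negbNE/eqP/setP/(_ v); rewrite in_set0 in_setI set21 vW.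
Qed.

Lemma card_complete_le : (#|E| <= n ^ 2)%N.
Proof.
apply: (@leq_trans 'C(n, 2)); last exact: leq_bin_exp.
by rewrite -[n in 'C(n, _)]card_ord -card_draws.
Qed.

Lemma nstars_complete : X E = #|stars n r|%:R.
Proof.
rewrite nstarsE; congr _%:R; apply: eq_card => t.
apply/idP/idP => [|tS]; first by rewrite in_set => /andP[].
by rewrite in_set tS (star_edges_complete tS).
Qed.

End TiltAndClusters.

(** * Elementary inequalities *)

Section RealBounds.
Variable R : realType.
Implicit Types x y z t d : R.

Lemma ln_le_sub1 x : 0 < x -> ln x <= x - 1.
Proof.
move=> x0; have := @le_ln1Dx R (x - 1); rewrite (addrC 1) subrK; apply; lra.
Qed.

Lemma ln_ge_subV x : 0 < x -> 1 - x^-1 <= ln x.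
Proof.
move=> x0; have := @ln_le_sub1 x^-1; rewrite invr_gt0 => /(_ x0).
by rewrite lnV ?posrE //; lra.
Qed.

Lemma phi_le_sqr x : 0 <= x -> phi x <= x ^+ 2.
Proof.
move=> x0; rewrite /phi; have := @le_ln1Dx R x; set l := ln _ => h.
have {}h : l <= x by apply: h; lra.
by nra.
Qed.

Lemma phi_le x : 0 <= x -> phi x <= x * ln (1 + x).
Proof.
move=> x0; rewrite /phi; have := @le_ln1Dx R x; set l := ln _ => h.
have {}h : l <= x by apply: h; lra.
lra.
Qed.

(* [ln (1 + x) = 2 ln s >= 2 (1 - 1 / s)] for [s = sqrt (1 + x)] gives the constant 4. *)
Lemma phi_ge x : 0 <= x -> x * ln (1 + x) / 4 <= phi x.
Proof.
move=> x0; rewrite /phi; set s := Num.sqrt (1 + x).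
have s2 : s ^+ 2 = 1 + x by rewrite sqr_sqrtr //; lra.
have s1 : 1 <= s by rewrite -sqrtr1 ler_wsqrtr //; lra.
have s0 : 0 < s by lra.
have -> : ln (1 + x) = 2 * ln s by rewrite -s2 lnXn // mulr_natl.
have := ln_ge_subV s0; set l := ln s => hl.
have sl : s - 1 <= s * l.
  have := ler_wpM2l (ltW s0) hl; rewrite mulrBr mulr1 mulfV ?gt_eqF //.
have -> : x = s ^+ 2 - 1 by rewrite s2; lra.
have h : 0 <= (1 + 3 * s ^+ 2) * (s * l - (s - 1)).
  by rewrite mulr_ge0 //; [have := sqr_ge0 s; lra | lra].
have h2 : 0 <= (s - 1) ^+ 3 by rewrite exprn_ge0 //; lra.
rewrite -subr_ge0 -(pmulr_rge0 _ s0).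
have -> : s * ((1 + (s ^+ 2 - 1)) * (2 * l) - (s ^+ 2 - 1) -
   (s ^+ 2 - 1) * (2 * l) / 4) = ((1 + 3 * s ^+ 2) * (s * l - (s - 1))
   + (s - 1) ^+ 3) / 2 by field.
by lra.
Qed.

Lemma ln1D_ge0 x : 0 <= x -> 0 <= ln (1 + x).
Proof. by move=> x0; apply: ln_ge0; lra. Qed.

Lemma ler_ln1D x y : 0 <= x -> x <= y -> ln (1 + x) <= ln (1 + y).
Proof. by move=> x0 xy; rewrite ler_ln ?posrE; lra. Qed.

Lemma ln1D_natM x (m : nat) : 0 <= x -> ln (1 + m%:R * x) <= m%:R * ln (1 + x).
Proof.
move=> x0; rewrite [leRHS]mulr_natl -lnXn; last by lra.
have mx : 0 <= m%:R * x by rewrite mulr_ge0.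
rewrite ler_ln ?posrE ?exprn_gt0 //; try lra.
elim: m {mx} => [|m IH]; first by rewrite mul0r addr0 expr0.
have mx : 0 <= m%:R * x by rewrite mulr_ge0.
rewrite exprS; apply: (@le_trans _ _ ((1 + x) * (1 + m%:R * x))).
  by rewrite -natr1; nra.
by apply: ler_wpM2l => //; lra.
Qed.

Lemma ln1D_ge x a : 1 <= a -> a^-1 <= x -> (2 * a)^-1 <= ln (1 + x).
Proof.
move=> a1 ax; have a0 : 0 < a by lra.
have i0 : 0 < a^-1 by rewrite invr_gt0.
apply: (@le_trans _ _ (ln (1 + a^-1))); last by apply: ler_ln1D => //; exact: ltW.
have h := @ln_ge_subV (1 + a^-1) (ltac:(lra)); apply: le_trans h.
have -> : 1 - (1 + a^-1)^-1 = (a + 1)^-1 by field; rewrite !gt_eqF //; lra.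
by rewrite lef_pV2 ?posrE; lra.
Qed.

Lemma mulr_ln_le1 x y : 0 < x -> 0 < y -> x <= y -> x * (ln y - ln x) <= y.
Proof.
move=> x0 y0 xy; rewrite -ln_div ?posrE // mulrC -ler_pdivlMr //.
by apply: ltW; apply: ln_sublinear; exact: divr_gt0.
Qed.

(** Here x is a degree. For x <= y the number of stars per unit of cost, x^(r-1) / log (x / d), is
    at most of order y^(r-1) / L. The logarithm lost in passing from y to x is absorbed by x log (y
    / x) <= y, which spends one factor x and so needs r >= 2. *)
Lemma log_scale (L A K : R) (r : nat) x y d : (2 <= r)%N ->
  0 < d -> 0 < y -> 0 < x -> 1 <= K -> 0 <= A -> 0 <= L ->
  L <= 1 + A * (ln K + ln y - ln d) -> 1 <= ln x - ln d ->
  (x <= y -> L * x ^+ r.-1 <= (1 + A * (ln K + 2)) * (y ^+ r.-1 * (ln x - ln d)))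
  /\ (y <= x -> L <= (1 + A * (ln K + 2)) * (ln x - ln d)).
Proof.
move=> r2 d0 y0 x0 K1 A0 L0 hL hx; have lK := ln_ge0 K1.
set u := ln x - ln d in hx *; split => xy.
  have h1 : L * x <= (1 + A * (ln K + 2)) * (y * u).
    have h := mulr_ln_le1 x0 y0 xy.
    apply: (@le_trans _ _ ((1 + A * (ln K + ln y - ln d)) * x)).
      by apply: ler_wpM2r => //; exact: ltW.
    have yu : y <= y * u by rewrite ler_peMr // ltW.
    have xyu : x <= y * u by exact: le_trans xy yu.
    have e : ln K + ln y - ln d = ln K + (ln y - ln x) + u by rewrite /u; lra.
    have h3 : x * (ln K + ln y - ln d) <= (ln K + 2) * (y * u).
      rewrite e.
      have h4 : x * ln K <= ln K * (y * u) by rewrite mulrC; apply: ler_wpM2l.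
      have h5 : x * u <= y * u by apply: ler_wpM2r => //; lra.
      by lra.
    have := ler_wpM2l A0 h3; lra.
  case: r r2 => [|[|r]] //= _.
  rewrite !exprS; have xr : x ^+ r <= y ^+ r by apply: lerXn2r xy; rewrite nnegrE ltW.
  have xr0 : 0 <= x ^+ r by rewrite exprn_ge0 // ltW.
  apply: (@le_trans _ _ ((1 + A * (ln K + 2)) * (y * u) * x ^+ r)).
    by rewrite mulrA; apply: ler_wpM2r.
  rewrite [y * y ^+ r]mulrC -!mulrA; apply: ler_wpM2l.
    by rewrite addr_ge0 // mulr_ge0 // addr_ge0.
  rewrite !mulrA [y ^+ r * y]mulrC -!mulrA; apply: ler_wpM2l; first exact: ltW.
  by rewrite mulrC; apply: ler_wpM2r => //; lra.
have lyx : ln y <= ln x by rewrite ler_ln ?posrE.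
apply: le_trans hL _.
have h3 : ln K + ln y - ln d <= (ln K + 2) * u.
  have : ln K <= ln K * u by rewrite ler_peMr.
  by rewrite /u in hx *; lra.
by have := ler_wpM2l A0 h3; lra.
Qed.

Lemma ln_256 : 4 <= ln (256 : R).
Proof.
rewrite -(expRK 4) ler_ln ?posrE ?expR_gt0 //.
have -> : 4 = 4%:R * 1 :> R by rewrite mulr1.
rewrite expRM_natl; apply: (@le_trans _ _ (4 ^+ 4)); last by lra.
by apply: lerXn2r; rewrite ?nnegrE ?expR_ge0 ?expR1_le4.
Qed.

(** The bound (e d / x)^x in exponential form, from x! >= (x / e)^x. *)
Lemma bin_exp_le (n : nat) (p : R) (x : nat) : (0 < n)%N -> 0 < p -> (0 < x)%N ->
  'C(n.-1, x)%:R * p ^+ x <= expR (x%:R * (1 - (ln x%:R - ln (n%:R * p)))).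
Proof.
move=> n0 p0 x0; have xR : 0 < x%:R :> R by rewrite ltr0n.
have d0 : 0 < n%:R * p by rewrite mulr_gt0 ?ltr0n.
have f0 : 0 < x`!%:R :> R by rewrite ltr0n fact_gt0.
have h1 : 'C(n.-1, x)%:R * x`!%:R <= n%:R ^+ x :> R.
  rewrite -natrM bin_ffact -natrX ler_nat.
  elim: (x) => // k IH; rewrite ffactnSr expnSr leq_mul //.
  by apply: leq_trans (leq_subr _ _) (leq_pred _).
have h2 : x%:R ^+ x <= expR x%:R * x`!%:R :> R.
  rewrite -ler_pdivrMr //; have := @expR_ge1Dxn R x%:R x.-1 (ler0n _ _).
  rewrite prednK //; apply: le_trans; lra.
have -> : expR (x%:R * (1 - (ln x%:R - ln (n%:R * p))))
   = expR x%:R * (n%:R * p) ^+ x / x%:R ^+ x.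
  rewrite expRM_natl opprB addrA expRB expRD !lnK ?posrE //.
  by rewrite expr_div_n exprMn -expRM_natl mulr1.
rewrite ler_pdivlMr ?exprn_gt0 // exprMn.
have p0' : 0 <= p ^+ x by rewrite exprn_ge0 // ltW.
rewrite -(ler_pM2r f0).
set c := 'C(n.-1, x)%:R in h1 *; set f := x`!%:R in h1 h2 f0 *.
apply: (@le_trans _ _ (p ^+ x * (n%:R ^+ x * (expR x%:R * f)))); last first.
  by rewrite le_eqVlt; apply/orP; left; apply/eqP; ring.
have -> : c * p ^+ x * x%:R ^+ x * f = p ^+ x * ((c * f) * x%:R ^+ x) by ring.
apply: ler_wpM2l => //; apply: ler_pM => //.
  by rewrite mulr_ge0 // ltW.
by rewrite exprn_ge0.
Qed.

(** Each factor of the falling factorial is at least n - r, and n <= (r + 1)(n - r) as soon as n >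
    r. *)
Lemma exp_le_bin (n r : nat) : (r < n)%N ->
  (n ^ r <= r`! * r.+1 ^ r * 'C(n.-1, r))%N.
Proof.
move=> rn; rewrite mulnAC (mulnC r`!) bin_ffact.
have : forall k, (k <= r)%N -> ((n - r) ^ k <= n.-1 ^_ k)%N.
  elim=> // k IH kr; rewrite expnSr ffactnSr leq_mul //; first by apply: IH; lia.
  by lia.
move=> /(_ r (leqnn r)) h; apply: (@leq_trans ((n - r) ^ r * r.+1 ^ r)%N).
  by rewrite -expnMn; apply: leq_exp_r; nia.
by rewrite leq_mul2r h orbT.
Qed.

End RealBounds.

(** * Upper bound for the tail probability *)

Section UpperTail.
Variables (R : realType) (n r : nat) (p eps : R).
Implicit Types (G : {set {set 'I_n}}).
Local Notation E := (complete_graph n).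
Local Notation X := (nstars R (stars n r)).
Local Notation mu := (#|stars n r|%:R * p ^+ r).
Local Notation d := (n%:R * p).
Local Notation light D G := ((\sum_(v | (deg G v < D)%N) 'C(deg G v, r))%:R : R).
Local Notation heavy D G := ((\sum_(v | ~~ (deg G v < D)%N) 'C(deg G v, r))%:R : R).
Local Notation cost t := (t%:R * (ln t%:R - ln d)).

Lemma light_exp (D : nat) : (2 <= r)%N -> 0 < p -> p <= 1 -> 0 < eps -> 0 < mu ->
  (0 < D)%N ->
  pexp p E (fun G => ((1 + eps / 2) * mu <= light D G)%R%:R)
  <= expR (- (eps * mu * ln (1 + eps) / (16 * (2 * D ^ r.-1 * r)%:R))).
Proof.
move=> r2 p0 p1 e0 mu0 D0; have [Q QE] : exists Q : R, Q = (2 * D ^ r.-1 * r)%:R by eexists.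
rewrite -QE; have Q0 : 0 < Q by rewrite QE ltr0n !muln_gt0 expn_gt0 D0 (ltnW r2).
have x0 : 0 < eps * mu by exact: mulr_gt0.
(* The excess eps mu / 2 is split in two: Q k <= eps mu / 4 pays for the blocked stars, and the rest
   gives the ratio 1 + eps / 4 for each of the k + 1 stars of a tuple. Passing to ln (1 + eps) costs
   a second factor 4, whence 16. *)
set z := eps * mu / (4 * Q); have z0 : 0 <= z by apply/ltW/divr_gt0/mulr_gt0.
have /andP := truncn_itv z0; move: (Num.truncn z) => k [kz zk].
have B0 : 0 < (1 + eps / 4) * mu by rewrite mulr_gt0 // addr_gt0 // divr_gt0.
have := light_tail n (ltW p0) p1 D k (ltnW r2) (ltW B0).
set P := pexp _ _ _ => h.
have {}h : (1 + eps / 4) ^+ k.+1 * P <= 1.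
  have m0 : 0 < mu ^+ k.+1 by exact: exprn_gt0.
  rewrite -(ler_pM2r m0) mul1r; apply: le_trans h.
  by rewrite (exprMn _ (1 + eps / 4)) mulrAC.
apply: (@le_trans _ _ P).
  apply: ler_pexp; rewrite ?(ltW p0) // => G _.
  rewrite ler_nat; case: (boolP ((1 + eps / 2) * mu <= light D G)%R) => h1 //=.
  rewrite lt0b.
  apply: le_trans h1.
  have : (2 * D ^ r.-1 * (r * k))%:R <= eps * mu / 4.
    rewrite mulnA natrM -QE; have := ler_wpM2l (ltW Q0) kz.
    rewrite /z; have -> : Q * (eps * mu / (4 * Q)) = eps * mu / 4.
      by move: (eps * mu) (Q) Q0 => x' q q0; field; exact: lt0r_neq0.
    by [].
  have -> : (1 + eps / 2) * mu = (1 + eps / 4) * mu + eps * mu / 4.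
    by move: (mu) => m; field.
  by rewrite lerD2l.
have l0 := ln1D_ge0 (ltW e0).
have e4 : 0 <= eps / 4 by lra.
have l4 := ln1D_ge0 e4.
have b0 : 0 < 1 + eps / 4 by lra.
apply: (@le_trans _ _ ((1 + eps / 4) ^+ k.+1)^-1).
  by rewrite -[leRHS]mulr1 ler_pdivlMl ?exprn_gt0.
rewrite -[X in (X ^+ _)^-1]lnK ?posrE // -expRM_natl -expRN ler_expR lerN2.
have l14 : ln (1 + eps) <= 4 * ln (1 + eps / 4).
  have := @ln1D_natM R (eps / 4) 4 e4.
  by rewrite (_ : 4%:R * (eps / 4) = eps) //; lra.
apply: (@le_trans _ _ (z * ln (1 + eps / 4))); last first.
  by apply: ler_wpM2r => //; exact: ltW.
have -> : eps * mu * ln (1 + eps) / (16 * Q) = z * (ln (1 + eps) / 4).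
  rewrite /z; move: (eps * mu) (Q) Q0 (ln _) => x' q q0 l; field; exact: lt0r_neq0.
by apply: ler_wpM2l => //; lra.
Qed.

(** With u = log (t / d), degree t has probability at most exp (t - t u). Half of t u pays for w^2,
    a quarter absorbs t because u >= 4, and the last quarter gives n^-2 because t u >= 8 log n. *)
Lemma heavy_exp (D : nat) (s : R) : (0 < n)%N -> 0 < p -> p <= 1 -> (0 < D)%N ->
  (forall t, (D <= t < n)%N -> 4 <= ln t%:R - ln d) ->
  (forall t, (D <= t < n)%N -> 8 * ln n%:R <= cost t) ->
  pexp p E (fun G => (s <= \sum_(v | ~~ (deg G v < D)%N) cost (deg G v))%R%:R)
  <= 2 * expR (- (s / 4)).
Proof.
move=> n0 p0 p1 D0 h4 h8.
have nR : 0 < n%:R :> R by rewrite ltr0n.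
pose w (t : nat) : R := expR (cost t / 4).
have w0 t : 0 <= w t by exact: expR_ge0.
have hw t : (D <= t < n)%N ->
    'C(n.-1, t)%:R * p ^+ t * w t ^+ 2 <= n%:R^-1 ^+ 2.
  move=> tD; have t0 : (0 < t)%N by case/andP: tD => + _; exact: leq_trans.
  have := bin_exp_le n0 p0 t0 => /(ler_wpM2r (sqr_ge0 (w t))) h.
  apply: le_trans h _; rewrite /w -expRM_natl -expRD.
  rewrite (_ : n%:R^-1 ^+ 2 = expR (2%:R * - ln n%:R)); last first.
    by rewrite expRM_natl expRN lnK ?posrE.
  rewrite ler_expR; have := h4 t tD; have := h8 t tD.
  set u := ln t%:R - ln d => hu8 hu4.
  have : 0 <= t%:R * (u - 4) by rewrite mulr_ge0 // subr_ge0.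
  lra.
have := heavy_moment (ltW p0) p1 n0 w0 hw.
have := @pexp_markov R _ p E (ltW p0) p1
  (fun G => \prod_v (if (deg G v < D)%N then 1 else w (deg G v))) (expR (s / 4)).
have f0 G : G \subset E -> 0 <= \prod_v (if (deg G v < D)%N then 1 else w (deg G v)).
  by move=> _; apply: prodr_ge0 => v _; case: ifP.
move=> /(_ f0) h1 h2; have {}h1 := le_trans h1 h2.
rewrite expRN [leRHS]mulrC ler_pdivlMl ?expR_gt0 //.
apply: le_trans h1.
apply: ler_wpM2l; first exact: expR_ge0.
apply: ler_pexp => // [|G _]; first exact: ltW.
rewrite ler_nat; case: (boolP (s <= _)%R) => h //=; rewrite lt0b.
rewrite (bigID (fun v => (deg G v < D)%N)) /= big1 ?mul1r; last by move=> v ->.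
rewrite (eq_bigr (fun v => expR (cost (deg G v) / 4))); last by move=> v /negbTE ->.
rewrite -expR_sum ler_expR -mulr_suml; lra.
Qed.

(** If some heavy degree reaches y, that vertex alone pays for y L. Otherwise the comparison of
    t^(r-1) L with y^(r-1) log (t / d) is multiplied by t and summed. The second term of the maximum
    repeats this with n in place of y, since every degree is below n; there [log_scale] has A = K =
    1 and constant 3. *)
Lemma cost_ge (D : nat) (x y L C : R) : (2 <= r)%N -> (0 < n)%N -> 0 < p -> p <= 1 ->
  (0 < D)%N -> 0 <= x -> 0 < y -> y ^+ r = x -> 0 <= L -> L <= 1 + (ln n%:R - ln d) ->
  3 <= C ->
  (forall t, (D <= t < n)%N -> 4 <= ln t%:R - ln d) ->
  (forall t, (D <= t < n)%N -> t%:R <= y ->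
     L * t%:R ^+ r.-1 <= C * (y ^+ r.-1 * (ln t%:R - ln d))) ->
  (forall t, (D <= t < n)%N -> y <= t%:R -> L <= C * (ln t%:R - ln d)) ->
  forall G, x / 2 <= heavy D G ->
  Num.max y (x / n%:R ^+ r.-1) * L / (2 * C)
  <= \sum_(v | ~~ (deg G v < D)%N) cost (deg G v).
Proof.
move=> r2 n0 p0 p1 D0 x0 y0 yx L0 Ln C3 h4 hs hl G hG.
have nR : 0 < n%:R :> R by rewrite ltr0n.
have d0 : 0 < d by exact: mulr_gt0.
have C0 : 0 < C by lra.
have rE : r = r.-1.+1 by rewrite prednK // ltnW.
have degs v : ~~ (deg G v < D)%N -> (D <= deg G v < n)%N.
  by rewrite -leqNgt => ->; rewrite deg_lt.
have {}hG : x / 2 <= \sum_(v | ~~ (deg G v < D)%N) (deg G v)%:R ^+ r.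
  apply: le_trans hG _; rewrite natr_sum; apply: ler_sum => v _.
  by rewrite -natrX ler_nat leq_bin_exp.
have hsum : x / 2 * L <= \sum_(v | ~~ (deg G v < D)%N) (deg G v)%:R ^+ r * L.
  by rewrite -mulr_suml; apply: ler_wpM2r.
have cost0 v : ~~ (deg G v < D)%N -> 0 <= cost (deg G v).
  by move=> /degs/h4 h; rewrite mulr_ge0 //; lra.
rewrite ler_pdivrMr; last by lra.
have hM z : 0 < z ->
   (forall v, ~~ (deg G v < D)%N ->
      L * (deg G v)%:R ^+ r.-1 <= C * (z ^+ r.-1 * (ln (deg G v)%:R - ln d))) ->
   x / z ^+ r.-1 * L <=
   (\sum_(v | ~~ (deg G v < D)%N) cost (deg G v)) * (2 * C).
  move=> z0 hz; rewrite mulrAC ler_pdivrMr ?exprn_gt0 //.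
  suff : \sum_(v | ~~ (deg G v < D)%N) (deg G v)%:R ^+ r * L
    <= (\sum_(v | ~~ (deg G v < D)%N) cost (deg G v)) * (C * z ^+ r.-1).
    move: hsum; move: (\sum_(v | _) cost _) (\sum_(v | _) _ * L) (z ^+ r.-1).
    by move=> A B Z hsum h; lra.
  rewrite mulr_suml; apply: ler_sum => v vD; have := hz v vD.
  rewrite [X in _ ^+ X * L]rE exprS => /(ler_wpM2l (ler0n R (deg G v))).
  move: (deg G v)%:R (z ^+ r.-1) => t Z; move: (t ^+ r.-1) (ln t - ln d) => T u h; lra.
rewrite maxr_pMl // ge_max; apply/andP; split; last first.
  apply: hM => // v vD; have /h4 h := degs v vD.
  have dR : 0 < (deg G v)%:R :> R.
    by rewrite ltr0n; apply: leq_trans D0 _; rewrite leqNgt.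
  have [] := @log_scale R L 1 1 r (deg G v)%:R n%:R d r2 d0 nR dR; rewrite ?ln1 //; try lra.
  rewrite ler_nat (ltnW (deg_lt G v)) => /(_ isT) h1 _; apply: le_trans h1 _.
  rewrite (_ : 1 + 1 * (0 + 2) = 3); last by ring.
  apply: ler_wpM2r => //; rewrite mulr_ge0 ?exprn_ge0 //; lra.
have [/existsP[v /andP[vD yv]]|] :=
  boolP [exists v, ~~ (deg G v < D)%N && (y <= (deg G v)%:R)].
  rewrite (bigD1 v) //=.
  have S0 : 0 <= \sum_(i | ~~ (deg G i < D)%N && (i != v)) cost (deg G i).
    by apply: sumr_ge0 => i /andP[/cost0].
  have h := hl _ (degs v vD) yv; have := h4 _ (degs v vD) => hu4.
  apply: (@le_trans _ _ (cost (deg G v) * C)).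
    apply: (@le_trans _ _ (y * (C * (ln (deg G v)%:R - ln d)))).
      by apply: ler_wpM2l => //; exact: ltW.
    rewrite mulrCA mulrC; apply: ler_wpM2r; first exact: ltW.
    by apply: ler_wpM2r => //; lra.
  have := cost0 v vD; move: S0; move: (cost _) (\sum_(_ | _) _) => c S S0 c0; nra.
move=> /existsPn hy.
have yE : y * L = x / y ^+ r.-1 * L.
  rewrite -yx [X in y ^+ X / _]rE exprS mulfK // expf_neq0 // gt_eqF //.
rewrite yE; apply: hM => // v vD; apply: hs; first exact: degs.
have := hy v; rewrite vD /= -ltNge; exact: ltW.
Qed.

Lemma upper_core (D : nat) (y L C : R) : (2 <= r)%N -> (0 < n)%N -> 0 < p -> p <= 1 ->
  0 < eps -> 0 < mu ->
  (0 < D)%N -> 0 < y -> y ^+ r = eps * mu -> 0 <= L -> L <= 1 + (ln n%:R - ln d) ->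
  3 <= C ->
  (forall t, (D <= t < n)%N -> 4 <= ln t%:R - ln d) ->
  (forall t, (D <= t < n)%N -> 8 * ln n%:R <= cost t) ->
  (forall t, (D <= t < n)%N -> t%:R <= y ->
     L * t%:R ^+ r.-1 <= C * (y ^+ r.-1 * (ln t%:R - ln d))) ->
  (forall t, (D <= t < n)%N -> y <= t%:R -> L <= C * (ln t%:R - ln d)) ->
  pexp p E (fun G => ((1 + eps) * mu <= X G)%R%:R)
  <= expR (- (eps * mu * ln (1 + eps) / (16 * (2 * D ^ r.-1 * r)%:R)))
   + 2 * expR (- (Num.max y (eps * mu / n%:R ^+ r.-1) * L / (8 * C))).
Proof.
move=> r2 n0 p0 p1 e0 mu0 D0 y0 yx L0 Ln C3 h4 h8 hs hl.
have x0 : 0 < eps * mu by exact: mulr_gt0.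
have hL := light_exp r2 p0 p1 e0 mu0 D0.
have hH := heavy_exp (Num.max y (eps * mu / n%:R ^+ r.-1) * L / (2 * C)) n0 p0 p1 D0 h4 h8.
have e : Num.max y (eps * mu / n%:R ^+ r.-1) * L / (2 * C) / 4
  = Num.max y (eps * mu / n%:R ^+ r.-1) * L / (8 * C).
  by move: (Num.max _ _ * L) => M; field; apply: lt0r_neq0; lra.
rewrite e in hH; apply: le_trans (lerD hL hH).
rewrite -pexpD; apply: ler_pexp; rewrite ?(ltW p0) // => G _.
case: (boolP ((1 + eps) * mu <= X G)%R) => h /=; last by rewrite addr_ge0.
case: (boolP ((1 + eps / 2) * mu <= light D G)%R) => h1 /=.
  by rewrite lerDl.
rewrite add0r ler1n lt0b.
apply: (@cost_ge D (eps * mu) y L C r2 n0 p0 p1 D0 (ltW x0) y0 yx L0 Ln C3 h4 hs hl G).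
move: h; rewrite nstarsE card_stars_in (bigID (fun v => (deg G v < D)%N)) /= natrD.
move: h1; rewrite -ltNge; by move: (light D G) (heavy D G) (mu) => a b m; lra.
Qed.

End UpperTail.

(** * Comparison of the exponents *)

(* The scales of the problem: a = n^alpha with alpha = 1 / (16 r), d = n p,
   x = eps mu, y = x^(1/r), L = log (e / p), and K absorbs the ratio between
   'C(n - 1, r) and n^r. *)
Record regime (R : realType) (r n : nat) (a eps d mu x y L K : R) : Prop := Regime {
  regime_r : (2 <= r)%N;
  regime_a : 1 <= a;
  regime_n : a ^+ (16 * r) = n%:R;
  regime_eps : a^-1 <= eps;
  regime_d : 0 < d;
  regime_dn : d <= n%:R;
  regime_mu : 0 < mu;
  regime_K : 1 <= K;
  regime_muK : n%:R * d ^+ r <= K * mu;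
  regime_x : x = eps * mu;
  regime_y : 0 < y;
  regime_yx : y ^+ r = x;
  regime_L : L = 1 + (ln n%:R - ln d) }.

Section RegimeLemmas.
Variables (R : realType) (r n : nat) (a eps d mu x y L K : R).
Hypothesis P : regime r n a eps d mu x y L K.

Local Notation M := (Num.max y (x / n%:R ^+ r.-1)).

Lemma regime_a0 : 0 < a. Proof. by have := regime_a P; lra. Qed.

Lemma regime_eps0 : 0 < eps.
Proof. by apply: lt_le_trans (regime_eps P); rewrite invr_gt0 regime_a0. Qed.

Lemma regime_x0 : 0 < x.
Proof. by rewrite (regime_x P) mulr_gt0 ?regime_eps0 ?(regime_mu P). Qed.

Lemma regime_n0 : 0 < n%:R :> R.
Proof. by rewrite -(regime_n P) exprn_gt0 ?regime_a0. Qed.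

Lemma regime_lnn : ln n%:R = (16 * r)%:R * ln a.
Proof. by rewrite -(regime_n P) lnXn ?regime_a0 // mulr_natl. Qed.

Lemma regime_lna : 0 <= ln a /\ ln a <= a.
Proof.
split; first exact: ln_ge0 (regime_a P).
by apply/ltW/ln_sublinear/regime_a0.
Qed.

Lemma regime_L1 : 1 <= L.
Proof.
rewrite (regime_L P) lerDl subr_ge0 ler_ln ?posrE ?regime_n0 ?(regime_d P) //.
exact: regime_dn P.
Qed.

Lemma regime_rE : r = r.-1.+1.
Proof. by rewrite prednK // ltnW // (regime_r P). Qed.

(** The slack bought by alpha: x = eps mu is at least a^-1 n d^r / K, and a^-1 n = a^(16 r - 1) is
    at least a^(15 r). Then take r-th roots. *)
Lemma regime_y_ge : a ^+ 15 * d <= K * y.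
Proof.
have := P => -[r2 a1 an ea d0 dn m0 K1 mK ex y0 yx _].
have a0 := regime_a0; have K0 : 0 < K by lra.
have r0 : (0 < r)%N by exact: ltnW.
rewrite -(@ler_pXn2r _ r) ?nnegrE //; last 2 first.
- by rewrite mulr_ge0 ?exprn_ge0 // ltW.
- by rewrite mulr_ge0 // ltW.
rewrite (exprMn _ (a ^+ 15) d) (exprMn _ K y) yx ex -exprM.
apply: (@le_trans _ _ (K * (eps * mu))); last first.
  apply: ler_wpM2r; first by rewrite mulr_ge0 // ltW // regime_eps0.
  by rewrite -[leLHS]expr1 ler_weXn2l.
apply: (@le_trans _ _ (a^-1 * (n%:R * d ^+ r))); last first.
  rewrite [leRHS]mulrCA; apply: ler_pM => //; first by rewrite invr_ge0 ltW.
  by rewrite mulr_ge0 // exprn_ge0 // ltW.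
rewrite mulrA; apply: ler_wpM2r; first by rewrite exprn_ge0 // ltW.
rewrite ler_pdivlMl // -an -exprS; apply: ler_weXn2l => //; lia.
Qed.

Lemma regime_L_dense : 1 <= a * d -> L <= 1 + (17 * r)%:R * ln a.
Proof.
move=> ad; have [l0 _] := regime_lna; have d0 := regime_d P.
rewrite (regime_L P) regime_lnn.
have : 0 <= ln a + ln d by rewrite -lnM ?posrE ?regime_a0 // ln_ge0.
have r1 : 1 <= r%:R :> R by rewrite ler1n ltnW // (regime_r P).
rewrite !natrM => h.
have : ln a <= r%:R * ln a by rewrite ler_peMl.
lra.
Qed.

Lemma regime_L_dense_a : 1 <= a * d -> L <= (18 * r)%:R * a.
Proof.
move=> ad; have [l0 la] := regime_lna; apply: le_trans (regime_L_dense ad) _.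
have a1 := regime_a P; rewrite !natrM.
have r1 : 1 <= r%:R :> R by rewrite ler1n ltnW // (regime_r P).
have : r%:R * ln a <= r%:R * a by apply: ler_wpM2l.
have : 1 <= r%:R * a by rewrite -[leLHS]mulr1 ler_pM.
lra.
Qed.

(** L is of order log a here, and K y / d >= a by [regime_y_ge]. This is the hypothesis of
    [log_scale] with A = 17 r. *)
Lemma regime_lnKy : 1 <= a * d -> L <= 1 + (17 * r)%:R * (ln K + ln y - ln d).
Proof.
move=> ad; apply: le_trans (regime_L_dense ad) _; rewrite lerD2l.
have := P => -[r2 a1 an ea d0 dn m0 K1 mK ex y0 yx _].
have a0 := regime_a0; have K0 : 0 < K by lra.
apply: ler_wpM2l => //; rewrite -lnM ?posrE // -ln_div ?posrE ?mulr_gt0 //.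
rewrite ler_ln ?posrE ?divr_gt0 ?mulr_gt0 // ler_pdivlMr //.
apply: le_trans regime_y_ge; apply: ler_wpM2r; first exact: ltW.
by rewrite -[leLHS]expr1 ler_weXn2l.
Qed.

Lemma regime_max_le (u v : R) : 0 <= u ->
  y * u <= v -> x / n%:R ^+ r.-1 * u <= v -> M * u <= v.
Proof. by move=> u0 h1 h2; rewrite maxr_pMl // ge_max h1 h2. Qed.

(** Here L is at most of order a, while x / y = y^(r-1) and n^(r-1) both exceed a^(r+1) up to a
    constant: the first since K y >= a^15 d >= a^14, the second since n = a^(16 r). *)
Lemma regime_dense_ML : 1 <= a * d ->
  M * L * a ^+ r <= (18 * r)%:R * K ^+ r.-1 * x.
Proof.
move=> ad; have := regime_L_dense_a ad; have := regime_y_ge.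
have e14 : (r.+1 <= 14 * r.-1)%N by have := regime_r P; lia.
have e16 : (r.+1 <= 16 * r * r.-1)%N by have := regime_r P; nia.
have := P => -[r2 a1 an ea d0 dn m0 K1 mK ex y0 yx _] Ky hL.
have a0 := regime_a0; have K0 : 0 < K by lra.
have L0 : 0 <= L by have := regime_L1; lra.
have x0 := ltW regime_x0.
have aL : L * a ^+ r <= (18 * r)%:R * a ^+ r.+1.
  by rewrite exprS mulrA; apply: ler_wpM2r => //; rewrite exprn_ge0 // ltW.
have Ky14 : a ^+ 14 <= K * y.
  apply: le_trans Ky; rewrite (exprSr a 14) -mulrA ler_peMr // exprn_ge0 // ltW //.
rewrite -mulrA; apply: regime_max_le.
- by rewrite mulr_ge0 // exprn_ge0 // ltW.
- have -> : x = y * y ^+ r.-1 by rewrite -exprS -regime_rE yx.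
  rewrite [leRHS]mulrCA; apply: ler_wpM2l; first exact: ltW.
  apply: le_trans aL _; rewrite -[leRHS]mulrA; apply: ler_wpM2l => //.
  rewrite -exprMn; apply: (@le_trans _ _ (a ^+ (14 * r.-1))).
    by apply: ler_weXn2l.
  have a14 : 0 <= a ^+ 14 by rewrite exprn_ge0 // ltW.
  have Ky0 : 0 <= K * y by rewrite mulr_ge0 // ltW.
  rewrite (exprM a 14 r.-1); move: (a ^+ 14) a14 Ky14 => b b0 bK.
  by apply: (lerXn2r r.-1 _ _ bK); rewrite nnegrE.
- rewrite -mulrA mulrC; apply: ler_wpM2r => //.
  have N0 : 0 < n%:R ^+ r.-1 :> R by rewrite exprn_gt0 ?regime_n0.
  rewrite ler_pdivrMl //; apply: le_trans aL _.
  rewrite [leRHS]mulrC -mulrA; apply: ler_wpM2l => //.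
  apply: (@le_trans _ _ (n%:R ^+ r.-1)).
    by rewrite -an -exprM; apply: ler_weXn2l.
  by rewrite ler_peMl // ?exprn_ege1 // ltW.
Qed.

(** The denominator 32 r D^(r-1) of the light exponent at D = 512 r. *)
Definition light_const : R := (32 * r)%:R * (512 * r)%:R ^+ r.-1.

Lemma light_const_gt0 : (0 < r)%N -> 0 < light_const.
Proof.
by move=> r0; rewrite /light_const mulr_gt0 ?exprn_gt0 // ltr0n muln_gt0.
Qed.

(** Three ranges of d. For a d < 1 the threshold is bounded and the first bound for G suffices. For
    d >= a it is of order d, and d^(r-1) n d <= K mu converts the second bound. In between it is of
    order a, and M L is beaten instead, using [regime_dense_ML] and ln (1 + eps) >= 1 / (2 a). *)
Lemma regime_light (xi G D : R) : 0 < xi -> xi <= 1 ->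
  G <= x * ln (1 + eps) / xi -> G <= eps * ln (1 + eps) * (n%:R * d) / xi ->
  0 < D -> (1 <= a * d -> D <= (512 * r)%:R * Num.max d a) ->
  (a * d < 1 -> D <= (512 * r)%:R) ->
  xi / ((36 * r)%:R * K ^+ r * light_const) * Num.min G (M * L)
  <= x * ln (1 + eps) / ((32 * r)%:R * D ^+ r.-1).
Proof.
move=> xi0 xi1 G1 G2 D0 hD1 hD2.
have := P => -[r2 a1 an ea d0 dn m0 K1 mK ex y0 yx _].
have a0 := regime_a0; have K0 : 0 < K by lra.
have eps0 := regime_eps0; have x0 := regime_x0.
have Q0 := light_const_gt0 (ltnW r2).
have l0 : 0 <= ln (1 + eps) by apply: ln1D_ge0; exact: ltW.
have r0 : 0 < r%:R :> R by rewrite ltr0n ltnW.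
have r1 : 1 <= r%:R :> R by rewrite ler1n ltnW.
have K1r k : 1 <= K ^+ k by exact: exprn_ege1.
set c0 := xi / _.
have DD : 0 < (32 * r)%:R * D ^+ r.-1.
  have r32 : 0 < (32 * r)%:R :> R by rewrite ltr0n muln_gt0 (ltnW r2).
  by rewrite mulr_gt0 // exprn_gt0.
have c00 : 0 < c0.
  have r36 : 0 < (36 * r)%:R :> R by rewrite ltr0n muln_gt0 (ltnW r2).
  by rewrite /c0 divr_gt0 // mulr_gt0 // mulr_gt0 // exprn_gt0.
have main z T : 0 < z -> Num.min G (M * L) <= T ->
    D <= (512 * r)%:R * z -> c0 * light_const * z ^+ r.-1 * T <= x * ln (1 + eps) ->
    0 <= T ->
    c0 * Num.min G (M * L) <= x * ln (1 + eps) / ((32 * r)%:R * D ^+ r.-1).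
  move=> z0 GT Dz hT T0; rewrite ler_pdivlMr //.
  have Dr : (32 * r)%:R * D ^+ r.-1 <= light_const * z ^+ r.-1.
    rewrite /light_const -mulrA -exprMn; apply: ler_wpM2l => //.
    by apply: lerXn2r Dz; rewrite nnegrE ?mulr_ge0 // ltW.
  apply: le_trans hT.
  apply: (@le_trans _ _ (c0 * T * ((32 * r)%:R * D ^+ r.-1))).
    by apply: ler_wpM2r; [exact: ltW | apply: ler_wpM2l => //; exact: ltW].
  rewrite -![c0 * _ * _]mulrA; apply: ler_wpM2l; first exact: ltW.
  by rewrite [leRHS]mulrC; apply: ler_wpM2l.
have c0E k : (k <= r)%N -> c0 * light_const * K ^+ k <= xi / (36 * r)%:R.
  move=> kr; have -> : c0 * light_const * K ^+ k = xi / (36 * r)%:R * (K ^+ k / K ^+ r).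
    rewrite /c0; move: Q0 (K1r r); move: light_const (K ^+ r) (K ^+ k) => q u v q0 u1.
    by rewrite natrM; field; rewrite !lt0r_neq0 //; lra.
  rewrite ler_piMr //; first by rewrite divr_ge0 // ltW.
  rewrite ler_pdivrMr ?mul1r ?ler_weXn2l //.
  by have := K1r r; lra.
have xi36 : xi / (36 * r)%:R <= xi.
  rewrite ler_pdivrMr; last by rewrite natrM; lra.
  by rewrite ler_peMr ?natrM //; [exact: ltW | lra].
have cz : 0 <= c0 * light_const by rewrite mulr_ge0 // ltW.
have [ad|ad] := ltP (a * d) 1.
  apply: (main 1 (x * ln (1 + eps) / xi)) => //.
  - by rewrite ge_min G1.
  - by rewrite mulr1 hD2.
  - rewrite expr1n mulr1; have := c0E 0%N isT; rewrite expr0 mulr1 => h.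
    rewrite mulrCA ger_pMr; last by apply: mulr_gt0 => //; rewrite ln_gt0 //; lra.
    by rewrite ler_pdivrMr // mul1r; exact: le_trans h xi36.
  - by rewrite divr_ge0 // ?mulr_ge0 // ltW.
have {}hD1 := hD1 ad.
have [da|da] := leP a d.
  apply: (main d (eps * ln (1 + eps) * (n%:R * d) / xi)) => //.
  - by rewrite ge_min G2.
  - by move: hD1; rewrite (max_idPl da).
  - have h1 : d ^+ r.-1 * (n%:R * d) <= K * mu.
      by rewrite mulrCA -exprSr -regime_rE.
    have h2 := c0E 1%N (ltnW r2); rewrite expr1 in h2.
    apply: (@le_trans _ _ (c0 * light_const * (eps * ln (1 + eps) / xi) * (K * mu))).
      rewrite (_ : _ * (eps * ln (1 + eps) * _ / xi) =
        c0 * light_const * (eps * ln (1 + eps) / xi) * (d ^+ r.-1 * (n%:R * d))).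
        apply: ler_wpM2l h1; rewrite mulr_ge0 // divr_ge0 ?mulr_ge0 // ltW //.
      by move: (c0 * _) (d ^+ _) (ln _) => u v w; ring.
    rewrite (_ : _ * (K * mu) = (c0 * light_const * K) / xi * (x * ln (1 + eps))).
      apply: ler_piMl; first by rewrite mulr_ge0 // ltW.
      by rewrite ler_pdivrMr // mul1r; exact: le_trans h2 xi36.
    by rewrite ex; move: (c0 * _) (ln _) => u w; ring.
  - by rewrite divr_ge0 ?mulr_ge0 // ltW.
apply: (main a (M * L)) => //.
- by rewrite ge_min lexx orbT.
- by move: hD1; rewrite (max_idPr (ltW da)).
- have h := regime_dense_ML ad; have hl := ln1D_ge a1 ea.
  have h2 := c0E r.-1 (leq_pred r).
  apply: (@le_trans _ _ (x * (2 * a)^-1)); last by apply: ler_wpM2l => //; exact: ltW.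
  rewrite ler_pdivlMr; last by lra.
  have -> : c0 * light_const * a ^+ r.-1 * (M * L) * (2 * a)
    = 2 * (c0 * light_const) * (M * L * a ^+ r).
    rewrite [in a ^+ r]regime_rE exprS.
    by move: (M * L) (c0 * _) (a ^+ _) => u v w; ring.
  apply: (@le_trans _ _ (2 * (c0 * light_const) * ((18 * r)%:R * K ^+ r.-1 * x))).
    by apply: ler_wpM2l h; rewrite mulr_ge0.
  have -> : 2 * (c0 * light_const) * ((18 * r)%:R * K ^+ r.-1 * x)
    = (c0 * light_const * K ^+ r.-1) * (36 * r)%:R * x.
    by rewrite !natrM; move: (c0 * _) (K ^+ _) => u v; ring.
  rewrite ler_piMl ?(ltW x0) // -ler_pdivlMr; last by rewrite natrM; lra.
  apply: le_trans h2 _; apply: ler_wpM2r => //; rewrite invr_ge0; exact: ler0n.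
- by rewrite mulr_ge0 // ?le_max ?(ltW y0) //; have := regime_L1; lra.
Qed.

End RegimeLemmas.

(** * Choice of the degree threshold *)

Section LightCutoff.
Variables (R : realType) (r n : nat) (a eps d mu x y L K : R).

(** The constant of [log_scale] at A = 17 r, with ln K replaced by K. *)
Definition log_const : R := 1 + (17 * r)%:R * (K + 2).

(** The first entry serves the light stars, the second the heavy ones. *)
Definition upper_const (xi : R) : R :=
  Num.min (xi / ((36 * r)%:R * K ^+ r * light_const R r)) (8 * log_const)^-1.

Lemma upper_const_gt0 (xi : R) : (0 < r)%N -> 1 <= K -> 0 < xi -> 0 < upper_const xi.
Proof.
move=> r0 K1 xi0; have K0 := lt_le_trans ltr01 K1.
rewrite lt_min; apply/andP; split.
  apply: divr_gt0 => //; apply: mulr_gt0; last exact: light_const_gt0.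
  by apply: mulr_gt0; [rewrite ltr0n muln_gt0 | exact: exprn_gt0].
rewrite invr_gt0; apply: mulr_gt0 => //; apply: ltr_pwDl => //.
by apply: mulr_ge0 => //; apply: addr_ge0 => //; exact: ltW.
Qed.

Hypothesis P : regime r n a eps d mu x y L K.

Lemma log_const_ge : (16 * r)%:R + 2 <= log_const.
Proof.
have K1 := regime_K P; have r1 : 1 <= r%:R :> R by rewrite ler1n ltnW // (regime_r P).
rewrite /log_const !natrM; have : 3 * r%:R <= (K + 2) * r%:R.
  by apply: ler_wpM2r => //; lra.
lra.
Qed.

(** The factor 256 gives log (t / d) >= 4. For the union over degrees, t log (t / d) must reach 8
    log n = 128 r log a: if a d < 1 the factor log (t / d) >= log a does this for t >= 256 r,
    otherwise t >= 256 r a does. Rounding up at most doubles 256 r max (d, a), whence 512 r. *)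
Lemma light_cutoff : exists D : nat, [/\ (0 < D)%N,
  (1 <= a * d -> D%:R <= (512 * r)%:R * Num.max d a),
  (a * d < 1 -> D%:R <= (512 * r)%:R :> R) &
  forall t : nat, (D <= t)%N ->
   [/\ 4 <= ln t%:R - ln d,
       8 * ln n%:R <= t%:R * (ln t%:R - ln d),
       (t%:R <= y -> L * t%:R ^+ r.-1 <= log_const * (y ^+ r.-1 * (ln t%:R - ln d))) &
       (y <= t%:R -> L <= log_const * (ln t%:R - ln d))]].
Proof.
have := P => -[r2 a1 an ea d0 dn m0 K1 mK ex y0 yx eL].
have a0 := regime_a0 P; have r1 : 1 <= r%:R :> R by rewrite ler1n ltnW.
have [l0 la] := regime_lna P; have L1 := regime_L1 P.
have l256 := ln_256 R; have lnn := regime_lnn P; have hC := log_const_ge.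
have [ad|ad] := ltP (a * d) 1.
  exists (256 * r)%N; split.
  - by rewrite muln_gt0 (ltnW r2).
  - lra.
  - by rewrite ler_nat leq_mul2r orbT.
  move=> t ht; have {ht} ht : 256 * r%:R <= t%:R :> R.
    by move: ht; rewrite -(ler_nat R) natrM.
  have t0 : 0 < t%:R :> R by lra.
  have lt4 : 4 <= ln (t%:R : R).
    apply: le_trans l256 _; rewrite ler_ln ?posrE //; lra.
  have ld : ln a <= - ln d.
    have : ln (a * d) <= 0 by apply: ln_le0; exact: ltW.
    by rewrite lnM ?posrE //; lra.
  have hL : L <= log_const * (ln t%:R - ln d).
    apply: (@le_trans _ _ (((16 * r)%:R + 2) * (ln t%:R - ln d))); last first.
      by apply: ler_wpM2r => //; lra.
    rewrite eL lnn; have : (16 * r)%:R * ln a <= (16 * r)%:R * (ln t%:R - ln d).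
      by apply: ler_wpM2l => //; lra.
    by rewrite mulrDl; move: ((16 * r)%:R * (_ - _)) => q; lra.
  split => //.
  - lra.
  - rewrite lnn; apply: (@le_trans _ _ ((256 * r%:R) * ln a)).
      by rewrite natrM; have := mulr_ge0 (ler0n R r) l0; lra.
    apply: (@le_trans _ _ (t%:R * ln a)); first exact: ler_wpM2r.
    by apply: ler_wpM2l => //; lra.
  - move=> ty; apply: (@le_trans _ _ (L * y ^+ r.-1)).
      apply: ler_wpM2l; first lra.
      by apply: lerXn2r ty; rewrite nnegrE // ltW.
    rewrite [y ^+ _ * _]mulrC mulrA; apply: ler_wpM2r => //.
    by rewrite exprn_ge0 // ltW.
set z := 256 * r%:R * Num.max d a.
have m1 : 1 <= Num.max d a by rewrite le_max a1 orbT.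
have rm : 1 <= r%:R * Num.max d a by rewrite -[leLHS]mulr1 ler_pM.
have z0 : 0 <= z by rewrite /z -mulrA; lra.
have /andP := truncn_itv z0; move: (Num.truncn z) => k [kz zk].
exists k.+1; split => //.
- by move=> _; rewrite -natr1 natrM; move: kz; rewrite /z -!mulrA; lra.
move=> t ht; have {ht zk} ht : z <= t%:R.
  by apply: le_trans (ltW zk) _; rewrite ler_nat.
have zd : 256 * d <= z.
  rewrite /z -mulrA ler_pM2l //; apply: le_trans (_ : d <= 1 * Num.max d a) _.
    by rewrite mul1r le_max lexx.
  by apply: ler_wpM2r => //; lra.
have za : 256 * r%:R * a <= z.
  by apply: ler_wpM2l; [lra | rewrite le_max lexx orbT].
have t0 : 0 < t%:R :> R by lra.
have u4 : 4 <= ln t%:R - ln d.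
  apply: le_trans l256 _; rewrite -ln_div ?posrE // ler_ln ?posrE ?divr_gt0 //.
  by rewrite ler_pdivlMr //; lra.
have C0 : (0 : R) <= (17 * r)%:R by [].
have L0 : 0 <= L by lra.
have u1 : 1 <= ln t%:R - ln d by lra.
have [s1 s2] := log_scale r2 d0 y0 t0 K1 C0 L0 (regime_lnKy P ad) u1.
have hC2 : 1 + (17 * r)%:R * (ln K + 2) <= log_const.
  rewrite lerD2l; apply: ler_wpM2l => //; rewrite lerD2r.
  by apply/ltW/ln_sublinear; lra.
split => //.
- rewrite lnn; apply: (@le_trans _ _ (t%:R * 1)); last by apply: ler_wpM2l => //; lra.
  have : r%:R * ln a <= r%:R * a by apply: ler_wpM2l.
  by rewrite natrM mulr1; lra.
- move=> ty; apply: le_trans (s1 ty) _.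
  by apply: ler_wpM2r => //; rewrite mulr_ge0 ?exprn_ge0 ?(ltW y0) //; lra.
- move=> ty; apply: le_trans (s2 ty) _.
  by apply: ler_wpM2r => //; lra.
Qed.

End LightCutoff.

Section UpperExponent.
Variables (R : realType) (r n : nat) (p a eps x y L K : R).
Local Notation E := (complete_graph n).
Local Notation mu := (#|stars n r|%:R * p ^+ r).
Local Notation d := (n%:R * p).
Local Notation M := (Num.max y (x / n%:R ^+ r.-1)).
Local Notation log_const := (log_const r K).

Hypothesis P : regime r n a eps d mu x y L K.

Lemma upper_exp (xi G : R) : 0 < p -> p <= 1 -> 0 < xi -> xi <= 1 -> 0 <= G ->
  G <= x * ln (1 + eps) / xi -> G <= eps * ln (1 + eps) * (n%:R * d) / xi ->
  pexp p E (fun G => ((1 + eps) * mu <= nstars R (stars n r) G)%R%:R)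
  <= 3 * expR (- (upper_const r K xi * Num.min G (M * L))).
Proof.
move=> p0 p1 xi0 xi1 G0 G1 G2.
have [D [D0 hD1 hD2 hD]] := light_cutoff P.
have := P => -[r2 a1 an ea d0 dn m0 K1 mK ex y0 yx eL].
have n0 : (0 < n)%N by rewrite -(ltr0n R) (regime_n0 P).
have L1 := regime_L1 P; have L0 : 0 <= L by lra.
have hC := log_const_ge P; have r0 : 0 <= (16 * r)%:R :> R by [].
have r1 : 1 <= r%:R :> R by rewrite ler1n ltnW.
have C3 : 3 <= log_const by move: hC; rewrite natrM; lra.
have hD' t : (D <= t < n)%N -> _ := fun h => hD t (proj1 (andP h)).
have := @upper_core R n r p eps D y L log_const r2 n0 p0 p1 (regime_eps0 P) m0 D0 y0.
rewrite -ex => /(_ yx L0 _ C3); rewrite eL lexx => /(_ isT) h.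
have {h} := h (fun t ht => let: And4 h _ _ _ := hD' t ht in h)
  (fun t ht => let: And4 _ h _ _ := hD' t ht in h).
rewrite -eL => h.
have {}h := h (fun t ht => let: And4 _ _ h _ := hD' t ht in h)
  (fun t ht => let: And4 _ _ _ h := hD' t ht in h).
apply: le_trans h _.
have x0 := regime_x0 P.
have ML0 : 0 <= M * L by rewrite mulr_ge0 // le_max (ltW y0).
set c := upper_const r K xi; set m := Num.min G (M * L).
have m0' : 0 <= m by rewrite le_min G0.
have hl : expR (- (x * ln (1 + eps) / (16 * (2 * D ^ r.-1 * r)%:R))) <= expR (- (c * m)).
  rewrite ler_expR lerN2.
  have -> : 16 * (2 * D ^ r.-1 * r)%:R = (32 * r)%:R * D%:R ^+ r.-1 :> R.
    by rewrite !natrM natrX; ring.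
  have DR : 0 < D%:R :> R by rewrite ltr0n.
  have := @regime_light R r n a eps d mu x y L K P xi G D%:R xi0 xi1 G1 G2 DR hD1 hD2.
  apply: le_trans; apply: ler_wpM2r => //.
  by rewrite /c /upper_const ge_min lexx.
have hh : expR (- (M * L / (8 * log_const))) <= expR (- (c * m)).
  rewrite ler_expR lerN2 mulrC; apply: ler_pM => //.
  - exact/ltW/(upper_const_gt0 (ltnW r2) K1).
  - by rewrite /c /upper_const ge_min lexx orbT.
  - by rewrite /m ge_min lexx orbT.
set e := expR (- (c * m)) in hl hh *; lra.
Qed.

End UpperExponent.

(** * Lower bounds for the tail probability *)

Section LowerExponents.
Variables (R : realType) (r n : nat) (p xi x y : R).
Local Notation E := (complete_graph n).
Local Notation X := (nstars R (stars n r)).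
Local Notation mu := (#|stars n r|%:R * p ^+ r).
Local Notation d := (n%:R * p).
Local Notation s2 := (pvar p E X).
Local Notation M := (Num.max y (x / n%:R ^+ r.-1)).
Local Notation tail := (pexp p E (fun G => (mu + x <= X G)%R%:R)).

Definition bin_const : R := (r`! * r.+1 ^ r)%:R.

Lemma bin_const_ge1 : 1 <= bin_const.
Proof. by rewrite ler1n muln_gt0 fact_gt0 expn_gt0. Qed.

Lemma exp_le_binR (m : nat) : (r < m)%N ->
  m%:R ^+ r <= bin_const * ('C(m.-1, r))%:R.
Proof. by move=> rm; rewrite /bin_const -natrX -natrM ler_nat exp_le_bin. Qed.

(** The first term makes (w y)^r large enough for 3 x <= xi X F; the second pays for r + 1 extra
    leaves, since y >= xi / 2. *)
Definition cluster_width : R := 3 * bin_const / xi + (r.+1)%:R * 2 / xi.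

Definition cluster_const : R :=
  cluster_width + 3 * bin_const / xi + cluster_width ^+ r.

(** One star with about w y leaves is used if it fits into n vertices. If not, n is at most w y and
    full vertices are used, about x / n^r of them. If even n of these are too few, all of K_n is
    affordable. *)
Lemma exists_cluster : (2 <= r)%N -> (r < n)%N -> 0 < xi -> xi < 1 ->
  0 < y -> y ^+ r = x -> xi / 2 <= x ->
  exists F : {set {set 'I_n}}, [/\ F \subset E, #|F|%:R <= cluster_const * M &
    (F = E) \/ 3 * x <= xi * X F].
Proof.
move=> r2 rn xi0 xi1 y0 yx x2.
have K1 := bin_const_ge1; have n0 : 0 < n%:R :> R by rewrite ltr0n (leq_ltn_trans _ rn).
have nr0 : 0 < n%:R ^+ r.-1 :> R by rewrite exprn_gt0.
have x0 : 0 < x by lra.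
have rE : r = r.-1.+1 by rewrite prednK // ltnW.
have K0 : 0 < bin_const by lra.
have [b bE] : exists b, b = 3 * bin_const / xi by eexists.
have b3 : 3 <= b.
  rewrite bE ler_pdivlMr //; have := ltW xi0; nra.
have [w wE] : exists w, w = cluster_width by eexists.
have wb : b + (r.+1)%:R * (2 / xi) = w by rewrite wE /cluster_width bE mulrA.
have bw : b <= w by rewrite -wb lerDl mulr_ge0 // divr_ge0 // ltW.
have w0 : 0 < w by lra.
have y2 : xi / 2 <= y.
  rewrite leNgt; apply/negP => yx2; have : y ^+ r <= y.
    rewrite rE exprS ler_piMr ?(ltW y0) // exprn_ile1 ?(ltW y0) //; lra.
  by rewrite yx; lra.
have M0 : 0 <= M by rewrite le_max (ltW y0).
have CE : cluster_const = w + b + w ^+ r by rewrite /cluster_const -wE -bE.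
have C0 : 0 <= w + b + w ^+ r by rewrite !addr_ge0 ?exprn_ge0 //; lra.
have Mx : x / n%:R ^+ r.-1 <= M by rewrite le_max lexx orbT.
have by0 : 0 <= b * y by rewrite mulr_ge0 // ltW //; lra.
have /andP := truncn_itv by0; move: (Num.truncn _) => k0 [k0l k0u].
(* The extra r leaves ensure r < k + 1, so that C(k, r) is comparable with k^r. *)
have [k kE] : exists k, k = (k0.+1 + r)%N by eexists.
have kb : b * y <= k%:R by apply: le_trans (ltW k0u) _; rewrite ler_nat kE leq_addr.
have kw : k%:R <= w * y.
  rewrite kE natrD -natr1 -wb mulrDl.
  have : (r.+1)%:R * 1 <= (r.+1)%:R * (2 / xi * y).
    apply: ler_wpM2l => //; have := ler_wpM2l (_ : 0 <= 2 / xi) y2.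
    rewrite divr_ge0 ?(ltW xi0) // => /(_ isT); apply: le_trans.
    by rewrite [leRHS](_ : _ = 1) //; field; rewrite lt0r_neq0.
  by rewrite mulr1 mulrA -natr1; lra.
have [kn|nk] := ltnP k n.
  have [F [FE cF XF]] := star_cluster R r kn.
  exists F; split => //.
    rewrite cF CE; apply: le_trans kw _; apply: ler_pM; rewrite ?(ltW w0) ?(ltW y0) //.
      have : 0 <= w ^+ r by rewrite exprn_ge0 // ltW.
      lra.
    by rewrite le_max lexx.
  right; apply: (@le_trans _ _ (xi * 'C(k, r)%:R)); last first.
    by apply: ler_wpM2l => //; exact: ltW.
  have rk : (r < k.+1)%N by rewrite ltnS kE leq_addl.
  have h := exp_le_binR rk; rewrite /= in h.
  have : b * x <= bin_const * 'C(k, r)%:R.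
    apply: le_trans h; apply: (@le_trans _ _ ((b * y) ^+ r)).
      rewrite exprMn yx; apply: ler_wpM2r; first exact: ltW.
      by rewrite -[leLHS]expr1 ler_weXn2l ?(ltnW r2) //; lra.
    apply: lerXn2r; rewrite ?nnegrE //; apply: le_trans kb _.
    by rewrite ler_nat.
  rewrite bE mulrAC ler_pdivrMr // => hh; rewrite -(ler_pM2l K0); move: hh.
  by move: (bin_const) 'C(k, r)%:R => B c; lra.
(* From n <= w y. This pays for the n edges of the one hub added by rounding up. *)
have nw : n%:R <= w ^+ r * (x / n%:R ^+ r.-1).
  rewrite mulrA ler_pdivlMr // -exprS -rE -yx -exprMn.
  apply: lerXn2r; rewrite ?nnegrE ?mulr_ge0 ?(ltW w0) ?(ltW y0) //.
  by apply: le_trans kw; rewrite ler_nat.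
have z0 : 0 <= b * x / n%:R ^+ r.
  by rewrite divr_ge0 ?exprn_ge0 // mulr_ge0 // ltW //; lra.
have /andP := truncn_itv z0; move: (Num.truncn _) => h0 [hl hu].
have hn : (h0.+1 * n)%:R <= cluster_const * M.
  apply: (@le_trans _ _ ((b + w ^+ r) * (x / n%:R ^+ r.-1))); last first.
    apply: ler_pM => //; first by rewrite addr_ge0 ?exprn_ge0 ?(ltW w0) //; lra.
      by rewrite divr_ge0 // ltW.
    by rewrite CE; lra.
  rewrite mulrDl natrM -natr1 mulrDl mul1r; apply: lerD => //.
  apply: le_trans (ler_wpM2r (ltW n0) hl) _.
  rewrite [in n%:R ^+ r]rE exprS.
  have -> : b * x / (n%:R * n%:R ^+ r.-1) * n%:R = b * (x / n%:R ^+ r.-1).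
    by move: (n%:R ^+ _) nr0 => N N0; field; rewrite !lt0r_neq0.
  by [].
have [hn1|hn1] := leqP h0.+1 n.
  have [F [FE cF XF]] := hub_cluster R r hn1.
  exists F; split => //.
    by apply: le_trans hn; rewrite ler_nat.
  right; apply: (@le_trans _ _ (xi * (h0.+1 * 'C(n.-1, r))%:R)); last first.
    by apply: ler_wpM2l => //; exact: ltW.
  have h := exp_le_binR rn.
  have : b * x <= bin_const * (h0.+1 * 'C(n.-1, r))%:R.
    rewrite natrM mulrCA; apply: (@le_trans _ _ (h0.+1%:R * n%:R ^+ r)).
      by rewrite -ler_pdivrMr ?exprn_gt0 // ltW.
    by apply: ler_wpM2l.
  rewrite bE mulrAC ler_pdivrMr // => hh; rewrite -(ler_pM2l K0); move: hh.
  by move: (bin_const) (h0.+1 * 'C(n.-1, r))%:R => B c; lra.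
(* More than n hubs are called for, so n^2 is below their cost. *)
exists E; split => //; last by left.
apply: le_trans hn; rewrite ler_nat; apply: leq_trans (card_complete_le n) _.
by rewrite -mulnn leq_mul2r ltnW ?orbT.
Qed.

Lemma lower_cluster (L : R) : (2 <= r)%N -> (r < n)%N -> 0 < xi -> xi < 1 ->
  0 < p -> p <= 1 - xi -> 0 < y -> y ^+ r = x -> xi / 2 <= x -> s2 <= x ^+ 2 ->
  mu + x <= #|stars n r|%:R -> L = 1 - ln p -> 1 <= M * L ->
  0 < tail /\ - ln tail <= (cluster_const + 1) * (M * L).
Proof.
have q34 : 0 < 3 / 4 :> R by lra.
have l34 : - ln (3 / 4 : R) <= 1.
  by have := @ln_ge_subV R (3 / 4) q34; rewrite invf_div; lra.
move=> r2 rn xi0 xi1 p0 pxi y0 yx x2 sx top eL ML1.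
have lpL : - ln p <= L by lra.
have L0 : 0 <= L by have := @ln_le0 R p; lra.
have p1 : p <= 1 by lra.
have x0 : 0 < x by lra.
have [F [FE cF hF]] := exists_cluster r2 rn xi0 xi1 y0 yx x2.
have pr : p ^+ r <= p.
  rewrite -(prednK (ltnW r2)) exprS ler_piMr ?(ltW p0) // exprn_ile1 // ltW //.
have low : p ^+ #|F| * (3 / 4) <= tail.
  case: hF => [FEq|hF].
    rewrite FEq; apply: le_trans (ler_pexp_plant (ltW p0) p1 (subxx _) (fun G => ler0n _ _)).
    apply: ler_wpM2l; first by rewrite exprn_ge0 // ltW.
    rewrite (@eq_pexp _ _ _ _ _ (fun=> 1)) ?pexp_cst; first by lra.
    by move=> G GE; rewrite (setUidPl GE) nstars_complete top.
  apply: tail_plant => //; first exact: ltW.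
  apply: le_trans hF _; apply: ler_wpM2r; first exact: nstars_ge0.
  by lra.
have q0 : 0 < p ^+ #|F| * (3 / 4) by rewrite mulr_gt0 ?exprn_gt0.
have t0 : 0 < tail := lt_le_trans q0 low.
split => //; apply: (@le_trans _ _ (- ln (p ^+ #|F| * (3 / 4)))).
  by rewrite lerN2 ler_ln ?posrE.
rewrite lnM ?posrE ?exprn_gt0 //.
rewrite lnXn // -[ln p *+ _]mulr_natl opprD [leRHS]mulrDl mul1r; apply: lerD; last first.
  exact: le_trans ML1.
rewrite -mulrN; apply: (@le_trans _ _ (#|F|%:R * L)).
  exact: ler_wpM2l.
by rewrite mulrA; apply: ler_wpM2r.
Qed.

Lemma variance_bounds : (2 <= r)%N -> 0 < xi -> 0 < p -> p <= 1 - xi ->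
  [/\ xi * mu <= s2, mu ^+ 2 * xi <= n%:R * d * s2 &
      s2 <= mu * ((2 * r)%:R * (d + r%:R) ^+ r.-1)].
Proof.
move=> r2 xi0 p0 pxi; have p1 : p <= 1 by lra.
have p1' : p < 1 by lra.
have mu0 : 0 <= mu by rewrite mulr_ge0 ?exprn_ge0 // ltW.
have s0 : 0 <= s2 by apply: pexp_ge0 => [||G _]; rewrite ?sqr_ge0 // ltW.
split.
- apply: le_trans (pvar_nstars_ge n (ltW p0) p1 (ltnW r2)).
  by apply: ler_wpM2r => //; lra.
- have h := pvar_nstars_ge_edges n r (ltW p0) p1 p1'.
  apply: (@le_trans _ _ (mu ^+ 2 * r%:R ^+ 2 * (1 - p))).
    rewrite -[leRHS]mulrA; apply: ler_wpM2l; first exact: sqr_ge0.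
    have r1 : 1 <= r%:R ^+ 2 :> R by rewrite exprn_ege1 // ler1n ltnW.
    by rewrite -[leLHS]mul1r; apply: ler_pM => //; lra.
  apply: le_trans h _; apply: ler_wpM2r => //; rewrite mulrA.
  apply: ler_wpM2r; first exact: ltW.
  by rewrite -natrM ler_nat mulnn card_complete_le.
- by have := pvar_nstars_le n (ltW p0) r2.
Qed.

(** The parenthesis bounds the ratio C of the variances of X at the tilted and the original edge
    probability. With 2 + 2 C the margin is (1 + 2 C) x, and (1 + 2 C)^2 >= 2 C is what Chebyshev
    needs. *)
Definition tilt_const : R :=
  2 + 2 * (2 ^+ r * (2 * r)%:R * (r + 2)%:R ^+ r.-1 * bin_const / xi).

(** At q = (1 + K0 eps) p the mean rises by at least K0 x, while d >= 1 and q <= 2 p keep the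
    variance of order s2 <= x^2. The condition K0 eps <= xi gives q <= (1 + xi)(1 - xi) <= 1. The
    cost is at most n^2 (q - p)^2 / (p (1 - p)). *)
Lemma lower_tilt (eps : R) : (2 <= r)%N -> (r < n)%N -> 0 < xi -> xi < 1 ->
  0 < p -> p <= 1 - xi -> 0 < eps -> x = eps * mu -> s2 <= x ^+ 2 -> 1 <= d ->
  0 < x -> tilt_const * eps <= xi ->
  0 < tail /\ - ln tail <= 4 + tilt_const ^+ 2 / xi * (eps ^+ 2 * (n%:R * d)).
Proof.
move=> r2 rn xi0 xi1 p0 pxi e0 ex sx d1 x0.
have K1 := bin_const_ge1; have n0 : 0 < n%:R :> R by rewrite ltr0n (leq_ltn_trans _ rn).
have d0 : 0 < d by lra.
have [h1 h2 h3] := variance_bounds r2 xi0 p0 pxi.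
have mu0 : 0 < mu by move: x0; rewrite ex pmulr_rgt0.
have [C3 C3E] : exists C3 : R,
  C3 = 2 ^+ r * (2 * r)%:R * (r + 2)%:R ^+ r.-1 * bin_const / xi by eexists.
rewrite /tilt_const -C3E => hK.
have C30 : 0 <= C3.
  by rewrite C3E divr_ge0 ?(ltW xi0) // !mulr_ge0 ?exprn_ge0 // (le_trans ler01).
have [K0 KE] : exists K0, K0 = 2 + 2 * C3 by eexists.
rewrite -KE in hK *.
have K02 : 2 <= K0 by lra.
have [q qE] : exists q, q = (1 + K0 * eps) * p by eexists.
have ke0 : 0 <= K0 * eps by rewrite mulr_ge0 ?(ltW e0) //; lra.
have e1 : 1 <= 1 + K0 * eps by rewrite lerDl.
have q0 : 0 <= q by rewrite qE mulr_ge0 ?(ltW p0) //; lra.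
have q1 : q <= 1.
  rewrite qE; apply: (@le_trans _ _ ((1 + xi) * (1 - xi))); last by nra.
  by apply: ler_pM; rewrite ?(ltW p0) //; lra.
have q2 : q <= 2 * p by rewrite qE; apply: ler_wpM2r; [exact: ltW | lra].
have mq : mu + K0 * x <= pexp q E X.
  rewrite (pexp_nstars q (subxx _)) qE exprMn mulrCA ex.
  have : 1 + K0 * eps <= (1 + K0 * eps) ^+ r.
    by apply: ler_eXnr => //; exact: ltnW.
  move=> /(ler_wpM2r (ltW mu0)); apply: le_trans.
  by rewrite mulrDl mul1r -[K0 * eps * _]mulrA.
have vq : pvar q E X <= C3 * s2.
  apply: le_trans (pvar_nstars_le n q0 r2) _.
  have hd : (2 * r)%:R * (n%:R * q + r%:R) ^+ r.-1 <= (2 * r)%:R * ((r + 2)%:R ^+ r.-1 * d ^+ r.-1).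
    apply: ler_wpM2l => //; rewrite -exprMn.
    have nq : n%:R * q <= 2 * d by rewrite [leRHS]mulrCA; apply: ler_wpM2l => //; exact: ltW.
    have nq0 : 0 <= n%:R * q by rewrite mulr_ge0.
    have rd0 : 0 <= (r + 2)%:R * d by rewrite mulr_ge0 // ltW.
    have rd : r%:R <= r%:R * d by rewrite ler_peMr.
    apply: lerXn2r; rewrite ?nnegrE ?addr_ge0 //.
    rewrite natrD mulrDl; rewrite addrC [leLHS]addrC [leRHS]addrC.
    exact: lerD.
  have hm : #|stars n r|%:R * q ^+ r <= 2 ^+ r * mu.
    rewrite [leRHS]mulrCA -exprMn; apply: ler_wpM2l => //.
    have pp0 : 0 <= 2 * p by rewrite mulr_ge0 // ltW.
    by apply: (lerXn2r r _ _ q2); rewrite nnegrE.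
  apply: (@le_trans _ _ (2 ^+ r * mu * ((2 * r)%:R * ((r + 2)%:R ^+ r.-1 * d ^+ r.-1)))).
    apply: ler_pM => //; rewrite ?mulr_ge0 ?exprn_ge0 ?addr_ge0 ?mulr_ge0 //.
  have hmu : n%:R * d ^+ r <= bin_const * mu.
    rewrite card_stars natrM exprMn.
    have nq : 0 <= n%:R * p ^+ r by rewrite mulr_ge0 ?exprn_ge0 // ltW.
    have := ler_wpM2r nq (exp_le_binR rn).
    have -> : n%:R ^+ r * (n%:R * p ^+ r) = n%:R * (n%:R ^+ r * p ^+ r) by rewrite mulrCA.
    suff -> : bin_const * 'C(n.-1, r)%:R * (n%:R * p ^+ r)
      = bin_const * (n%:R * 'C(n.-1, r)%:R * p ^+ r) by [].
    by rewrite -!mulrA; congr (_ * _); rewrite mulrCA.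
  have hs : mu * d ^+ r.-1 * xi <= bin_const * s2.
    have nd : 0 < n%:R * d by exact: mulr_gt0.
    rewrite -(ler_pM2l nd); apply: (@le_trans _ _ (bin_const * mu * mu * xi)).
      have dr : d ^+ r = d * d ^+ r.-1 by rewrite -exprS prednK // ltnW.
      have -> : n%:R * d * (mu * d ^+ r.-1 * xi) = n%:R * d ^+ r * mu * xi.
        by rewrite dr; move: (mu) (d ^+ r.-1) => m D; ring.
      by do 2 ![apply: ler_wpM2r; first exact: ltW].
    have := ler_wpM2l (le_trans ler01 K1) h2.
    have -> : bin_const * (mu ^+ 2 * xi) = bin_const * mu * mu * xi.
      by move: (mu) => m; ring.
    by rewrite [leRHS]mulrCA.
  rewrite C3E -(ler_pM2r xi0).
  have -> : 2 ^+ r * (2 * r)%:R * (r + 2)%:R ^+ r.-1 * bin_const / xi * s2 * xi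
    = 2 ^+ r * (2 * r)%:R * (r + 2)%:R ^+ r.-1 * (bin_const * s2).
    move: (s2) ((r + 2)%:R ^+ r.-1) (2 ^+ r) (2 * r)%:R (bin_const) => s D u v w.
    by field; rewrite lt0r_neq0.
  have -> : 2 ^+ r * mu * ((2 * r)%:R * ((r + 2)%:R ^+ r.-1 * d ^+ r.-1)) * xi
    = 2 ^+ r * (2 * r)%:R * (r + 2)%:R ^+ r.-1 * (mu * d ^+ r.-1 * xi).
    move: (mu) (d ^+ r.-1) ((r + 2)%:R ^+ r.-1) (2 ^+ r) (2 * r)%:R => m D T u v.
    by ring.
  by apply: ler_wpM2l => //; rewrite !mulr_ge0 ?exprn_ge0.
have yy0 : 0 < (K0 - 1) * x by rewrite mulr_gt0 //; lra.
have p1 : p < 1 by lra.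
have Tq : mu + x + (K0 - 1) * x <= pexp q E X by move: mq; rewrite mulrBl mul1r; lra.
have vq2 : 2 * pvar q E X <= ((K0 - 1) * x) ^+ 2.
  rewrite exprMn KE; have x2 : 0 <= x ^+ 2 := sqr_ge0 x.
  have : C3 * s2 <= C3 * x ^+ 2 by exact: ler_wpM2l.
  have : 0 <= C3 ^+ 2 * x ^+ 2 by rewrite mulr_ge0 ?sqr_ge0.
  have : 0 <= C3 * x ^+ 2 by rewrite mulr_ge0.
  by move: (s2) (pvar q E X) vq => s v; move: (x ^+ 2) x2 => z *; nra.
have := tail_tilt p0 p1 q0 q1 yy0 Tq vq2.
set t := tail; set W := _ ^+ #|E| => ht.
clear h1 h2 h3 sx mq vq Tq vq2 yy0 q1 q2 q0 rn ex C3E KE C30 hK.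
have dl0 : 0 <= (q - p) ^+ 2 / (p * (1 - p)).
  by rewrite divr_ge0 ?sqr_ge0 // mulr_ge0 ?subr_ge0 // ltW.
have W0 : 0 < W by rewrite exprn_gt0 //; lra.
have t0 : 0 < t by rewrite -(pmulr_rgt0 _ W0); lra.
split => //.
have W_le : ln W <= K0 ^+ 2 / xi * (eps ^+ 2 * (n%:R * d)).
  rewrite lnXn; last by lra.
  rewrite -[_ *+ #|_|]mulr_natl; apply: (@le_trans _ _ ((n ^ 2)%:R * ((q - p) ^+ 2 / (p * (1 - p))))).
    apply: ler_pM => //; first by apply: ln_ge0; lra.
      by rewrite ler_nat card_complete_le.
    by apply: le_ln1Dx; lra.
  have -> : q - p = K0 * eps * p by rewrite qE; ring.
  rewrite natrX (_ : _ * (_ / _) = K0 ^+ 2 / (1 - p) * (eps ^+ 2 * (n%:R * d))); last first.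
    by field; rewrite !lt0r_neq0 //; lra.
  apply: ler_wpM2r; first by rewrite !mulr_ge0 // ltW.
  apply: ler_wpM2l; first exact: sqr_ge0.
  by rewrite lef_pV2 ?posrE; lra.
have : ln (1 / 4 : R) <= ln (W * t) by rewrite ler_ln ?posrE ?mulr_gt0 //; lra.
rewrite lnM ?posrE //; have := @ln_ge_subV R (1 / 4) (ltac:(lra)).
by rewrite invf_div; move: (K0 ^+ 2 / xi * _) W_le => z *; lra.
Qed.

(** Chosen so that the upper end of the packing window is at most (1 + packing_const eps) mu: 80 =
    16 * 5 from J <= 5 x / xi, and d + r <= r + 1. *)
Definition packing_const : R := 3 + 80 * r%:R * r.+1%:R ^+ r.-1 / xi.

Lemma lower_packing (eps : R) (J : nat) :
  (2 <= r)%N -> 0 < xi -> xi < 1 ->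
  0 < p -> p <= 1 - xi -> 0 < eps -> 0 < mu -> x = eps * mu -> s2 <= x ^+ 2 -> d <= 1 ->
  (0 < J)%N -> 3 * x <= xi * J%:R -> xi * J%:R <= 5 * x ->
  ((r.+1 * J) ^ 2 * 4 <= n)%N ->
  0 < tail /\ - ln tail <= 2 + 5 * x / xi * ln (1 + packing_const * eps).
Proof.
have q38 : 0 < 3 / 8 :> R by lra.
have l38 : - ln (3 / 8 : R) <= 2.
  by have := @ln_ge_subV R (3 / 8) q38; rewrite invf_div; lra.
move=> r2 xi0 xi1 p0 pxi e0 mu0 ex sx d1 J0 J3 J5 Jn.
have x0 : 0 < x by rewrite ex mulr_gt0.
have p1 : p <= 1 by lra.
have pr : p ^+ r <= p.
  rewrite -(prednK (ltnW r2)) exprS ler_piMr ?(ltW p0) // exprn_ile1 // ltW //.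
have J3' : 3 * x <= (1 - p ^+ r) * J%:R.
  by apply: le_trans J3 _; apply: ler_wpM2r => //; lra.
have := tail_packing r2 (ltW p0) p1 x0 sx J0 J3' Jn.
set T := mu + 3 * x + _ => h.
have dp0 : 0 <= d by rewrite mulr_ge0 // ltW.
have T1 : mu <= T.
  have : 0 <= (16 * (r * J))%:R * (d + r%:R) ^+ r.-1.
    by rewrite mulr_ge0 // exprn_ge0 // addr_ge0.
  by rewrite /T; move: (_ * _ ^+ r.-1) (mu) => A m; lra.
have T2 : T <= (1 + packing_const * eps) * mu.
  have : (16 * (r * J))%:R * (d + r%:R) ^+ r.-1 <= 80 * r%:R * r.+1%:R ^+ r.-1 / xi * x.
    apply: (@le_trans _ _ (16 * r%:R * (5 * x / xi) * r.+1%:R ^+ r.-1)); last first.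
      rewrite le_eqVlt; apply/orP; left; apply/eqP.
      by move: (r.+1%:R ^+ r.-1) => z; field; rewrite lt0r_neq0.
    apply: ler_pM => //; first by rewrite exprn_ge0 // addr_ge0.
      have -> : (16 * (r * J))%:R = 16 * r%:R * J%:R :> R by rewrite mulnA !natrM.
      apply: ler_wpM2l; first by rewrite mulr_ge0.
      by rewrite ler_pdivlMr // mulrC.
    by apply: lerXn2r; rewrite ?nnegrE ?addr_ge0 // -natr1; lra.
  rewrite /T /packing_const ex; move: (_ * _ ^+ r.-1) (80 * _ * _ / xi) (mu) => A B m; lra.
have T0 : 0 < T by exact: lt_le_trans T1.
have t0 : 0 < tail.
  by apply: lt_le_trans h; rewrite mulr_gt0 ?exprn_gt0 ?divr_gt0.
split => //; apply: (@le_trans _ _ (- ln (3 / 8 * (mu / T) ^+ J))).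
  by rewrite lerN2 ler_ln ?posrE // mulr_gt0 ?exprn_gt0 ?divr_gt0.
rewrite lnM ?posrE ?exprn_gt0 ?divr_gt0 //.
rewrite opprD; apply: lerD => //.
rewrite lnXn ?divr_gt0 // -[_ *+ J]mulr_natl -mulrN ln_div ?posrE // opprB.
apply: ler_pM => //.
- by rewrite subr_ge0 ler_ln ?posrE.
- by rewrite ler_pdivlMr // mulrC.
- by rewrite -ln_div ?posrE // ler_ln ?posrE ?divr_gt0 // ?ler_pdivrMr // -(pmulr_lgt0 _ mu0) (lt_le_trans T0).
Qed.

End LowerExponents.

(** * Regimes in which planting one cluster is as cheap as G *)

Section LowerRegimes.
Variables (R : realType) (r n : nat) (a eps d mu x y L K : R).
Hypothesis P : regime r n a eps d mu x y L K.
Local Notation M := (Num.max y (x / n%:R ^+ r.-1)).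

(** For the term y: L is of order a and a d <= K y, so L d^(r-1) is of order y^(r-1). For the other
    term, L d <= 2 n. Since G has order x log (1 + eps) / d^(r-1), this bounds M L by G once eps is
    bounded below. *)
Lemma regime_large_dense : 1 <= d ->
  M * (L * d ^+ r.-1) <= ((18 * r)%:R * K ^+ r.-1 + 2) * x.
Proof.
have r10 : (0 < r.-1)%N by have := regime_r P; lia.
have r21 : r.-1 = r.-2.+1 by have := regime_r P; lia.
move=> d1; have := P => -[r2 a1 an ea d0 dn m0 K1 mK ex y0 yx eL].
have a0 : 0 < a by lra.
have ad : 1 <= a * d by nra.
have Ky := regime_y_ge P; have hL := regime_L_dense_a P ad.
have L1 := regime_L1 P; have x0 := regime_x0 P; have n0 := regime_n0 P.
have L0 : 0 <= L by lra.
have dr0 : 0 <= d ^+ r.-1 by rewrite exprn_ge0 // ltW.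
have c0 : 0 <= (18 * r)%:R * K ^+ r.-1 by rewrite mulr_ge0 // exprn_ge0 //; lra.
apply: regime_max_le.
- by rewrite mulr_ge0.
- have -> : x = y * y ^+ r.-1 by rewrite -exprS -(regime_rE P) yx.
  rewrite [leRHS]mulrCA; apply: ler_wpM2l; first exact: ltW.
  have yr0 : 0 <= y ^+ r.-1 by rewrite exprn_ge0 // ltW.
  apply: (@le_trans _ _ ((18 * r)%:R * K ^+ r.-1 * y ^+ r.-1)); last first.
    by apply: ler_wpM2r => //; lra.
  rewrite -[leRHS]mulrA -exprMn; apply: (@le_trans _ _ ((18 * r)%:R * (a * d ^+ r.-1))).
    by rewrite mulrA; apply: ler_wpM2r.
  apply: ler_wpM2l => //; apply: (@le_trans _ _ ((a * d) ^+ r.-1)).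
    rewrite exprMn; apply: ler_wpM2r => //; exact: ler_eXnr.
  apply: lerXn2r; rewrite ?nnegrE ?mulr_ge0 ?(ltW a0) ?(ltW d0) ?(ltW y0) ?(le_trans ler01) //.
  apply: le_trans Ky; apply: ler_wpM2r; first exact: ltW.
  exact: ler_eXnr.
- have nr0 : 0 < n%:R ^+ r.-1 :> R by rewrite exprn_gt0.
  rewrite mulrAC ler_pdivrMr // [_ * x]mulrC -mulrA; apply: ler_wpM2l; first exact: ltW.
  apply: (@le_trans _ _ (2 * n%:R ^+ r.-1)); last by apply: ler_wpM2r; [exact: ltW | lra].
  have dL : L * d <= 2 * n%:R.
    by have := mulr_ln_le1 d0 n0 dn; rewrite eL; lra.
  rewrite r21 !exprS !mulrA; apply: ler_pM => //.
  - by rewrite mulr_ge0 // ltW.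
  - by rewrite exprn_ge0 // ltW.
  - by apply: lerXn2r dn; rewrite nnegrE ltW.
Qed.

(** If n / d <= n^2, then L is of order log n, hence at most of order a, and ln (1 + eps) >= 1 / (2
    a). Otherwise mu <= n d^r is so small that (1 + eps) mu >= 1 forces 1 + eps >= sqrt (n / d). *)
Lemma regime_L_sparse : (1 < n)%N -> d <= 1 -> 1 <= (1 + eps) * mu ->
  mu <= n%:R * d ^+ r ->
  L <= (66 * r)%:R * a ^+ 2 * ln (1 + eps).
Proof.
move=> n2 d1 m1 mn; have := P => -[r2 a1 an ea d0 dn m0 K1 mK ex y0 yx eL].
have a0 : 0 < a by lra.
have [la0 la] := regime_lna P; have lnn := regime_lnn P; have n0 := regime_n0 P.
have e0 := regime_eps0 P.
have r1 : 1 <= r%:R :> R by rewrite ler1n ltnW.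
have hl := ln1D_ge a1 ea; have l0 := ln1D_ge0 (ltW e0).
have lnd : ln d <= 0 by exact: ln_le0.
set l := ln (1 + eps) in hl l0 *.
have lnn0 : 1 / 2 <= ln n%:R :> R.
  have := ln_ge_subV n0; apply: le_trans.
  have : n%:R^-1 <= 2^-1 :> R by rewrite lef_pV2 ?posrE // ler_nat.
  lra.
have [q1|q2] := leP (ln n%:R - ln d) (2 * ln n%:R).
  have al : 1 <= 2 * a * l by rewrite -ler_pdivrMl ?mulr1 //; lra.
  apply: (@le_trans _ _ ((33 * r)%:R * a)).
    rewrite eL; apply: (@le_trans _ _ (1 + 2 * ((16 * r)%:R * a))).
      rewrite lerD2l; apply: le_trans q1 _; rewrite lnn; apply: ler_wpM2l => //.
      exact: ler_wpM2l.
    have : 1 <= r%:R * a by rewrite -[leLHS]mulr1 ler_pM.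
    by rewrite !natrM; lra.
  have -> : (66 * r)%:R * a ^+ 2 * l = (33 * r)%:R * a * (2 * a * l).
    by rewrite !natrM; ring.
  by rewrite ler_peMr // mulr_ge0 // ltW.
set q := ln n%:R - ln d in q2 eL.
have hq : q <= 2 * l.
  have h : 0 <= l + (ln n%:R + r%:R * ln d).
    rewrite mulr_natl -lnXn // -lnM ?posrE ?exprn_gt0 //.
    rewrite /l -lnM ?posrE ?mulr_gt0 ?exprn_gt0 //; last by lra.
    apply: ln_ge0; apply: le_trans m1 _; apply: ler_wpM2l => //; lra.
  have h2 : r%:R * (2 * ln n%:R) <= r%:R * q by apply: ler_wpM2l => //; exact: ltW.
  have h3 : 2 * q <= r%:R * q by apply: ler_wpM2r; [lra | rewrite ler_nat].
  have h4 : r%:R * ln d = r%:R * ln n%:R - r%:R * q by rewrite /q; ring.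
  by lra.
have q1 : 1 <= q by lra.
apply: (@le_trans _ _ (4 * l)); first by rewrite eL; lra.
apply: ler_wpM2r => //; apply: (@le_trans _ _ ((66 * r)%:R * 1)).
  by rewrite natrM; lra.
by apply: ler_wpM2l => //; exact: exprn_ege1.
Qed.

(** Since a^(8 r) = sqrt n, this covers the x too large for disjoint planting. Then y >= c a^8, so x
    / y absorbs the a^2 of [regime_L_sparse]. *)
Lemma regime_sparse (c : R) : (1 < n)%N -> d <= 1 -> 1 <= (1 + eps) * mu ->
  mu <= n%:R * d ^+ r -> 0 < c -> c <= 1 -> c * a ^+ (8 * r) <= x ->
  M * L <= (66 * r)%:R / c ^+ r.-1 * (x * ln (1 + eps)).
Proof.
have e8 : (2 <= 8 * r.-1)%N by have := regime_r P; lia.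
have e16 : (2 <= 16 * r * r.-1)%N by have := regime_r P; nia.
move=> n2 d1 m1 mn c0 c1 cx; have := P => -[r2 a1 an ea d0 dn m0 K1 mK ex y0 yx eL].
have a0 : 0 < a by lra.
have hL := regime_L_sparse n2 d1 m1 mn.
have e0 := regime_eps0 P; have x0 := regime_x0 P.
have L1 := regime_L1 P; have L0 : 0 <= L by lra.
have l0 := ln1D_ge0 (ltW e0).
set l := ln (1 + eps) in hL l0 *.
have cr : 0 < c ^+ r.-1 by exact: exprn_gt0.
have ca : c * a ^+ 8 <= y.
  have ca0 : 0 <= c * a ^+ 8 by rewrite mulr_ge0 ?exprn_ge0 // ltW.
  rewrite -(@ler_pXn2r _ r) ?nnegrE ?(ltW y0) //; last exact: ltnW.
  rewrite yx (exprMn _ c (a ^+ 8)) -(exprM a 8 r); apply: le_trans cx.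
  apply: ler_wpM2r; first by rewrite exprn_ge0 // ltW.
  rewrite -(prednK (ltnW r2)) exprS ler_piMr ?(ltW c0) // exprn_ile1 // ltW //.
apply: regime_max_le => //.
- have -> : (66 * r)%:R / c ^+ r.-1 * (x * l) = y * ((66 * r)%:R / c ^+ r.-1 * (y ^+ r.-1 * l)).
    have -> : x = y * y ^+ r.-1 by rewrite -exprS -(regime_rE P) yx.
    by move: (y ^+ r.-1) (c ^+ r.-1) => u v; ring.
  apply: ler_wpM2l; first exact: ltW.
  apply: le_trans hL _; rewrite -[leLHS]mulrA -[leRHS]mulrA; apply: ler_wpM2l => //.
  rewrite [leRHS]mulrA; apply: ler_wpM2r => //.
  rewrite -ler_pdivrMl ?invr_gt0 // invrK.
  apply: (@le_trans _ _ ((c * a ^+ 8) ^+ r.-1)); last first.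
    by apply: (lerXn2r r.-1 _ _ ca); rewrite nnegrE ?mulr_ge0 ?exprn_ge0 // ltW.
  rewrite (exprMn _ c (a ^+ 8)) -(exprM a 8); apply: ler_wpM2l; first exact: ltW.
  exact: ler_weXn2l.
- have nr0 : 0 < n%:R ^+ r.-1 :> R by rewrite exprn_gt0 ?(regime_n0 P).
  have xl0 : 0 <= x * l by rewrite mulr_ge0 // ltW.
  apply: (@le_trans _ _ ((66 * r)%:R * (x * l))); last first.
    apply: ler_wpM2r => //; rewrite ler_peMr // invf_ge1 //.
    by rewrite exprn_ile1 // ltW.
  rewrite mulrAC ler_pdivrMr // -mulrA [leRHS]mulrC -!mulrA mulrCA.
  rewrite [leRHS]mulrCA.
  apply: (@le_trans _ _ (x * ((66 * r)%:R * a ^+ 2 * l))).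
    by apply: ler_wpM2l => //; exact: ltW.
  have -> : x * ((66 * r)%:R * a ^+ 2 * l) = a ^+ 2 * ((66 * r)%:R * (x * l)).
    by move: ((66 * r)%:R) => q; ring.
  rewrite [leRHS](_ : _ = n%:R ^+ r.-1 * ((66 * r)%:R * (x * l))); last first.
    by move: ((66 * r)%:R) (n%:R ^+ _) => q u; ring.
  apply: ler_wpM2r; first by rewrite mulr_ge0.
  by rewrite -an -exprM; apply: ler_weXn2l.
Qed.

End LowerRegimes.

(** One summand per case of [lower_main]: tilting, d >= 1 with eps > xi / K0, disjoint planting, and
    d < 1 with x at least of order sqrt n. *)
Definition lower_const (R : realType) (r : nat) (K xi A C K0 Q : R) : R :=
  (4 + 2 * K0 ^+ 2 * K * C / xi)
  + A * ((18 * r)%:R * K ^+ r.-1 + 2) * C / ln (1 + xi / K0)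
  + (2 + 5 * (Num.truncn Q).+1%:R * C / xi)
  + A * (66 * r)%:R / (xi / (10 * r.+1%:R)) ^+ r.-1 * C.

Lemma lower_main (R : realType) (r n : nat) (a eps d mu x y L K : R)
  (xi A C K0 Q T G : R) :
  regime r n a eps d mu x y L K -> 0 < xi -> xi < 1 -> (1 < n)%N ->
  xi / 2 <= x -> 1 <= (1 + eps) * mu -> mu <= n%:R * d ^+ r ->
  0 <= A -> 0 <= C -> 2 <= K0 -> 0 <= Q -> 1 <= G ->
  T <= A * (Num.max y (x / n%:R ^+ r.-1) * L) ->
  (1 <= d -> x * ln (1 + eps) <= C * (d ^+ r.-1 * G)) ->
  (d <= 1 -> x * ln (1 + eps) <= C * G) ->
  (1 <= d -> K0 * eps <= xi -> T <= 4 + K0 ^+ 2 / xi * (eps ^+ 2 * (n%:R * d))) ->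
  (d <= 1 -> forall J : nat, (0 < J)%N -> 3 * x <= xi * J%:R -> xi * J%:R <= 5 * x ->
     ((r.+1 * J) ^ 2 * 4 <= n)%N -> T <= 2 + 5 * x / xi * ln (1 + Q * eps)) ->
  T <= lower_const r K xi A C K0 Q * G.
Proof.
have e16 : (8 * r * 2 = 16 * r)%N by lia.
move=> P xi0 xi1 n2 x2 m1 mn A0 C0 K02 Q0 G1 hA hGd hGs htilt hpack.
have := P => -[r2 a1 an ea d0 dn m0 K1 mK ex y0 yx eL].
have a0 : 0 < a by lra.
have e0 := regime_eps0 P; have x0 := regime_x0 P.
have l0 := ln1D_ge0 (ltW e0); have G0 : 0 <= G by lra.
have K00 : 0 < K0 by lra.
have e1 : 0 < xi / K0 by exact: divr_gt0.
have le1 : 0 < ln (1 + xi / K0) by rewrite ln_gt0 // ltrDl.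
have c60 : 0 < xi / (10 * r.+1%:R) by rewrite divr_gt0 // mulr_gt0.
rewrite /lower_const.
set t1 := 4 + _; set t2 := _ / ln (1 + xi / K0); set t3 := 2 + _; set t4 := _ * C.
have t10 : 0 <= t1.
  by rewrite /t1 addr_ge0 // divr_ge0 ?(ltW xi0) // !mulr_ge0 ?sqr_ge0 //; lra.
have t20 : 0 <= t2.
  rewrite /t2 divr_ge0 ?(ltW le1) // !mulr_ge0 // addr_ge0 // mulr_ge0 // exprn_ge0 //; lra.
have t30 : 0 <= t3 by rewrite /t3 addr_ge0 // divr_ge0 ?(ltW xi0) // !mulr_ge0.
have t40 : 0 <= t4 by rewrite /t4 !mulr_ge0 ?invr_ge0 ?exprn_ge0 // ltW.
have fin t : t <= t1 + t2 + t3 + t4 -> T <= t * G -> T <= (t1 + t2 + t3 + t4) * G.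
  by move=> ht hT; apply: le_trans hT _; apply: ler_wpM2r.
have [d1|d1] := leP 1 d.
  have dr0 : 0 < d ^+ r.-1 by rewrite exprn_gt0.
  have hG := hGd d1.
  have [ke|ke] := leP (K0 * eps) xi.
    apply: (fin t1); first by move: t20 t30 t40; clear; lra.
    have eps1 : eps <= 1 by move: ke K02 xi1 e0; clear; nra.
    have hl : eps / 2 <= ln (1 + eps).
      have h1 : 0 < 1 + eps by move: e0; clear; lra.
      have := ln_ge_subV h1; apply: le_trans.
      have -> : 1 - (1 + eps)^-1 = eps / (1 + eps) by field; rewrite lt0r_neq0.
      apply: ler_wpM2l; first exact: ltW.
      by rewrite lef_pV2 ?posrE //; move: eps1; clear; lra.
    have key : eps ^+ 2 * (n%:R * d) <= 2 * K * C * G.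
      rewrite -(ler_pM2r dr0).
      apply: (@le_trans _ _ (eps ^+ 2 * (K * mu))).
        rewrite -mulrA; apply: ler_wpM2l; first exact: sqr_ge0.
        by rewrite -mulrA -exprS -(regime_rE P).
      apply: (@le_trans _ _ (2 * K * (x * ln (1 + eps)))).
        have -> : eps ^+ 2 * (K * mu) = 2 * K * (x * (eps / 2)) by rewrite ex; field.
        apply: ler_wpM2l; first by move: K1; clear; lra.
        by apply: ler_wpM2l => //; exact: ltW.
      have -> : 2 * K * C * G * d ^+ r.-1 = 2 * K * (C * (d ^+ r.-1 * G)).
        by move: (d ^+ r.-1) => D; ring.
      by apply: ler_wpM2l => //; move: K1; clear; lra.
    apply: le_trans (htilt d1 ke) _; rewrite /t1 mulrDl; apply: lerD.
      by move: G1; clear; lra.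
    have -> : 2 * K0 ^+ 2 * K * C / xi * G = K0 ^+ 2 / xi * (2 * K * C * G).
      by move: (K0 ^+ 2) (xi^-1) => u v; ring.
    by apply: ler_wpM2l => //; rewrite divr_ge0 ?sqr_ge0 // ltW.
  apply: (fin t2); first by move: t10 t30 t40; clear; lra.
  apply: le_trans hA _.
  rewrite /t2 -!mulrA; apply: ler_wpM2l => //.
  rewrite -(ler_pM2r dr0) -!mulrA.
  apply: le_trans (regime_large_dense P d1) _.
  apply: ler_wpM2l.
    by rewrite addr_ge0 // mulr_ge0 // exprn_ge0 //; move: K1; clear; lra.
  have lel : ln (1 + xi / K0) <= ln (1 + eps).
    apply: ler_ln1D; first exact: ltW.
    by rewrite ler_pdivrMr // mulrC ltW.
  have h : x * ln (1 + xi / K0) <= C * (d ^+ r.-1 * G).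
    by apply: le_trans hG; apply: ler_wpM2l => //; exact: ltW.
  rewrite -(ler_pM2r le1); apply: le_trans h _.
  rewrite le_eqVlt; apply/orP; left; apply/eqP.
  by move: (d ^+ r.-1) (ln (1 + xi / K0)) le1 => D l ll; field; exact: lt0r_neq0.
have {}d1 := ltW d1; have hG := hGs d1.
have z0 : 0 <= 3 * x / xi by rewrite divr_ge0 ?(ltW xi0) //; move: x0; clear; lra.
(* J = j + 1 stars are planted; as xi <= 2 x, rounding up costs at most 2 x, which gives xi J <= 5
   x. *)
have /andP := truncn_itv z0; move: (Num.truncn (3 * x / xi)) => j [jl ju].
have J3 : 3 * x <= xi * j.+1%:R by rewrite [leRHS]mulrC -ler_pdivrMr // ltW.
have J5 : xi * j.+1%:R <= 5 * x.
  rewrite -natr1; have : xi * j%:R <= 3 * x by rewrite mulrC -ler_pdivlMr.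
  by move: x2; clear; lra.
have [Jn|Jn] := leqP ((r.+1 * j.+1) ^ 2 * 4) n.
  apply: (fin t3); first by move: t10 t20 t40; clear; lra.
  apply: le_trans (hpack d1 j.+1 isT J3 J5 Jn) _.
  rewrite /t3 [leRHS]mulrDl; apply: lerD; first by move: G1; clear; lra.
  set m := (Num.truncn Q).+1.
  have Qm : Q <= m%:R by apply/ltW/truncnS_gt.
  apply: (@le_trans _ _ (5 * x / xi * (m%:R * ln (1 + eps)))).
    apply: ler_wpM2l; first by rewrite divr_ge0 ?(ltW xi0) //; move: x0; clear; lra.
    apply: le_trans (ln1D_natM m (ltW e0)); apply: ler_ln1D.
      by rewrite mulr_ge0 // ltW.
    by apply: ler_wpM2r => //; exact: ltW.
  have -> : 5 * x / xi * (m%:R * ln (1 + eps)) = 5 * m%:R / xi * (x * ln (1 + eps)).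
    by move: (m%:R) (xi^-1) (ln _) => u v w; ring.
  have -> : 5 * m%:R * C / xi * G = 5 * m%:R / xi * (C * G).
    by move: (m%:R) (xi^-1) => u v; ring.
  by apply: ler_wpM2l => //; rewrite divr_ge0 ?mulr_ge0 // ltW.
apply: (fin t4); first by move: t10 t20 t30; clear; lra.
apply: le_trans hA _.
have c61 : xi / (10 * r.+1%:R) <= 1.
  rewrite ler_pdivrMr ?mulr_gt0 // mul1r.
  have : 1 <= r.+1%:R :> R by rewrite ler1n.
  by move: xi1; clear; lra.
(* Now 4 ((r + 1) J)^2 > n with xi J <= 5 x, whence sqrt n <= 10 (r + 1) x / xi. *)
have hx : xi / (10 * r.+1%:R) * a ^+ (8 * r) <= x.
  rewrite mulrAC ler_pdivrMr ?mulr_gt0 //.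
  have sq : (a ^+ (8 * r)) ^+ 2 <= (2 * (r.+1 * j.+1)%:R) ^+ 2.
    rewrite -exprM e16.
    rewrite an exprMn -!natrX -natrM ler_nat mulnC; exact: ltnW.
  rewrite ler_pXn2r ?nnegrE ?exprn_ge0 ?mulr_ge0 ?(ltW a0) // in sq.
  apply: (@le_trans _ _ (xi * (2 * (r.+1 * j.+1)%:R))).
    by apply: ler_wpM2l => //; exact: ltW.
  rewrite natrM; have r0 : 0 <= 2 * r.+1%:R :> R by rewrite mulr_ge0.
  have := ler_wpM2l r0 J5; move: (r.+1%:R) (j.+1%:R) => u v; clear; lra.
have h := regime_sparse P n2 d1 m1 mn c60 c61 hx.
rewrite /t4 -!mulrA; apply: ler_wpM2l => //; apply: le_trans h _.
rewrite -!mulrA; do 2 ![apply: ler_wpM2l; first by rewrite ?invr_ge0 ?exprn_ge0 // ltW].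
exact: hG.
Qed.

(** * Assembly *)

(** With f = phi(eps), l = log (1 + eps), m = mu, s = sigma^2, q = n d: the two lower bounds for the
    variance become the two upper bounds for G used in [regime_light]. *)
Lemma ler_exponent_div (R : realType) (xi f e l m s q : R) :
  0 < xi -> 0 < m -> 0 < s -> 0 <= f -> f <= e * l -> 0 <= e * l ->
  xi * m <= s -> m ^+ 2 * xi <= q * s ->
  f * m ^+ 2 / s <= e * m * l / xi /\ f * m ^+ 2 / s <= e * l * q / xi.
Proof.
move=> xi0 m0 s0 f0 fel el0 h1 h2; split; rewrite ler_pdivrMr //.
  rewrite mulrAC ler_pdivlMr //; apply: (@le_trans _ _ (e * l * m * (xi * m))).
    have -> : f * m ^+ 2 * xi = f * m * (xi * m) by ring.
    apply: ler_wpM2r; first by rewrite mulr_ge0 // ltW.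
    by apply: ler_wpM2r => //; exact: ltW.
  have -> : e * m * l * s = e * l * m * s by ring.
  by apply: ler_wpM2l => //; rewrite mulr_ge0 // ltW.
rewrite mulrAC ler_pdivlMr //.
have -> : f * m ^+ 2 * xi = f * (m ^+ 2 * xi) by ring.
have -> : e * l * q * s = e * l * (q * s) by ring.
by apply: ler_pM => //; rewrite mulr_ge0 ?sqr_ge0 // ltW.
Qed.

Lemma ler_exponent_mul (R : realType) (f e l m s w : R) :
  0 < m -> 0 < s -> 0 <= w -> 0 <= f -> e * l / 4 <= f -> s <= m * w ->
  e * m * l <= 4 * (w * (f * m ^+ 2 / s)).
Proof.
move=> m0 s0 w0 f0 h hs; have -> : 4 * (w * (f * m ^+ 2 / s)) = 4 * w * f * m ^+ 2 / s.
  by field; exact: lt0r_neq0.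
rewrite ler_pdivlMr //; apply: (@le_trans _ _ (4 * f * m * s)).
  apply: ler_wpM2r; first exact: ltW.
  have -> : e * m * l = e * l * m by ring.
  by apply: ler_wpM2r; [exact: ltW | lra].
have -> : 4 * w * f * m ^+ 2 = 4 * f * m * (m * w) by ring.
by apply: ler_wpM2l => //; rewrite !mulr_ge0 // ltW.
Qed.

(** The second hypothesis gives - ln P >= 1/2, which removes the factor 3 for bounded z: add 4 times
    it to - ln P >= z - ln 3 >= z - 2. *)
Lemma ln_tail_ge (R : realType) (P z : R) : 0 < P -> P <= 2^-1 ->
  P <= 3 * expR (- z) -> z / 5 <= - ln P.
Proof.
move=> P0 P2 P3.
have h1 : ln P <= ln (2^-1) by rewrite ler_ln ?posrE ?invr_gt0.
have h2 : ln P <= ln (3 * expR (- z)) by rewrite ler_ln ?posrE ?mulr_gt0 ?expR_gt0.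
rewrite lnM ?posrE ?expR_gt0 // expRK in h2.
rewrite lnV ?posrE // in h1.
have t0 : 0 < 2 :> R by lra.
have s0 : 0 < 3 :> R by lra.
have := ln_ge_subV t0; have := ln_le_sub1 s0; lra.
Qed.

Section Assembly.
Variables (R : realType) (r n : nat) (p xi eps a : R).
Local Notation E := (complete_graph n).
Local Notation X := (nstars R (stars n r)).
Local Notation mu := (#|stars n r|%:R * p ^+ r).
Local Notation d := (n%:R * p).
Local Notation s2 := (pvar p E X).
Local Notation x := (eps * mu).
Local Notation y := (x `^ (r%:R^-1)).
Local Notation L := (ln (expR 1 / p)).
Local Notation K := (bin_const R r).
Local Notation tail := (pexp p E (fun G => ((1 + eps) * mu <= X G)%R%:R)).
Local Notation G := (phi eps * mu ^+ 2 / s2).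
Local Notation M := (Num.max y (x / n%:R ^+ r.-1)).

Hypotheses (r2 : (2 <= r)%N) (n1 : (1 <= n)%N) (xi0 : 0 < xi) (xi1 : xi < 1).
Hypotheses (p0 : 0 < p) (pxi : p <= 1 - xi).
Hypotheses (a1 : 1 <= a) (an : a ^+ (16 * r) = n%:R) (ea : a^-1 <= eps).
Hypotheses (m1 : 1 <= (1 + eps) * mu) (mtop : (1 + eps) * mu <= #|stars n r|%:R).

Lemma assembly_eps0 : 0 < eps.
Proof. by apply: lt_le_trans ea; rewrite invr_gt0 (lt_le_trans ltr01 a1). Qed.

Lemma assembly_mu0 : 0 < mu.
Proof.
rewrite lt0r mulr_ge0 ?exprn_ge0 ?(ltW p0) // andbT; apply/eqP => e.
by move: m1; rewrite e mulr0 ler10.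
Qed.

Lemma assembly_rn : (r < n)%N.
Proof.
rewrite ltnNge; apply/negP => nr; have := assembly_mu0.
rewrite card_stars bin_small ?muln0 ?mul0r ?ltxx //; lia.
Qed.

Lemma assembly_x0 : 0 < x.
Proof. by rewrite mulr_gt0 ?assembly_eps0 ?assembly_mu0. Qed.

Lemma assembly_yx : y ^+ r = x.
Proof.
rewrite -powR_mulrn ?powR_ge0 // -powRrM mulVf ?powRr1 ?ltW ?assembly_x0 //.
by rewrite pnatr_eq0; case: (r) r2.
Qed.

Lemma assembly_L : L = 1 - ln p.
Proof. by rewrite ln_div ?posrE ?expR_gt0 // expRK. Qed.

Lemma assembly_mu_ge : n%:R * d ^+ r <= K * mu.
Proof.
rewrite card_stars natrM exprMn.
have nq : 0 <= n%:R * p ^+ r by rewrite mulr_ge0 ?exprn_ge0 // ltW.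
have := ler_wpM2r nq (@exp_le_binR R r n assembly_rn).
have -> : n%:R ^+ r * (n%:R * p ^+ r) = n%:R * (n%:R ^+ r * p ^+ r) by rewrite mulrCA.
suff -> : K * 'C(n.-1, r)%:R * (n%:R * p ^+ r)
  = K * (n%:R * 'C(n.-1, r)%:R * p ^+ r) by [].
by rewrite -!mulrA; congr (_ * _); rewrite mulrCA.
Qed.

Lemma assembly_mu_le : mu <= n%:R * d ^+ r.
Proof.
rewrite card_stars natrM exprMn mulrA; apply: ler_wpM2r.
  by rewrite exprn_ge0 // ltW.
apply: ler_wpM2l => //; rewrite -natrX ler_nat; apply: leq_trans (leq_bin_exp _ _) _.
exact/leq_exp_r/leq_pred.
Qed.

Lemma assembly_regime : regime r n a eps d mu x y L K.
Proof.
have n0 : 0 < n%:R :> R by rewrite ltr0n.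
split => //.
- exact: mulr_gt0.
- rewrite ler_piMr // (le_trans pxi) // lerBlDr lerDl ltW //.
- exact: assembly_mu0.
- exact: bin_const_ge1.
- exact: assembly_mu_ge.
- by rewrite powR_gt0 // assembly_x0.
- exact: assembly_yx.
- by rewrite assembly_L lnM ?posrE // opprD addNKr.
Qed.

Lemma assembly_s2_gt0 : 0 < s2.
Proof.
have [h _ _] := variance_bounds n r2 xi0 p0 pxi.
by apply: lt_le_trans h; rewrite mulr_gt0 ?assembly_mu0.
Qed.

Hypotheses (G1 : 1 <= G) (ML1 : 1 <= M * L).

(** As phi(eps) <= eps^2, G >= 1 says that x is at least one standard deviation. The Chebyshev and
    Cantelli steps rest on this. *)
Lemma assembly_s2_le : s2 <= x ^+ 2.
Proof.
move: G1; rewrite ler_pdivlMr ?assembly_s2_gt0 // mul1r => h; apply: le_trans h _.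
rewrite (exprMn _ eps mu); apply: ler_wpM2r; first exact: sqr_ge0.
by apply: phi_le_sqr; rewrite ltW ?assembly_eps0.
Qed.

(** If x were smaller, mu >= 1 - x and xi mu <= s2 <= x^2 would give xi (1 - x) <= x^2, which fails
    for x < xi / 2. *)
Lemma assembly_x_ge : xi / 2 <= x.
Proof.
have [h _ _] := variance_bounds n r2 xi0 p0 pxi.
have := le_trans h assembly_s2_le; have := assembly_x0; have := m1.
rewrite mulrDl mul1r; move: (mu) (x) (xi) xi0 xi1 => m z k k0 k1 h1 z0 hz.
rewrite leNgt; apply/negP => zx.
have e1 : 0 <= (k / 2 - z) * z by rewrite mulr_ge0 ?subr_ge0 // ltW.
have e2 : 0 <= k * (m - (1 - z)) by rewrite mulr_ge0 ?(ltW k0) // subr_ge0 lerBlDr.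
have e3 : 0 < k * (1 - k) by rewrite mulr_gt0 // subr_gt0.
have e4 : 0 <= k * (k / 2 - z) by rewrite mulr_ge0 ?subr_ge0 ?ltW.
rewrite expr2 in hz; move: hz e1 e2 e3 e4; lra.
Qed.

Lemma assembly_tail_eq : tail = pexp p E (fun H => (mu + x <= X H)%R%:R).
Proof. by apply: eq_pexp => H _; rewrite mulrDl mul1r. Qed.

Lemma assembly_cluster : 0 < tail /\ - ln tail <= (cluster_const r xi + 1) * (M * L).
Proof.
rewrite assembly_tail_eq; apply: lower_cluster => //.
- exact: assembly_rn.
- by rewrite powR_gt0 // assembly_x0.
- exact: assembly_yx.
- exact: assembly_x_ge.
- exact: assembly_s2_le.
- by rewrite -{1}[mu]mul1r -mulrDl.
- exact: assembly_L.
Qed.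

Lemma assembly_upper :
  upper_const r K xi / 5 * Num.min G (M * L) <= - ln tail.
Proof.
have [t0 _] := assembly_cluster.
have p1 : p <= 1 by rewrite (le_trans pxi) // lerBlDr lerDl ltW.
have e0 := assembly_eps0; have mu0 := assembly_mu0; have s0 := assembly_s2_gt0.
have [h1 h2 _] := variance_bounds n r2 xi0 p0 pxi.
have l0 : 0 <= eps * ln (1 + eps) by rewrite mulr_ge0 ?ln1D_ge0 // ltW.
have ph : phi eps <= eps * ln (1 + eps) by apply: phi_le; exact: ltW.
have ph0 : 0 <= phi eps.
  by apply: le_trans (phi_ge (ltW e0)); rewrite divr_ge0.
have [g1 g2] := ler_exponent_div xi0 mu0 s0 ph0 ph l0 h1 h2.
rewrite mulrAC; apply: ln_tail_ge => //.
  have := pexp_cantelli (ltW p0) p1 assembly_x0 assembly_s2_le.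
  by rewrite (pexp_nstars p (subxx _)) assembly_tail_eq.
apply: (upper_exp assembly_regime) => //; first exact: ltW.
exact: le_trans G1.
Qed.

Lemma assembly_lower_G :
  - ln tail <= lower_const r K xi (cluster_const r xi + 1)
     (4 * ((2 * r)%:R * r.+1%:R ^+ r.-1)) (tilt_const r xi) (packing_const r xi) * G.
Proof.
have e0 := assembly_eps0; have mu0 := assembly_mu0; have s0 := assembly_s2_gt0.
have rn := assembly_rn; have n0 : 0 < n%:R :> R by rewrite ltr0n.
have d0 : 0 < d by exact: mulr_gt0.
have [_ _ h3] := variance_bounds n r2 xi0 p0 pxi.
have l0 : 0 <= eps * ln (1 + eps) by rewrite mulr_ge0 ?ln1D_ge0 // ltW.
have ph := phi_ge (ltW e0).
have ph0 : 0 <= phi eps by apply: le_trans ph; rewrite divr_ge0.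
have G0 : 0 <= G by exact: le_trans G1.
have K0 : 0 <= K by apply: le_trans (bin_const_ge1 R r).
have w0 : 0 <= (2 * r)%:R * (d + r%:R) ^+ r.-1.
  by rewrite mulr_ge0 // exprn_ge0 // addr_ge0 // ltW.
have hG := ler_exponent_mul mu0 s0 w0 ph0 ph h3.
have cw0 : 0 <= cluster_width r xi.
  by rewrite /cluster_width addr_ge0 // divr_ge0 ?mulr_ge0 // ltW.
have [_ hA] := assembly_cluster.
apply: (lower_main assembly_regime) => //.
- exact: leq_ltn_trans (ltnW r2) rn.
- exact: assembly_x_ge.
- exact: assembly_mu_le.
- apply: addr_ge0 => //; rewrite /cluster_const; apply: addr_ge0; last exact: exprn_ge0.
  by apply: addr_ge0 => //; rewrite divr_ge0 ?mulr_ge0 // ltW.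
- by apply: mulr_ge0 => //; apply: mulr_ge0 => //; exact: exprn_ge0.
- by rewrite /tilt_const lerDl mulr_ge0 // divr_ge0 ?(ltW xi0) // !mulr_ge0 ?exprn_ge0.
- by rewrite /packing_const addr_ge0 // divr_ge0 ?(ltW xi0) // !mulr_ge0 ?exprn_ge0.
- move=> d1; apply: le_trans hG _.
  rewrite -[leRHS]mulrA; apply: ler_wpM2l => //.
  rewrite [leRHS]mulrA; apply: ler_wpM2r => //.
  rewrite -mulrA -exprMn; apply: ler_wpM2l => //.
  apply: lerXn2r; rewrite ?nnegrE ?addr_ge0 ?mulr_ge0 ?(ltW p0) //.
  by rewrite -natr1 mulrDl mul1r [leRHS]addrC lerD2l ler_peMr.
- move=> d1; apply: le_trans hG _; rewrite -[leRHS]mulrA; apply: ler_wpM2l => //.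
  apply: ler_wpM2r => //.
  apply: ler_wpM2l => //.
  apply: lerXn2r; rewrite ?nnegrE ?addr_ge0 ?(ltW d0) //.
  by rewrite -natr1 addrC lerD2l.
- move=> d1 ke; rewrite assembly_tail_eq.
  by have [] := lower_tilt r2 rn xi0 xi1 p0 pxi e0 (erefl _) assembly_s2_le d1 assembly_x0 ke.
- move=> d1 J J0 J3 J5 Jn; rewrite assembly_tail_eq.
  by have [] := lower_packing r2 xi0 xi1 p0 pxi e0 mu0 (erefl _) assembly_s2_le d1 J0 J3 J5 Jn.
Qed.

End Assembly.

Theorem theorem2 (R : realType) (r : nat) (hr : (2 <= r)%N) :
  exists2 alpha : R, 0 < alpha &
  forall xi : R, 0 < xi -> xi < 1 ->
  exists c C : R, [/\ 0 < c, 0 < C &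
  forall (n : nat) (p eps : R),
    (1 <= n)%N ->
    0 < p -> p <= 1 - xi ->
    n%:R `^ (- alpha) <= eps ->
    1 <= (1 + eps) * star_mean r n p ->
    (1 + eps) * star_mean r n p <= star_count R r (complete_graph n) ->
    1 <= Phi r n p eps ->
    c * Phi r n p eps <= - ln (star_upper_tail r n p eps) /\
    - ln (star_upper_tail r n p eps) <= C * Phi r n p eps].
Proof.
have r0 : (0 < 16 * r)%N by rewrite muln_gt0 (ltnW hr).
(* With this alpha the scale a = n^alpha satisfies a^(16 r) = n. *)
exists (16 * r)%:R^-1; first by rewrite invr_gt0 ltr0n.
move=> xi xi0 xi1.
set A := cluster_const r xi + 1.
set B := lower_const r (bin_const R r) xi A (4 * ((2 * r)%:R * r.+1%:R ^+ r.-1))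
  (tilt_const r xi) (packing_const r xi).
have fin (T g m : R) : 0 <= g -> 0 <= m -> T <= A * m -> T <= B * g ->
    T <= Num.max 1 (Num.max A B) * Num.min g m.
  have AC : A <= Num.max 1 (Num.max A B) by rewrite !le_max lexx orbT.
  have BC : B <= Num.max 1 (Num.max A B) by rewrite !le_max lexx !orbT.
  move=> g0 m0 hA hB; rewrite /Num.min; case: ifP => _.
    by apply: le_trans hB _; apply: ler_wpM2r.
  by apply: le_trans hA _; apply: ler_wpM2r.
exists (upper_const r (bin_const R r) xi / 5), (Num.max 1 (Num.max A B)); split.
- by rewrite divr_gt0 // upper_const_gt0 ?bin_const_ge1 // ltnW.
- by rewrite lt_max ltr01.
move=> n p eps n1 p0 pxi ea.
have muE : star_mean r n p = #|stars n r|%:R * p ^+ r.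
  by rewrite star_meanE // card_stars.
rewrite star_countE // nstars_complete /Phi star_upper_tailE // star_varE // muE.
move=> m1 mtop; rewrite le_min => /andP[G1 ML1].
pose a : R := n%:R `^ (16 * r)%:R^-1.
have n1R : 1 <= n%:R :> R by rewrite ler1n.
have a1 : 1 <= a by rewrite -(powRr0 (n%:R : R)) ler_powR // invr_ge0.
have an : a ^+ (16 * r) = n%:R.
  by rewrite -powR_mulrn ?powR_ge0 // -powRrM mulVf ?powRr1 // pnatr_eq0 -lt0n.
have {}ea : a^-1 <= eps by rewrite /a -powRN.
split; first exact: (assembly_upper hr n1 xi0 xi1 p0 pxi a1 an ea m1 mtop G1 ML1).
have h1 := proj2 (assembly_cluster hr n1 xi0 xi1 p0 pxi a1 ea m1 mtop G1 ML1).
have h2 := assembly_lower_G hr n1 xi0 xi1 p0 pxi a1 an ea m1 mtop G1 ML1.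
exact: fin (le_trans ler01 G1) (le_trans ler01 ML1) h1 h2.
Qed.
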